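(* Let $\varphi$ be an analytic self-map of $\mathbb{D}$ and $v$ a radial weight. Then $$N_{\varphi,v^\star}(z)=\int_0^1N_\varphi(s,z)\,v(s)\,ds=\int_{|\zeta(z)|}^1\frac{n(r,z)}{r}\,\widehat{v}(r)\,dr,\quad z\ne\varphi(0),$$ where $\zeta(z)$ is a preimage of $z$ under $\varphi$ with the minimum modulus. In particular, $N_{\varphi,v^\star}$ is subharmonic on $\mathbb{D}\setminus\{\varphi(0)\}$.
   Context: $\mathbb{D}=\{z:|z|<1\}$ is the open unit disc in the complex plane. A weight is a nonnegative integrable function on $\mathbb{D}$; it is radial if it depends only on $|z|$. For a radial weight $v$, $\widehat{v}(r)=\int_r^1v(s)\,ds$ for $0\le r<1$, and $v^\star(z)=\int_{|z|}^1v(s)\log\frac{s}{|z|}\,s\,ds$ for $z\in\mathbb{D}\setminus\{0\}$. For an analytic self-map $\varphi$ of $\mathbb{D}$, $z\in\mathbb{D}\setminus\{\varphi(0)\}$ and $0<r<1$, with preimages repeated according to multiplicity: $N_{\varphi,v^\star}(z)=\sum_{\zeta\in\varphi^{-1}(z)}v^\star(\zeta)$ is the generalized Nevanlinna counting function; $n(r,z)=n_\varphi(r,z)$ is the number of preimages of $z$ under $\varphi$ in $D(0,r)=\{\zeta:|\zeta|<r\}$; and $N_\varphi(r,z)=\sum_{\zeta\in\varphi^{-1}(z),\,|\zeta|\le r}\log\frac{r}{|\zeta|}$ is the partial Nevanlinna counting function.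
   Formalization: The printed identities miss a factor s (they fail for φ(z)=z, v=1): the formal statement has N_φ(s,z)v(s)s ds in the first integral and ∫_r^1 v(s)s ds in place of v̂(r) in the second; v* is kept as defined. *)

(* Defs.v *)
(* MathComp-Analysis over R : realType; the complex plane is R[i]. *)
From HB Require Import structures.
From mathcomp Require Import all_boot all_order all_algebra.
From mathcomp Require Import all_classical all_reals all_analysis.
From mathcomp Require Export complex.
Set Implicit Arguments.
Unset Strict Implicit.
Unset Printing Implicit Defensive.
Import Order.TTheory GRing.Theory Num.Theory.
Import numFieldNormedType.Exports.
Local Open Scope classical_set_scope.
Local Open Scope ring_scope.
Local Open Scope complex_scope.

(* The real-valued modulus; `|z| is the same number as an element of R[i]. *)
Notation cmod := ComplexField.Normc.normc.

Definition unit_disc {R : realType} : set R[i] := [set z | cmod z < 1].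

(* Local power series expansion.  The cast to numFieldType selects the topology
   of R[i]. *)
Definition analytic_at {R : realType} (f : R[i] -> R[i]) (a : R[i]) : Prop :=
  exists (c : nat -> R[i]) (rho : R), 0 < rho /\
    forall w : R[i], cmod (w - a) < rho ->
      series (fun n => c n * (w - a) ^+ n : (R[i] : numFieldType)) @ \oo
        --> (f w : (R[i] : numFieldType)).

Definition analytic_self_map {R : realType} (phi : R[i] -> R[i]) : Prop :=
  (forall z, unit_disc z -> analytic_at phi z) /\
  (forall z, unit_disc z -> unit_disc (phi z)).

(* Integrability is with respect to area measure, R[i] being identified with
   R * R.  The values of v outside the disc are irrelevant. *)
Definition weight {R : realType} (v : R[i] -> R) : Prop :=
  (forall z, unit_disc z -> 0 <= v z) /\
  ((@lebesgue_measure R) \x (@lebesgue_measure R))%E.-integrable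
    [set p : R * R | unit_disc (p.1 +i* p.2)]
    (fun p => (v (p.1 +i* p.2))%:E).

Definition radial_weight {R : realType} (v : R[i] -> R) : Prop :=
  weight v /\
  (forall z w, unit_disc z -> unit_disc w -> cmod z = cmod w -> v z = v w).

(* For a radial weight, v(s) with s real means v (s%:C). *)
Definition hat {R : realType} (v : R[i] -> R) (r : R) : \bar R :=
  (\int[lebesgue_measure]_(s in `]r, 1%R[) (v s%:C)%:E)%E.

(* Meaningful for z != 0 only.  The kernel carries the factor s: writing v^* as
   an integral of n(r, z) / r therefore produces the tail integral of s * v(s),
   i.e. hat (fun w => v w * cmod w), not hat v. *)
Definition vstar {R : realType} (v : R[i] -> R) (z : R[i]) : \bar R :=
  (\int[lebesgue_measure]_(s in `]cmod z, 1%R[)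
     (v s%:C * ln (s / cmod z) * s)%:E)%E.

(* The order of the zero of f at a.  When f vanishes identically near a there is
   no such m and the value is the default 0; for f = phi - z at a preimage of z
   this needs phi constant on the disc, and then z = phi 0. *)
Definition zero_order {R : realType} (f : R[i] -> R[i]) (a : R[i]) : nat :=
  xget 0%N [set m | exists g : R[i] -> R[i],
    [/\ analytic_at g a, g a <> 0 &
        exists2 rho : R, 0 < rho &
          forall w, cmod (w - a) < rho -> f w = (w - a) ^+ m * g w]].

Definition multiplicity {R : realType} (phi : R[i] -> R[i]) (zeta : R[i]) : nat :=
  zero_order (fun w => phi w - phi zeta) zeta.

Definition preimages {R : realType} (phi : R[i] -> R[i]) (z : R[i]) : set R[i] :=
  [set zeta | unit_disc zeta /\ phi zeta = z].

Definition gen_counting {R : realType} (phi : R[i] -> R[i])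
    (w : R[i] -> \bar R) (z : R[i]) : \bar R :=
  (\esum_(zeta in preimages phi z) ((multiplicity phi zeta)%:R%:E * w zeta))%E.

Definition num_preimages {R : realType} (phi : R[i] -> R[i]) (r : R) (z : R[i]) :
    \bar R :=
  (\esum_(zeta in preimages phi z `&` [set zeta | (cmod zeta < r)%R])
     (multiplicity phi zeta)%:R%:E)%E.

Definition partial_counting {R : realType} (phi : R[i] -> R[i]) (r : R)
    (z : R[i]) : \bar R :=
  (\esum_(zeta in preimages phi z `&` [set zeta | (cmod zeta <= r)%R])
     ((multiplicity phi zeta)%:R * ln (r / cmod zeta))%:E)%E.

Definition is_min_preimage {R : realType} (phi : R[i] -> R[i]) (z zeta : R[i]) :
    Prop :=
  preimages phi z zeta /\
  forall xi, preimages phi z xi -> cmod zeta <= cmod xi.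

(* A chosen preimage of minimal modulus; the default 0 is used when z has no
   preimage, in which case num_preimages phi r z = 0 for all r. *)
Definition min_preimage {R : realType} (phi : R[i] -> R[i]) (z : R[i]) : R[i] :=
  xget 0 [set zeta | is_min_preimage phi z zeta].

(* Upper semicontinuous with values in [-oo, +oo) and satisfying the sub-mean
   value inequality on every closed disc contained in the open set Omega. *)
Definition subharmonic_on {R : realType} (Omega : set R[i]) (u : R[i] -> \bar R) :
    Prop :=
  [/\ forall z, Omega z -> (u z < +oo)%E,
      forall (z : R[i]) (c : R), Omega z -> (u z < c%:E)%E ->
        \forall w \near (z : (R[i] : numFieldType)), (u w < c%:E)%E &
      forall (a : R[i]) (rho : R), 0 < rho ->
        (forall w, cmod (w - a) <= rho -> Omega w) ->
        (u a <= ((2 * pi)^-1)%:E *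
           \int[lebesgue_measure]_(t in `[0%R, (2 * pi)%R])
             u (a + (rho * cos t +i* (rho * sin t))%C)%R)%E].

(* Main.v *)
(** A preimage [b] of [z] contributes [log (s / |b|)] to [N_phi(s, z)] as soon as
    [|b| < s]; integrating this against [s v(s) ds] gives [v^\star(b)], and writing
    [log (s / |b|)] as the integral of [dr / r] over [(|b|, s)] and exchanging the
    integrals gives the formula in terms of [n(r, z)].

    For the subharmonicity, let [k(x) = log (2 / x)], which is nonnegative on
    [(0, 2]].  Jensen's formula for [phi - z] reads, for all but countably many [s],
      [N_phi(s, z) + mean_t k(|phi(s e^(it)) - z|) = k(|phi(0) - z|)],
    and integrating it against [s v(s) ds] gives
      [N_{phi, v^\star}(z) + I(z) = V k(|phi(0) - z|)],
    where [V] is the integral of [s v(s)], which is finite, and [I] is a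
    superposition of the functions [k(|w - z|)].  The right-hand side is continuous
    and has the mean value property away from [phi(0)], while [I] is lower
    semicontinuous by Fatou's lemma and superharmonic by Tonelli's theorem. *)

Require Import Defs.
From HB Require Import structures.
From mathcomp Require Import all_boot all_order all_algebra.
From mathcomp Require Import all_classical all_reals all_analysis.
From mathcomp Require Import measurable_realfun finmap ring lra.
Set Implicit Arguments.
Unset Strict Implicit.
Unset Printing Implicit Defensive.
Import Order.TTheory GRing.Theory Num.Theory.
Import numFieldNormedType.Exports.
Local Open Scope classical_set_scope.
Local Open Scope ring_scope.
Local Open Scope complex_scope.
Local Notation Re := (@complex.Re _).
Local Notation Im := (@complex.Im _).

(** Two constraints shape the proof. Analyticity is given by local power series, but quotients such
    as [g' / g] would call for products and inverses of series. Series therefore serve only to split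
    off zeros and to obtain complex differentiability of finite order, which the elementary rules
    then propagate. Two orders are enough: the mean value property of [log |g|] for a zero-free [g]
    is proved with real variables, by differentiating circular means in the radius and integrating a
    periodic derivative in the angle. Neither a contour integral nor a branch of the logarithm
    occurs.

    The other constraint is that the counting function is a difference, so [I] has to be finite
    before it can be subtracted. The constant 2 in the kernel bounds the distance of two points of
    the disc; with the kernel nonnegative, its superpositions need only Tonelli and Fatou, and the
    finiteness of both summands is read off their sum. This rests on the finiteness of [V], which
    the integrability of the weight over the disc provides. *)

Section ComplexModulus.
Variable R : realType.
Implicit Types (z w : R[i]) (x y : R).

Lemma normcE z : `|z| = (cmod z)%:C.
Proof. by []. Qed.

Lemma cmod_ge0 z : 0 <= cmod z.
Proof. by rewrite -ler0c -normcE. Qed.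

Lemma cmod0 : cmod (0 : R[i]) = 0.
Proof. exact: ComplexField.Normc.normc0. Qed.

Lemma cmod1 : cmod (1 : R[i]) = 1.
Proof. exact: ComplexField.Normc.normc1. Qed.

Lemma cmod_eq0 z : (cmod z == 0) = (z == 0).
Proof.
by apply/eqP/eqP => [/ComplexField.Normc.eq0_normc//|->]; rewrite cmod0.
Qed.

Lemma cmod_gt0 z : (0 < cmod z) = (z != 0).
Proof. by rewrite lt_neqAle cmod_ge0 andbT eq_sym cmod_eq0. Qed.

Lemma cmodM z w : cmod (z * w) = cmod z * cmod w.
Proof. exact: ComplexField.Normc.normcM. Qed.

Lemma cmodV z : cmod z^-1 = (cmod z)^-1.
Proof. exact: ComplexField.Normc.normcV. Qed.

Lemma cmodX z n : cmod (z ^+ n) = cmod z ^+ n.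
Proof. by elim: n => [|n ih]; rewrite ?expr0 ?cmod1// !exprS cmodM ih. Qed.

Lemma cmodN z : cmod (- z) = cmod z.
Proof. exact: normcN. Qed.

Lemma cmod_distC z w : cmod (z - w) = cmod (w - z).
Proof. by rewrite -cmodN opprB. Qed.

Lemma cmodD z w : cmod (z + w) <= cmod z + cmod w.
Proof. exact: le_normcD. Qed.

Lemma cmod_triangle u z w : cmod (z - w) <= cmod (z - u) + cmod (u - w).
Proof. by rewrite (_ : z - w = (z - u) + (u - w)) ?cmodD//; ring. Qed.

Lemma cmod_leB z w : cmod z - cmod w <= cmod (z - w).
Proof. by rewrite lerBlDr (le_trans _ (cmodD _ _))// subrK. Qed.

Lemma cmodE x y : cmod (x +i* y) = Num.sqrt (x ^+ 2 + y ^+ 2).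
Proof. by []. Qed.

Lemma cmod_real x : cmod x%:C = `|x|.
Proof. by rewrite cmodE expr0n addr0 sqrtr_sqr. Qed.

Lemma cmod_sqr z : cmod z ^+ 2 = Re z ^+ 2 + Im z ^+ 2.
Proof. by case: z => x y; rewrite cmodE sqr_sqrtr ?addr_ge0 ?sqr_ge0. Qed.

Lemma Re_le_cmod z : `|Re z| <= cmod z.
Proof.
rewrite -(ler_pXn2r (n := 2)) ?nnegrE ?cmod_ge0//.
by rewrite real_normK ?num_real// cmod_sqr lerDl sqr_ge0.
Qed.

Lemma Im_le_cmod z : `|Im z| <= cmod z.
Proof.
rewrite -(ler_pXn2r (n := 2)) ?nnegrE ?cmod_ge0//.
by rewrite real_normK ?num_real// cmod_sqr lerDr sqr_ge0.
Qed.

Lemma cmod_le_ReIm z : cmod z <= `|Re z| + `|Im z|.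
Proof.
rewrite -(ler_pXn2r (n := 2)) ?nnegrE ?cmod_ge0 ?addr_ge0//.
rewrite cmod_sqr sqrrD !real_normK ?num_real// lerD2r lerDl.
by rewrite mulrn_wge0// mulr_ge0.
Qed.

Lemma ReB z w : Re (z - w) = Re z - Re w.
Proof. by case: z w => [? ?] [? ?]. Qed.

Lemma ImB z w : Im (z - w) = Im z - Im w.
Proof. by case: z w => [? ?] [? ?]. Qed.

Lemma ReM z w : Re (z * w) = Re z * Re w - Im z * Im w.
Proof. by case: z w => [? ?] [? ?]. Qed.

Lemma ImM z w : Im (z * w) = Re z * Im w + Im z * Re w.
Proof. by case: z w => [? ?] [? ?]. Qed.

Lemma cmod_sum n (F : nat -> R[i]) :
  cmod (\sum_(i < n) F i) <= \sum_(i < n) cmod (F i).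
Proof.
elim: n => [|n ih]; first by rewrite !big_ord0 cmod0.
by rewrite !big_ord_recr/= (le_trans (cmodD _ _))// lerD2r.
Qed.

(** Balls of [R[i]] have radii in [R[i]], but the order there makes a positive radius real; this
    passes between them and real radii. *)
Lemma nbhs_cmod (a : R[i]) (P : set R[i]) :
  nbhs (a : (R[i] : numFieldType)) P <->
  exists2 d, 0 < d & forall w, cmod (w - a) < d -> P w.
Proof.
split=> [/nbhs_ballP[e /= e0 h]|[d d0 h]].
  have ee : e = (Re e)%:C.
    by move: e0; case: e {h} => x y; rewrite ltcE /= => /andP[/eqP->].
  exists (Re e); first by move: e0; rewrite ee ltcR.
  move=> w wd; apply: h => /=; rewrite -ball_normE /=.
  by rewrite normcE cmod_distC ee ltcR.
apply/nbhs_ballP; exists d%:C; first by rewrite /= ltcR.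
move=> w; rewrite -ball_normE /= normcE cmod_distC ltcR; exact: h.
Qed.

Lemma cvg_cmodP (u : nat -> R[i]) (l : R[i]) :
  (u : nat -> (R[i] : numFieldType)) @ \oo --> (l : (R[i] : numFieldType)) <->
  forall e, 0 < e -> exists N, forall n, (N <= n)%N -> cmod (u n - l) < e.
Proof.
split=> [h e e0|h].
  have /h [N _ hN] : nbhs (l : (R[i] : numFieldType)) [set w | cmod (w - l) < e].
    by apply/nbhs_cmod; exists e.
  by exists N => n; exact: hN.
move=> P /nbhs_cmod[d d0 dP]; have [N hN] := h _ d0.
by exists N => // n /= Nn; apply: dP; exact: hN.
Qed.

Lemma le_cvg_cmod (u : nat -> R[i]) (l : R[i]) (M : R) :
  (u : nat -> (R[i] : numFieldType)) @ \oo --> (l : (R[i] : numFieldType)) ->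
  (forall n, cmod (u n) <= M) -> cmod l <= M.
Proof.
move=> /cvg_cmodP ul uM; apply/ler_addgt0Pr => e e0.
have [N hN] := ul _ e0; have := cmod_leB l (u N); rewrite cmod_distC.
by have := hN N (leqnn _); have := uM N; lra.
Qed.

Lemma cvg_cmod_unique (u : nat -> R[i]) (l l' : R[i]) :
  (u : nat -> (R[i] : numFieldType)) @ \oo --> (l : (R[i] : numFieldType)) ->
  (u : nat -> (R[i] : numFieldType)) @ \oo --> (l' : (R[i] : numFieldType)) ->
  l = l'.
Proof. exact: (@cvg_unique (R[i] : numFieldType)). Qed.

Lemma cvg_ReIm (u : nat -> R[i]) (x y : R) :
  (Re \o u) @ \oo --> x -> (Im \o u) @ \oo --> y ->
  (u : nat -> (R[i] : numFieldType)) @ \oo --> (x +i* y : (R[i] : numFieldType)).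
Proof.
move=> ux uy; apply/cvg_cmodP => e e0.
have e2 : 0 < e / 2 by rewrite divr_gt0.
have /cvgrPdist_lt/(_ _ e2)[N1 _ h1] := ux.
have /cvgrPdist_lt/(_ _ e2)[N2 _ h2] := uy.
exists (maxn N1 N2) => n; rewrite geq_max => /andP[n1 n2].
have := h1 _ n1; have := h2 _ n2; rewrite /= distrC => + .
rewrite [in X in _ -> X -> _]distrC => hy hx.
apply: (le_lt_trans (cmod_le_ReIm _)); rewrite ReB ImB/=.
by rewrite (splitr e) ltrD.
Qed.

End ComplexModulus.

(** * Complex differentiability *)

Local Notation cnbhs a := (nbhs (a : (_[i] : numFieldType))).

Section ComplexDerivative.
Variable R : realType.
Implicit Types (f g : R[i] -> R[i]) (a z w l m : R[i]) (e d : R).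

Definition ccont f a :=
  forall e, 0 < e -> cnbhs a [set w | cmod (f w - f a) < e].

(** Differentiability as a first-order expansion: no quotient is formed, so the point [a] needs no
    exclusion. *)
Definition cder f a l := forall e, 0 < e ->
  cnbhs a [set w | cmod (f w - f a - l * (w - a)) <= e * cmod (w - a)].

Definition cD f a : R[i] := xget 0 [set l | cder f a l].

Lemma cnbhsE a (P : set R[i]) : (forall w, P w) -> cnbhs a P.
Proof. by move=> hP; apply/nbhs_cmod; exists 1. Qed.

Lemma cnbhsI a (P Q : set R[i]) :
  cnbhs a P -> cnbhs a Q -> cnbhs a [set w | P w /\ Q w].
Proof. exact: filterI. Qed.

Lemma cnbhsS a (P Q : set R[i]) :
  (forall w, P w -> Q w) -> cnbhs a P -> cnbhs a Q.
Proof. by move=> h; exact: filterS. Qed.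

Lemma cnbhs_center a (P : set R[i]) : cnbhs a P -> P a.
Proof. by move=> /nbhs_cmod[d d0]; apply; rewrite subrr cmod0. Qed.

Lemma cnbhs_ball a d : 0 < d -> cnbhs a [set w | cmod (w - a) < d].
Proof. by move=> d0; apply/nbhs_cmod; exists d. Qed.

Lemma cnbhs_open a (P : set R[i]) : cnbhs a P -> cnbhs a [set z | cnbhs z P].
Proof.
move=> /nbhs_cmod[d d0 dP]; apply/nbhs_cmod; exists d => // z zd.
apply/nbhs_cmod; exists (d - cmod (z - a)); first by rewrite subr_gt0.
move=> w wz; apply: dP; apply: (le_lt_trans (cmod_triangle z _ _)).
by rewrite -ltrBrDr.
Qed.

Lemma ccont_ext f g a : cnbhs a [set w | f w = g w] -> ccont f a -> ccont g a.
Proof.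
move=> fg cf e /cf h; have /= fga := cnbhs_center fg.
by apply: cnbhsS (cnbhsI fg h) => w /= [<-]; rewrite fga.
Qed.

Lemma cder_ext f g a l : cnbhs a [set w | f w = g w] -> cder f a l -> cder g a l.
Proof.
move=> fg cf e /cf h; have /= fga := cnbhs_center fg.
by apply: cnbhsS (cnbhsI fg h) => w /= [<-]; rewrite fga.
Qed.

Lemma cder_unique f a l m : cder f a l -> cder f a m -> l = m.
Proof.
move=> fl fm; apply/eqP; rewrite -subr_eq0 -cmod_eq0 eq_le cmod_ge0 andbT.
apply/ler_addgt0Pr => e e0; rewrite add0r.
have e2 : 0 < e / 2 by rewrite divr_gt0.
have [d d0 h] := (nbhs_cmod _ _).1 (cnbhsI (fl _ e2) (fm _ e2)).
pose w := a + (d / 2)%:C.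
have wa : cmod (w - a) = d / 2.
  by rewrite /w addrC addKr cmod_real ger0_norm//; lra.
have [/= h1 h2] : _ /\ _ := h w ltac:(rewrite wa; lra).
have d2 : 0 < d / 2 by lra.
rewrite -(ler_pM2r d2) -wa -cmodM.
rewrite (_ : (l - m) * _ = (f w - f a - m * (w - a)) - (f w - f a - l * (w - a)));
  last by ring.
by apply: (le_trans (cmodD _ _)); rewrite cmodN; lra.
Qed.

Lemma cD_val f a l : cder f a l -> cD f a = l.
Proof.
move=> fl; apply: (@cder_unique f a) => //.
by rewrite /cD; case: xgetP => [m _ //|/(_ l)].
Qed.

Lemma cder_cD f a l : cder f a l -> cder f a (cD f a).
Proof. by move=> h; rewrite (cD_val h). Qed.

Lemma cder_cont f a l : cder f a l -> ccont f a.
Proof.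
move=> fl e e0; have K0 : 0 < 1 + cmod l by rewrite ltr_pwDl ?cmod_ge0.
have h := cnbhs_ball a (divr_gt0 e0 K0).
apply: cnbhsS (cnbhsI h (fl _ ltr01)) => w /= [].
rewrite ltr_pdivlMr// => h1 h2.
have := cmod_leB (f w - f a) (l * (w - a)); rewrite cmodM.
by have := cmod_ge0 (w - a); nra.
Qed.

Lemma ccont_cst z a : ccont (fun=> z) a.
Proof. by move=> e e0; apply: cnbhsE => w /=; rewrite subrr cmod0. Qed.

Lemma ccont_id a : ccont id a.
Proof. by move=> e e0; exact: cnbhs_ball. Qed.

Lemma ccontD f g a : ccont f a -> ccont g a -> ccont (fun w => f w + g w) a.
Proof.
move=> cf cg e e0; have e2 : 0 < e / 2 by rewrite divr_gt0.
apply: cnbhsS (cnbhsI (cf _ e2) (cg _ e2)) => w /= [h1 h2].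
rewrite (_ : _ - _ = (f w - f a) + (g w - g a)); last by ring.
by apply: (le_lt_trans (cmodD _ _)); lra.
Qed.

Lemma ccontM f g a : ccont f a -> ccont g a -> ccont (fun w => f w * g w) a.
Proof.
move=> cf cg e e0.
have K1 : 0 < cmod (g a) + 1 by rewrite ltr_wpDl ?cmod_ge0.
have K2 : 0 < cmod (f a) + 1 by rewrite ltr_wpDl ?cmod_ge0.
have e1 : 0 < e / 2 / (cmod (g a) + 1) by rewrite !divr_gt0.
have e2 : 0 < e / 2 / (cmod (f a) + 1) by rewrite !divr_gt0.
have h := cnbhsI (cf _ e1) (cnbhsI (cg _ e2) (cg _ ltr01)).
apply: cnbhsS h => w /= [+ [+ h3]].
rewrite !ltr_pdivlMr// => h1 h2.
rewrite (_ : _ - _ = (f w - f a) * g w + f a * (g w - g a)); last by ring.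
apply: (le_lt_trans (cmodD _ _)); rewrite !cmodM.
have := cmod_leB (g w) (g a) => h4.
have := cmod_ge0 (f w - f a); have := cmod_ge0 (g w - g a).
have := cmod_ge0 (f a); nra.
Qed.

Lemma ccontV f a : f a != 0 -> ccont f a -> ccont (fun w => (f w)^-1) a.
Proof.
move=> fa0 cf e e0; have k0 : 0 < cmod (f a) by rewrite cmod_gt0.
have k2 : 0 < cmod (f a) / 2 by rewrite divr_gt0.
have e1 : 0 < e * (cmod (f a) / 2) * cmod (f a) by rewrite !mulr_gt0.
apply: cnbhsS (cnbhsI (cf _ k2) (cf _ e1)) => w /= [h1 h2].
have h3 : cmod (f a) / 2 < cmod (f w).
  by have := cmod_leB (f a) (f w); rewrite cmod_distC; lra.
have fw0 : f w != 0 by rewrite -cmod_gt0; lra.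
rewrite (_ : _ - _ = - ((f w - f a) / (f w * f a))); last by field; rewrite fa0 fw0.
rewrite cmodN cmodM cmodV cmodM ltr_pdivrMr; last by rewrite mulr_gt0// cmod_gt0.
by apply: (lt_le_trans h2); rewrite -mulrA ler_pM2l// ler_pM2r// ltW.
Qed.

Lemma cder_cst z a : cder (fun=> z) a 0.
Proof.
move=> e e0; apply: cnbhsE => w /=.
by rewrite subrr mul0r subr0 cmod0 mulr_ge0 ?cmod_ge0 ?ltW.
Qed.

Lemma cder_id a : cder id a 1.
Proof.
move=> e e0; apply: cnbhsE => w /=.
by rewrite mul1r subrr cmod0 mulr_ge0 ?cmod_ge0 ?ltW.
Qed.

Lemma cderD f g a l m :
  cder f a l -> cder g a m -> cder (fun w => f w + g w) a (l + m).
Proof.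
move=> cf cg e e0; have e2 : 0 < e / 2 by rewrite divr_gt0.
apply: cnbhsS (cnbhsI (cf _ e2) (cg _ e2)) => w /= [h1 h2].
rewrite (_ : _ - _ - _ = (f w - f a - l * (w - a)) + (g w - g a - m * (w - a)));
  last by ring.
by apply: (le_trans (cmodD _ _)); lra.
Qed.

Lemma cderM f g a l m : cder f a l -> cder g a m ->
  cder (fun w => f w * g w) a (l * g a + f a * m).
Proof.
move=> cf cg e e0.
have K1 : 0 < cmod (g a) + 1 by rewrite ltr_wpDl ?cmod_ge0.
have K2 : 0 < cmod (f a) + 1 by rewrite ltr_wpDl ?cmod_ge0.
have K3 : 0 < cmod l + 1 by rewrite ltr_wpDl ?cmod_ge0.
have e1 : 0 < e / 3 / (cmod (g a) + 1) by rewrite !divr_gt0.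
have e2 : 0 < e / 3 / (cmod (f a) + 1) by rewrite !divr_gt0.
have e3 : 0 < e / 3 / (cmod l + 1) by rewrite !divr_gt0.
have h := cnbhsI (cf _ e1) (cnbhsI (cg _ e2)
  (cnbhsI (cder_cont cg ltr01) (cder_cont cg e3))).
apply: cnbhsS h => w /= [h1 [h2 [h3 h4]]]; rewrite ltr_pdivlMr// in h4.
rewrite (_ : _ - _ - _ = (f w - f a - l * (w - a)) * g w
  + l * (w - a) * (g w - g a) + f a * (g w - g a - m * (w - a))); last by ring.
have h5 : cmod (g w) <= cmod (g a) + 1 by have := cmod_leB (g w) (g a); lra.
set D := cmod (w - a) in h1 h2 *.
have D0 : 0 <= D by exact: cmod_ge0.
apply: (le_trans (cmodD _ _)); rewrite [leRHS](_ : _ = e / 3 * D + e / 3 * D + e / 3 * D);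
  last by field.
apply: lerD.
  apply: (le_trans (cmodD _ _)); rewrite !cmodM -/D; apply: lerD.
    apply: (le_trans (ler_pM _ _ h1 h5)); rewrite ?cmod_ge0//.
    by rewrite mulrAC divfK ?gt_eqF.
  by have := cmod_ge0 l; have := cmod_ge0 (g w - g a); nra.
rewrite cmodM; apply: (le_trans (ler_wpM2l (cmod_ge0 _) h2)).
rewrite mulrA ler_wpM2r// mulrA ler_pdivrMr// mulrC ler_wpM2l//; lra.
Qed.

Lemma cderV f a l : f a != 0 -> cder f a l ->
  cder (fun w => (f w)^-1) a (- l / f a ^+ 2).
Proof.
move=> fa0 cf e e0.
have cV := ccontV fa0 (cder_cont cf).
have nz : cnbhs a [set w | f w != 0].
  have k0 : 0 < cmod (f a) by rewrite cmod_gt0.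
  apply: cnbhsS (cder_cont cf k0) => w /= h.
  by apply/eqP => fw; move: h; rewrite fw sub0r cmodN ltxx.
pose h w := (f w)^-1.
have K1 : 0 < (cmod (h a) + 1) * (cmod (h a) + 1).
  by rewrite mulr_gt0// ltr_wpDl ?cmod_ge0.
have K2 : 0 < cmod l * cmod (h a) + 1 by rewrite ltr_wpDl ?mulr_ge0 ?cmod_ge0.
have e1 : 0 < e / 2 / ((cmod (h a) + 1) * (cmod (h a) + 1)) by rewrite !divr_gt0.
have e2 : 0 < e / 2 / (cmod l * cmod (h a) + 1) by rewrite !divr_gt0.
have F := cnbhsI nz (cnbhsI (cf _ e1) (cnbhsI (cV _ e2) (cV _ ltr01))).
apply: cnbhsS F => w /= [fw0 [h1 [h2 h3]]]; rewrite ltr_pdivlMr// in h2.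
rewrite (_ : _ - _ - _ = - (f w - f a - l * (w - a)) * (h w * h a)
   - l * (w - a) * h a * (h w - h a)); last by rewrite /h; field; rewrite fa0 fw0.
have h5 : cmod (h w) <= cmod (h a) + 1.
  by have := cmod_leB (h w) (h a); rewrite /h; lra.
set D := cmod (w - a) in h1 *.
have D0 : 0 <= D by exact: cmod_ge0.
apply: (le_trans (cmodD _ _)); rewrite [leRHS](_ : _ = e / 2 * D + e / 2 * D);
  last by field.
rewrite cmodN !cmodM cmodN -/D; apply: lerD.
  have h6 : cmod (h w) * cmod (h a) <= (cmod (h a) + 1) * (cmod (h a) + 1).
    by rewrite ler_pM ?cmod_ge0// lerDl.
  apply: (le_trans (ler_pM _ _ h1 h6)); rewrite ?mulr_ge0 ?cmod_ge0//.
  by rewrite mulrAC divfK ?gt_eqF.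
have := cmod_ge0 (h w - h a); rewrite -/(h w) -/(h a) in h2 *.
have := cmod_ge0 l; have := cmod_ge0 (h a).
move=> ha0 l0 hh0.
have X : cmod l * cmod (h a) * cmod (h w - h a) <= e / 2.
  by have := mulr_ge0 l0 ha0; nra.
by move: (ler_wpM2r D0 X); rewrite [X in X <= _ -> _](_ : _ =
  cmod l * D * cmod (h a) * cmod (h w - h a)) //; ring.
Qed.

(** The class C^n at [a] in the complex sense. It depends only on the germ of [f], and the product
    and quotient rules make it stable under products and inverses, which would be laborious for
    [analytic_at]. *)
Fixpoint cdiff n f a : Prop :=
  if n is n'.+1 then cnbhs a [set z | cder f z (cD f z)] /\ cdiff n' (cD f) a
  else ccont f a.

Lemma cdiff_ext n f g a : cnbhs a [set w | f w = g w] ->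
  cdiff n f a -> cdiff n g a.
Proof.
elim: n f g => [|n ih] f g fg /=; first exact: ccont_ext.
move=> [h1 h2].
have fg' := cnbhs_open fg.
have DD : cnbhs a [set z | cD f z = cD g z].
  apply: cnbhsS (cnbhsI fg' h1) => z /= [h3 h4].
  by rewrite (cD_val (cder_ext h3 h4)).
split; last by apply: ih h2.
apply: cnbhsS (cnbhsI fg' h1) => z /= [h3 h4].
exact/cder_cD/(cder_ext h3 h4).
Qed.

(** Lets an explicit derivative stand in for the chosen [cD f]: the two agree near [a], which is all
    that [cdiff] sees. *)
Lemma cdiffS n f a (f' : R[i] -> R[i]) :
  cnbhs a [set z | cder f z (f' z)] -> cdiff n f' a -> cdiff n.+1 f a.
Proof.
move=> h1 h2; split; first by apply: cnbhsS h1 => z /=; exact: cder_cD.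
by apply: cdiff_ext h2; apply: cnbhsS h1 => z /= /cD_val.
Qed.

Lemma cdiffW n f a : cdiff n.+1 f a -> cdiff n f a.
Proof.
elim: n f => [|n ih] f /= [h1 h2]; last by split => //; exact: ih.
have /= := cnbhs_center h1; exact: cder_cont.
Qed.

Lemma cdiff_le (n k : nat) f a : (k <= n)%N -> cdiff n f a -> cdiff k f a.
Proof. by move=> /subnK <-; elim: (n - k)%N => // j ih /cdiffW /ih. Qed.

Lemma cdiff_cont n f a : cdiff n f a -> ccont f a.
Proof. exact: cdiff_le (leq0n n). Qed.

Lemma cdiff_cst n z a : cdiff n (fun=> z) a.
Proof.
elim: n z => [|n ih] z; first exact: ccont_cst.
by apply: cdiffS (ih 0); apply: cnbhsE => w; exact: cder_cst.
Qed.

Lemma cdiff_id n a : cdiff n id a.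
Proof.
case: n => [|n]; first exact: ccont_id.
by apply: (@cdiffS _ _ _ (fun=> 1)); [apply: cnbhsE => w; exact: cder_id|
  exact: cdiff_cst].
Qed.

Lemma cdiffD n f g a :
  cdiff n f a -> cdiff n g a -> cdiff n (fun w => f w + g w) a.
Proof.
elim: n f g => [|n ih] f g; first exact: ccontD.
move=> [f1 f2] [g1 g2]; apply: cdiffS (ih _ _ f2 g2).
by apply: cnbhsS (cnbhsI f1 g1) => z /= [? ?]; exact: cderD.
Qed.

Lemma cdiffM n f g a :
  cdiff n f a -> cdiff n g a -> cdiff n (fun w => f w * g w) a.
Proof.
elim: n f g => [|n ih] f g; first exact: ccontM.
move=> hf hg; have [f1 f2] := hf; have [g1 g2] := hg.
apply: cdiffS (cdiffD (ih _ _ f2 (cdiffW hg)) (ih _ _ (cdiffW hf) g2)).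
by apply: cnbhsS (cnbhsI f1 g1) => z /= [? ?]; exact: cderM.
Qed.

Lemma ccont_neq0 f a : ccont f a -> f a != 0 -> cnbhs a [set w | f w != 0].
Proof.
move=> cf fa0; have k0 : 0 < cmod (f a) by rewrite cmod_gt0.
apply: cnbhsS (cf _ k0) => w /= h.
by apply/eqP => fw; move: h; rewrite fw sub0r cmodN ltxx.
Qed.

Lemma cdiffV n f a : f a != 0 -> cdiff n f a -> cdiff n (fun w => (f w)^-1) a.
Proof.
move=> fa0; elim: n => [|n ih]; first exact: ccontV.
move=> hf; have [f1 f2] := hf; have V := ih (cdiffW hf).
apply: (@cdiffS _ _ _ (fun z => (-1 * cD f z) * ((f z)^-1 * (f z)^-1))).
  have nz := ccont_neq0 (cdiff_cont hf) fa0.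
  apply: cnbhsS (cnbhsI f1 nz) => z /= [h1 h2].
  have := cderV h2 h1; congr cder.
  by field.
by do 2?[apply: cdiffM => //]; exact: cdiff_cst.
Qed.

Lemma cdiffX n f a k : cdiff n f a -> cdiff n (fun w => f w ^+ k) a.
Proof.
move=> hf; elim: k => [|k ih]; first exact: cdiff_cst.
apply: cdiff_ext (cdiffM hf ih).
by apply: cnbhsE => w /=; rewrite exprS.
Qed.

Lemma cdiff_prod n a (I : Type) (s : seq I) (F : I -> R[i] -> R[i]) :
  (forall i, cdiff n (F i) a) -> cdiff n (fun w => \prod_(i <- s) F i w) a.
Proof.
move=> hF; elim: s => [|i s ih].
  by apply: cdiff_ext (cdiff_cst n 1 a); apply: cnbhsE => w /=; rewrite big_nil.
apply: cdiff_ext (cdiffM (hF i) ih).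
by apply: cnbhsE => w /=; rewrite big_cons.
Qed.

End ComplexDerivative.

(** * Power series *)

Section PowerSeries.
Variable R : realType.
Implicit Types (f g : R[i] -> R[i]) (a z w u : R[i]) (c : nat -> R[i]) (r e : R).

Lemma geometric_sum_le r n : 0 <= r -> r < 1 ->
  \sum_(i < n) r ^+ i <= (1 - r)^-1.
Proof.
move=> r0 r1; have d0 : 0 < 1 - r by lra.
rewrite -(ler_pM2l d0) divff ?gt_eqF// -opprB mulNr -subrX1 opprB.
by rewrite gerBl exprn_ge0.
Qed.

(** Each of the [n] powers [r ^+ i] with [i < n] is at least [r ^+ n], so the geometric sum
    dominates. *)
Lemma natX_le r n : 0 <= r -> r < 1 -> n%:R * r ^+ n <= (1 - r)^-1.
Proof.
move=> r0 r1; apply: le_trans (geometric_sum_le n r0 r1).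
rewrite mulr_natl -[n in _ *+ n]card_ord -sumr_const; apply: ler_sum => i _.
apply: ler_wiXn2l => //; [exact: ltW | exact: ltnW (ltn_ord i)].
Qed.

(** The partial sums of [|Re|] and of [|Im|] are monotone and bounded by [M], so both real series
    converge absolutely. *)
Lemma series_abs_cvg (u : nat -> R[i]) (M : R) :
  (forall n, \sum_(i < n) cmod (u i) <= M) ->
  exists l, series (u : nat -> (R[i] : numFieldType)) @ \oo -->
    (l : (R[i] : numFieldType)).
Proof.
move=> uM.
have H (p : R[i] -> R) : {morph p : x y / x + y} -> p 0 = 0 ->
    (forall z, `|p z| <= cmod z) ->
    exists l : R, (fun n => p (series (u : nat -> (R[i] : numFieldType)) n)) @ \oo --> l.
  move=> pD p0 ple.
  have E : (fun n => p (series (u : nat -> (R[i] : numFieldType)) n)) =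
           series (fun n => p (u n)).
    apply/funext => n; rewrite /series /= !big_mkord.
    by apply: (big_morph p pD p0).
  rewrite E; exists (limn (series (fun n => p (u n)))).
  apply: normed_cvg; apply: nondecreasing_is_cvgn.
    by apply/nondecreasing_seqP => n; rewrite -subr_ge0 seriesSB; exact: normr_ge0.
  exists M => _ [n _ <-]; rewrite /= /series /= big_mkord; apply: le_trans (uM n).
  by apply: ler_sum => i _; exact: ple.
have [x hx] := H Re (fun a b => ltac:(by case: a b => [? ?] [? ?])) erefl (@Re_le_cmod R).
have [y hy] := H Im (fun a b => ltac:(by case: a b => [? ?] [? ?])) erefl (@Im_le_cmod R).
by exists (x +i* y); exact: cvg_ReIm.
Qed.

Definition psum c a (rho : R) f := forall w, cmod (w - a) < rho ->
  series (fun n => c n * (w - a) ^+ n : (R[i] : numFieldType)) @ \oo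
    --> (f w : (R[i] : numFieldType)).

(** At the point [a + r] every late term is the difference of two consecutive partial sums within 1
    of the limit, hence at most 2; the finitely many early terms are simply added to the bound. *)
Lemma psum_coef_bound c a rho f r : psum c a rho f -> 0 < r -> r < rho ->
  exists2 B, 0 <= B & forall n, cmod (c n) * r ^+ n <= B.
Proof.
move=> cf r0 rrho; have wa : cmod (a + r%:C - a) = r.
  by rewrite addrC addKr cmod_real gtr0_norm.
have := cf (a + r%:C); rewrite wa => /(_ rrho)/cvg_cmodP/(_ 1 ltr01)[N hN].
set t := fun n => _ in hN.
have ct n : cmod (t n) = cmod (c n) * r ^+ n by rewrite /t cmodM cmodX wa.
exists (2 + \sum_(i < N) cmod (t i)).
  by rewrite addr_ge0// sumr_ge0// => i _; exact: cmod_ge0.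
move=> n; rewrite -ct; have [nN|Nn] := ltnP n N.
  rewrite (bigD1 (Ordinal nN))//= addrCA lerDl addr_ge0// sumr_ge0// => i _.
  exact: cmod_ge0.
have -> : t n = series t n.+1 - series t n by rewrite seriesSB.
apply: (@le_trans _ _ 2); last first.
  by rewrite lerDl sumr_ge0// => i _; exact: cmod_ge0.
apply: (le_trans (cmod_triangle (f (a + r%:C)) _ _)).
rewrite [X in _ + X <= _]cmod_distC.
exact: ltW (ltrD (hN _ (leqW Nn)) (hN _ Nn)).
Qed.

(** The weight [i ^ 2] is the one produced by [expr_taylor_bound], so this sum controls the
    second-order remainder of the whole series. *)
Lemma psum_sum_bound c a rho f r : psum c a rho f -> 0 < r -> r < rho ->
  exists2 M, 0 <= M &
    forall n, \sum_(i < n) i%:R ^+ 2 * (cmod (c i) * r ^+ i) <= M.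
Proof.
move=> cf r0 rrho; have rho0 : 0 < rho by exact: lt_trans rrho.
(* eta^3 > r / rho, so each factor i of i^2 can absorb one power eta^i *)
pose eta := 1 - (1 - r / rho) / 4.
have th0 : 0 < r / rho by rewrite divr_gt0.
have th1 : r / rho < 1 by rewrite ltr_pdivrMr// mul1r.
have eta0 : 0 < eta by rewrite /eta; lra.
have eta1 : eta < 1 by rewrite /eta; lra.
have eta3 : r / rho < eta ^+ 3.
  set th := r / rho in th0 th1 eta0 eta1 *.
  have -> : th = 4 * eta - 3 by rewrite /eta -/th; field.
  rewrite -subr_gt0 (_ : _ - _ = (1 - eta) * (1 + 2 * (1 - eta) + eta * (1 - eta)));
    last by ring.
  by apply: mulr_gt0; [lra | nra].
have e30 : 0 < eta ^+ 3 by rewrite exprn_gt0.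
have r1rho : r / eta ^+ 3 < rho.
  by rewrite ltr_pdivrMr// mulrC -ltr_pdivrMr.
have r10 : 0 < r / eta ^+ 3 by rewrite divr_gt0.
have [B B0 hB] := psum_coef_bound cf r10 r1rho.
have K0 : 0 < (1 - eta)^-1 by rewrite invr_gt0 subr_gt0.
exists (B * (1 - eta)^-1 ^+ 2 * (1 - eta)^-1).
  by rewrite !mulr_ge0// ?exprn_ge0// ltW.
move=> n; apply: (@le_trans _ _ (\sum_(i < n) B * (1 - eta)^-1 ^+ 2 * eta ^+ i)).
  apply: ler_sum => i _.
  have -> : i%:R ^+ 2 * (cmod (c i) * r ^+ i) =
      (cmod (c i) * (r / eta ^+ 3) ^+ i) * (i%:R * eta ^+ i) ^+ 2 * eta ^+ i.
    rewrite -[in LHS](@divfK _ (eta ^+ 3) _ r) ?gt_eqF// exprMn -!exprM mulnC exprM.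
    ring.
  have h0 : 0 <= i%:R * eta ^+ i by rewrite mulr_ge0// exprn_ge0// ltW.
  rewrite ler_pM2r ?exprn_gt0//; apply: ler_pM; [|exact: exprn_ge0|exact: hB|].
    by rewrite mulr_ge0 ?cmod_ge0// exprn_ge0// ltW.
  by rewrite lerXn2r ?nnegrE//; [exact: ltW | exact: natX_le (ltW eta0) eta1].
rewrite -mulr_sumr; apply: ler_wpM2l; last exact: geometric_sum_le (ltW eta0) eta1.
by apply: mulr_ge0 => //; apply: exprn_ge0; exact: ltW.
Qed.

Definition diff_coef c n : R[i] := n.+1%:R * c n.+1.

(** The remainder satisfies [E (n + 1) = w E (n) + n u^(n-1) (w - u)^2], and [n^2 + n <= (n + 1)^2].
    The factor [r ^+ 2] stands on the left so that no exponent [n - 2] appears. *)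
Lemma expr_taylor_bound r u w n : 0 < r -> cmod u <= r -> cmod w <= r ->
  r ^+ 2 * cmod (w ^+ n - u ^+ n - n%:R * u ^+ n.-1 * (w - u)) <=
  n%:R ^+ 2 * r ^+ n * cmod (w - u) ^+ 2.
Proof.
move=> r0 ur wr; elim: n => [|n ih].
  by rewrite !expr0 subrr !mul0r subr0 cmod0 mulr0 expr0n/= !mul0r.
set D := cmod (w - u) in ih *.
have -> : w ^+ n.+1 - u ^+ n.+1 - n.+1%:R * u ^+ n * (w - u) =
   w * (w ^+ n - u ^+ n - n%:R * u ^+ n.-1 * (w - u)) +
   n%:R * u ^+ n.-1 * (w - u) ^+ 2.
  case: n {ih} => [|n]; first by rewrite /= mulr0n mulr1n !expr0 !expr1; ring.
  have -> : n.+2%:R = n.+1%:R + 1 :> R[i] by rewrite -addn1 natrD.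
  by rewrite /= (exprS w n.+1) (exprS u n.+1) (exprS u n); ring.
set B := w ^+ n - _ - _ in ih *.
have r20 : 0 <= r ^+ 2 by rewrite exprn_ge0// ltW.
apply: (le_trans (ler_wpM2l r20 (cmodD _ _))).
rewrite mulrDr.
apply: (@le_trans _ _ (n%:R ^+ 2 * r ^+ n.+1 * D ^+ 2 + n%:R * r ^+ n.+1 * D ^+ 2)).
  apply: lerD.
    rewrite cmodM mulrCA; apply: (@le_trans _ _ (r * (r ^+ 2 * cmod B))).
      by rewrite ler_wpM2r// mulr_ge0 ?cmod_ge0.
    apply: (le_trans (ler_wpM2l (ltW r0) ih)); rewrite (exprS r n).
    by rewrite le_eqVlt; apply/orP; left; apply/eqP; ring.
  rewrite (cmodM (n%:R * u ^+ n.-1)) (cmodM n%:R) !cmodX -/D.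
  have -> : cmod (n%:R : R[i]) = n%:R.
    have -> : (n%:R : R[i]) = (n%:R : R)%:C by rewrite rmorph_nat.
    by rewrite cmod_real ger0_norm.
  rewrite mulrA; apply: ler_wpM2r; first by rewrite exprn_ge0 ?cmod_ge0.
  case: n {ih B} => [|n]; first by rewrite mulr0n !mul0r mulr0.
  rewrite mulrCA; apply: ler_wpM2l => //=.
  rewrite (exprS r n.+1) (exprS r n) expr2 -!mulrA !ler_pM2l//.
  by rewrite lerXn2r ?nnegrE ?cmod_ge0// ltW.
rewrite -mulrDl -mulrDl ler_wpM2r ?exprn_ge0 ?cmod_ge0// ler_wpM2r ?exprn_ge0 ?ltW//.
by rewrite -natr1 sqrrD1 mulr2n; have : 0 <= n%:R :> R by []; lra.
Qed.
End PowerSeries.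

(** * Termwise differentiation, and the order of a zero *)

Section PowerSeriesDerivative.
Variable R : realType.
Implicit Types (f g : R[i] -> R[i]) (a z w u : R[i]) (c : nat -> R[i]) (r e : R).

Lemma cvg_cmod_shift (v : nat -> R[i]) (l : R[i]) :
  (v : nat -> (R[i] : numFieldType)) @ \oo --> (l : (R[i] : numFieldType)) ->
  (fun n => v n.+1 : (R[i] : numFieldType)) @ \oo --> (l : (R[i] : numFieldType)).
Proof.
move=> /cvg_cmodP h; apply/cvg_cmodP => e /h[N hN].
by exists N => n Nn; apply: hN; exact: leqW.
Qed.

(** The derived series converges absolutely because [i <= i ^ 2]. The remainders of the single terms
    then add up to at most [M |w - u|^2 / r^2], which is negligible against [|w - u|]. *)
Lemma psum_deriv c a rho f : psum c a rho f ->
  exists2 f', psum (diff_coef c) a rho f' &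
    forall w, cmod (w - a) < rho -> cder f w (f' w).
Proof.
move=> cf.
have [f' cf'] : exists f', psum (diff_coef c) a rho f'.
  pose P w := [set l : R[i] | series (fun n => diff_coef c n * (w - a) ^+ n :
    (R[i] : numFieldType)) @ \oo --> (l : (R[i] : numFieldType))].
  exists (fun w => xget 0 (P w)) => w wr; case: xgetP => [l _ //|abs]; exfalso.
  pose r := (cmod (w - a) + rho) / 2; have w0 := cmod_ge0 (w - a).
  have [r0 [rr wr']] : 0 < r /\ r < rho /\ cmod (w - a) <= r.
    by rewrite /r; split; [|split]; lra.
  have [M M0 hM] := psum_sum_bound cf r0 rr.
  have [|l hl] := @series_abs_cvg R (fun n => diff_coef c n * (w - a) ^+ n) (M / r).
    move=> n; rewrite ler_pdivlMr// mulr_suml.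
    apply: le_trans (hM n.+1); rewrite big_ord_recl mulr0n expr0n/= mul0r add0r.
    apply: ler_sum => i _; rewrite /diff_coef !cmodM cmodX.
    have -> : cmod (i.+1%:R : R[i]) = i.+1%:R.
      have -> : (i.+1%:R : R[i]) = (i.+1%:R : R)%:C by rewrite rmorph_nat.
      by rewrite cmod_real ger0_norm.
    rewrite /bump/= add1n (exprSr r i) expr2 -!mulrA ler_pM2l//.
    apply: (@le_trans _ _ (cmod (c i.+1) * (r ^+ i * r))).
      apply: ler_wpM2l; first exact: cmod_ge0.
      apply: ler_wpM2r; first exact: ltW.
      by rewrite lerXn2r ?nnegrE ?cmod_ge0// ltW.
    apply: ler_peMl; last by rewrite ler1n.
    have r00 := ltW r0; apply: mulr_ge0; first exact: cmod_ge0.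
    by apply: mulr_ge0 => //; exact: exprn_ge0.
  exact: abs hl.
exists f' => // u ur e e0.
pose r := (cmod (u - a) + rho) / 2; have u0 := cmod_ge0 (u - a).
have [r0 [rr ur']] : 0 < r /\ r < rho /\ cmod (u - a) < r.
  by rewrite /r; split; [|split]; lra.
have [M M0 hM] := psum_sum_bound cf r0 rr.
have r20 : 0 < r ^+ 2 by rewrite exprn_gt0.
have M1 : 0 < M + 1 by lra.
have d1 : 0 < r - cmod (u - a) by lra.
(* Chosen so that [M |w - u|^2 <= e r^2 |w - u|]; [M + 1] avoids a division by zero. *)
have d2 : 0 < e * r ^+ 2 / (M + 1) by apply: divr_gt0 => //; exact: mulr_gt0.
apply: cnbhsS (cnbhsI (cnbhs_ball u d1) (cnbhs_ball u d2)) => w /= [wu wu2].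
have war : cmod (w - a) < r by have := cmod_triangle u w a; lra.
have U := cf u ltac:(lra); have W := cf w ltac:(lra); have U' := cf' u ltac:(lra).
rewrite ltr_pdivlMr// in wu2.
rewrite -(ler_pM2l r20); apply: (@le_trans _ _ (M * cmod (w - u) ^+ 2)); last first.
  by have := cmod_ge0 (w - u); nra.
rewrite mulrC -ler_pdivlMr//.
pose S (z : R[i]) := series (fun n => c n * (z - a) ^+ n : (R[i] : numFieldType)).
pose S' := series (fun n => diff_coef c n * (u - a) ^+ n : (R[i] : numFieldType)).
(* Differentiation kills the constant term, so the [n] terms of [S' n] match those of index 1 to [n]
   in [S w n.+1]. *)
have lim : (fun n => S w n.+1 - S u n.+1 - S' n * (w - u)) @ \oo -->
    (f w - f u - f' u * (w - u) : (R[i] : numFieldType)).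
  apply: cvgB; last exact: cvgMl.
  exact: (cvgB (cvg_cmod_shift W) (cvg_cmod_shift U)).
apply: (le_cvg_cmod lim) => n; rewrite ler_pdivlMr// mulrC.
have -> : S w n.+1 - S u n.+1 - S' n * (w - u) =
    \sum_(i < n.+1) c i * ((w - a) ^+ i - (u - a) ^+ i
      - i%:R * (u - a) ^+ i.-1 * ((w - a) - (u - a))).
  rewrite /S /S' /series /= !big_mkord.
  transitivity (\sum_(i < n.+1) c i * (w - a) ^+ i -
    \sum_(i < n.+1) c i * (u - a) ^+ i -
    (\sum_(i < n.+1) c i * i%:R * (u - a) ^+ i.-1) * (w - u)).
    congr (_ - _ * _); rewrite [RHS]big_ord_recl mulr0n mulr0 mul0r add0r.
    by apply: eq_bigr => i _; rewrite /diff_coef lift0 [c _ * _]mulrC.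
  rewrite mulr_suml -!sumrB; apply: eq_bigr => i _.
  by rewrite [w - a - (u - a)](_ : _ = w - u); ring.
apply: (le_trans (ler_wpM2l (ltW r20) (cmod_sum _
  (fun i => c i * ((w - a) ^+ i - (u - a) ^+ i
      - i%:R * (u - a) ^+ i.-1 * ((w - a) - (u - a))))))).
apply: (@le_trans _ _ ((\sum_(i < n.+1) i%:R ^+ 2 * (cmod (c i) * r ^+ i)) *
   cmod (w - u) ^+ 2)); last by rewrite ler_wpM2r ?exprn_ge0 ?cmod_ge0.
rewrite mulr_sumr mulr_suml; apply: ler_sum => i _.
rewrite cmodM mulrCA.
have := @expr_taylor_bound R r (u - a) (w - a) i r0 (ltW ur') (ltW war).
move=> /(ler_wpM2l (cmod_ge0 (c i))) /le_trans; apply.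
have -> : (w - a) - (u - a) = w - u by ring.
by rewrite le_eqVlt; apply/orP; left; apply/eqP; ring.
Qed.

Lemma psum_cdiff n c a rho f : 0 < rho -> psum c a rho f -> cdiff n f a.
Proof.
elim: n c f => [|n ih] c f rho0 cf; have [f' cf' ff'] := psum_deriv cf.
  by apply: cder_cont (ff' a _); rewrite subrr cmod0.
apply: cdiffS (ih _ _ rho0 cf').
by apply: cnbhsS (cnbhs_ball a rho0) => w /=; exact: ff'.
Qed.

Lemma analytic_cdiff n f a : analytic_at f a -> cdiff n f a.
Proof. by move=> [c [rho [rho0 cf]]]; exact: psum_cdiff rho0 cf. Qed.

(** Away from [a] the quotient is [f w / (w - a)]; at [a] it is given the value [c 1], the sum of
    the shifted series at its centre. *)
Lemma psum_shift c a rho f : psum c a rho f -> c 0 = 0 -> 0 < rho ->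
  exists2 q, psum (fun n => c n.+1) a rho q &
    forall w, cmod (w - a) < rho -> f w = (w - a) * q w.
Proof.
move=> cf c0 rho0; exists (fun w => if w == a then c 1%N else f w / (w - a)) => w wr.
  have [->|wa] := eqVneq w a.
    apply/cvg_cmodP => e e0; exists 1%N => -[//|n] _.
    rewrite /series /= big_mkord big_ord_recl expr0 mulr1 big1 ?addr0 ?subrr ?cmod0//.
    by move=> i _; rewrite ?subrr lift0 exprS mul0r mulr0.
  have wa0 : w - a != 0 by rewrite subr_eq0.
  have h : (fun n => series (fun n => c n * (w - a) ^+ n : (R[i] : numFieldType)) n.+1
    * (w - a)^-1) @ \oo --> (f w / (w - a) : (R[i] : numFieldType)).
    apply: cvgMl; exact: (cvg_cmod_shift (cf _ wr)).
  have -> : series (fun n => c n.+1 * (w - a) ^+ n : (R[i] : numFieldType)) =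
      (fun n => series (fun n => c n * (w - a) ^+ n : (R[i] : numFieldType)) n.+1
    * (w - a)^-1); last by [].
  apply/funext => n; rewrite /series /= !big_mkord big_ord_recl c0 mul0r add0r mulr_suml.
  by apply: eq_bigr => i _; rewrite lift0 exprSr mulrA mulfK.
have [wa|wa] := eqVneq w a; last by rewrite mulrC divfK// subr_eq0.
rewrite wa subrr mul0r; have := cf a; rewrite subrr cmod0 => /(_ rho0) fa.
apply: (cvg_cmod_unique fa); apply/cvg_cmodP => e e0; exists 0%N => n _.
rewrite /series /= big_mkord big1 ?subrr ?cmod0// => i _.
by case: (i : nat) => [|k]; rewrite ?c0 ?mul0r// exprS mul0r mulr0.
Qed.

(** Either all coefficients at [a] vanish, or [w - a] can be divided out until the constant term is
    nonzero. *)
Lemma analytic_dichotomy f a : analytic_at f a ->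
  cnbhs a [set w | f w = 0] \/
  exists (m : nat) (g : R[i] -> R[i]), [/\ analytic_at g a, g a <> 0 &
    exists2 rho : R, 0 < rho & forall w, cmod (w - a) < rho ->
      f w = (w - a) ^+ m * g w].
Proof.
move=> [c [rho [rho0 cf]]].
have [c0|/existsNP[n /eqP cn]] := pselect (forall n, c n = 0).
  left; apply: cnbhsS (cnbhs_ball a rho0) => w /= /cf fw.
  apply: (cvg_cmod_unique fw); apply/cvg_cmodP => e e0; exists 0%N => n _.
  by rewrite /series /= big1 ?subrr ?cmod0// => i _; rewrite c0 mul0r.
(* The induction is on any index with a nonzero coefficient, not on the order of the zero; each
   shift of the series lowers it by one. *)
right; elim: n c f cf cn => [|n ih] c f cf cn; have [c0|c0] := eqVneq (c 0%N) 0.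
- by rewrite c0 eqxx in cn.
- exists 0%N, f; split; [by exists c, rho| |by exists rho => // w _; rewrite mul1r].
  move=> fa; move/eqP: c0; apply; rewrite -fa.
  have := cf a; rewrite subrr cmod0 => /(_ rho0); apply: cvg_cmod_unique.
  apply/cvg_cmodP => e e0; exists 1%N => -[//|k] _.
  rewrite /series /= big_mkord big_ord_recl expr0 mulr1 big1 ?addr0 ?subrr ?cmod0//.
  by move=> i _; rewrite ?subrr lift0 exprS mul0r mulr0.
- have [q cq fq] := psum_shift cf c0 rho0.
  have [m [g [g1 g2 [rho' rho'0 h]]]] := ih _ _ cq cn.
  exists m.+1, g; split => //; exists (Num.min rho rho').
    by rewrite lt_min rho0.
  by move=> w; rewrite lt_min => /andP[w1 w2]; rewrite fq// h// exprS mulrA.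
- exists 0%N, f; split; [by exists c, rho| |by exists rho => // w _; rewrite mul1r].
  move=> fa; move/eqP: c0; apply; rewrite -fa.
  have := cf a; rewrite subrr cmod0 => /(_ rho0); apply: cvg_cmod_unique.
  apply/cvg_cmodP => e e0; exists 1%N => -[//|k] _.
  rewrite /series /= big_mkord big_ord_recl expr0 mulr1 big1 ?addr0 ?subrr ?cmod0//.
  by move=> i _; rewrite ?subrr lift0 exprS mul0r mulr0.
Qed.

(** If [m < m'], cancelling [(w - a) ^+ m] at a point [w != a] near [a] makes [h w = 0], although
    [h a = - g a] is nonzero and [h] is continuous at [a]. *)
Lemma zero_order_le f a (m m' : nat) g g' (rho rho' : R) :
  analytic_at g a -> analytic_at g' a -> g a <> 0 ->
  0 < rho -> (forall w, cmod (w - a) < rho -> f w = (w - a) ^+ m * g w) ->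
  0 < rho' -> (forall w, cmod (w - a) < rho' -> f w = (w - a) ^+ m' * g' w) ->
  (m' <= m)%N.
Proof.
move=> ag ag' /eqP ga rho0 fg rho'0 fg'; rewrite leqNgt; apply/negP => mm'.
(* The exponent is displayed as a successor so that the power visibly vanishes at [a]. *)
pose h w := (w - a) ^+ (m' - m).-1.+1 * g' w - g w.
have hc : ccont h a.
  have hc : cdiff 0 (fun w => (w + - a) ^+ (m' - m).-1.+1 * g' w + (-1) * g w) a.
    apply: cdiffD; last by apply: cdiffM; [exact: cdiff_cst|exact: analytic_cdiff].
    apply: cdiffM; last exact: analytic_cdiff.
    by apply: cdiffX; apply: cdiffD; [exact: cdiff_id|exact: cdiff_cst].
  apply: (ccont_ext _ hc); apply: cnbhsE => w /=; rewrite /h; ring.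
have ha : h a != 0 by rewrite /h subrr exprS !mul0r sub0r oppr_eq0.
have [d d0 hd] := (nbhs_cmod _ _).1 (ccont_neq0 hc ha).
pose t := Num.min d (Num.min rho rho') / 2.
have t0 : 0 < t by rewrite divr_gt0// !lt_min d0 rho0.
have tmin : t < Num.min d (Num.min rho rho').
  by rewrite /t ltr_pdivrMr// ltr_pMr ?ltr1n// !lt_min d0 rho0.
move: tmin; rewrite !lt_min => /and3P[td trho trho'].
have wa : cmod (a + t%:C - a) = t by rewrite addrC addKr cmod_real gtr0_norm.
have := hd (a + t%:C); rewrite wa => /(_ td)/= hw.
have wz : a + t%:C - a != 0 by rewrite -cmod_gt0 wa.
have e1 := fg (a + t%:C) ltac:(by rewrite wa).
have e2 := fg' (a + t%:C) ltac:(by rewrite wa).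
set w := a + t%:C in hw wz e1 e2.
move/eqP: hw; apply; rewrite /h prednK ?subn_gt0//; apply/eqP; rewrite subr_eq0.
apply/eqP; apply: (mulfI (expf_neq0 m wz)).
by rewrite -e1 e2 mulrA -exprD subnKC// ltnW.
Qed.

Lemma zero_orderE f a (m : nat) g (rho : R) :
  analytic_at g a -> g a <> 0 ->
  0 < rho -> (forall w, cmod (w - a) < rho -> f w = (w - a) ^+ m * g w) ->
  zero_order f a = m.
Proof.
move=> ag ga rho0 fg; rewrite /zero_order; case: xgetP => [k _ /= [g' [ag' ga' [r r0 h]]]|].
  apply/eqP; rewrite eqn_leq (zero_order_le ag ag' ga rho0 fg r0 h).
  by rewrite (zero_order_le ag' ag ga' r0 h rho0 fg).
by move=> /(_ m)[]; exists g; split => //; exists rho.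
Qed.

End PowerSeriesDerivative.

(** * Preimages *)

Section Preimages.
Variable R : realType.
Implicit Types (f g phi : R[i] -> R[i]) (a z w u b : R[i]) (r s e d : R).

Lemma analytic_subC f a z : analytic_at f a -> analytic_at (fun w => f w - z) a.
Proof.
move=> [c [rho [rho0 cf]]].
exists (fun n => if n is 0%N then c 0%N - z else c n), rho; split=> [//|w wr].
have /cvg_cmodP h := cf w wr; apply/cvg_cmodP => e /h[N hN]; exists N.+1 => -[//|n] Nn.
have := hN n.+1 (ltnW Nn); rewrite /series /= !big_mkord !big_ord_recl /= !expr0.
by set x := \sum_(i < n) _; congr (cmod _ < _); ring.
Qed.

Lemma isolated_zero f a : analytic_at f a -> ~ cnbhs a [set w | f w = 0] ->
  exists2 d, 0 < d & forall w, cmod (w - a) < d -> f w = 0 -> w = a.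
Proof.
move=> /analytic_dichotomy[//|[m [g [ag /eqP ga [rho rho0 fg]]]]] _.
have gc := analytic_cdiff 0 ag.
have [d d0 hd] := (nbhs_cmod _ _).1 (ccont_neq0 gc ga).
exists (Num.min d rho); first by rewrite lt_min d0.
move=> w; rewrite lt_min => /andP[wd wr]; rewrite fg// => /eqP.
rewrite mulf_eq0 (negbTE (hd _ wd)) orbF expf_eq0 subr_eq0.
by move=> /andP[_ /eqP].
Qed.

(** Identity theorem along the segment from 0 to [a], at the infimum of the parameters near which
    [phi = z]. If [phi = z] around the corresponding point, the infimum can be lowered unless it is
    0, where [phi 0 = z] results. Otherwise any zero of [phi - z] near that point is the point
    itself, so a parameter of [A] close to the infimum describes this very point, a
    contradiction. *)
Lemma not_locally_constant phi z a : analytic_self_map phi -> phi 0 <> z ->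
  unit_disc a -> ~ cnbhs a [set w | phi w - z = 0].
Proof.
move=> [aphi _] phi0 ad az.
pose A := [set t : R | 0 <= t <= 1 /\ cnbhs (t%:C * a) [set w | phi w - z = 0]].
have A1 : A 1 by split; [rewrite ler01 lexx|rewrite mul1r].
have infA : has_inf A by split; [by exists 1|exists 0 => t [/andP[]]].
have lb t : A t -> inf A <= t by move=> At; exact: ge_inf infA.2 _ At.
have t0 : 0 <= inf A by apply: lb_le_inf; [exists 1|move=> t [/andP[]]].
have t1 : inf A <= 1 by exact: lb.
have pd : unit_disc ((inf A)%:C * a).
  rewrite /unit_disc /= cmodM cmod_real ger0_norm//.
  by move: ad; rewrite /unit_disc /=; have := cmod_ge0 a; nra.
have dist (t t' : R) : cmod (t%:C * a - t'%:C * a) <= `|t - t'|.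
  rewrite -mulrBl -rmorphB/= cmodM cmod_real ler_piMr//.
  by move: ad; rewrite /unit_disc/=; exact: ltW.
have [pz|pz] := pselect (cnbhs ((inf A)%:C * a) [set w | phi w - z = 0]).
  have [t00|t0' ] := eqVneq (inf A) 0.
    apply: phi0; apply/eqP; rewrite -subr_eq0; apply/eqP.
    by have := cnbhs_center pz; rewrite t00 mul0r.
  have [d d0 hd] := (nbhs_cmod _ _).1 (cnbhs_open pz).
  have t0'' : 0 < inf A by rewrite lt_neqAle eq_sym t0'.
  pose t := inf A - Num.min (inf A) d / 2.
  have m0 : 0 < Num.min (inf A) d by rewrite lt_min t0''.
  have m1 : Num.min (inf A) d <= inf A by rewrite ge_min lexx.
  have m2 : Num.min (inf A) d <= d by rewrite ge_min lexx orbT.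
  have : A t.
    split; first by rewrite /t; apply/andP; split; lra.
    apply: hd; apply: (le_lt_trans (dist _ _)).
    have -> : t - inf A = - (Num.min (inf A) d / 2) by rewrite /t; ring.
    by rewrite normrN gtr0_norm; lra.
  by move=> /lb; rewrite /t; lra.
have [d d0 hd] := isolated_zero (analytic_subC z (aphi _ pd)) pz.
have [t At tlt] := inf_adherent d0 infA.
apply: pz; have [_ tz] := At.
rewrite -(hd (t%:C * a)) //; last exact: (cnbhs_center tz).
apply: (le_lt_trans (dist _ _)); have := lb _ At.
by rewrite -subr_ge0 => /ger0_norm ->; lra.
Qed.

(** Compactness of a closed disc for an arbitrary choice of radii, drawn from the compact square
    around it in [R * R]. *)
Lemma disc_cover (d : R[i] -> R) r : (forall p, 0 < d p) ->
  exists ps : seq R[i], forall w, cmod w <= r ->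
    exists2 p, p \in ps & cmod (w - p) < d p.
Proof.
(* Halved because the modulus is bounded by the sum of the two coordinate distances. *)
move=> d0; pose D (p : R * R) := d (p.1 +i* p.2) / 2.
have D0 p : 0 < D p by rewrite divr_gt0.
pose K := `[- r, r]%classic `*` `[- r, r]%classic : set (R * R).
have : compact K by apply: compact_setX; exact: segment_compact.
rewrite (@compact_cover (HB.pack_for ptopologicalType (R * R)%type)).
move=> /(_ (R * R)%type setT (fun p : R * R => ball p (D p))) [].
- by move=> p _; exact: ball_open.
- by move=> p _; exists p => //; exact: ballxx.
move=> D' _ KD'; exists [seq p.1 +i* p.2 | p <- enum_fset D'] => w wr.
have [/= p pD' wp] : cover [set` D'] (fun p : R * R => ball p (D p)) (Re w, Im w).
  apply: KD'; split; rewrite /= in_itv /= -ler_norml; apply: le_trans wr.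
    exact: Re_le_cmod.
  exact: Im_le_cmod.
exists (p.1 +i* p.2); first by apply/mapP; exists p.
apply: (le_lt_trans (cmod_le_ReIm _)); rewrite ReB ImB /=.
have [/= h1 h2] := wp; rewrite (splitr (d _)); move: h1 h2; rewrite -!ball_normE /=.
by rewrite [ `|_ - Re w|]distrC [ `|_ - Im w|]distrC; exact: ltrD.
Qed.

(** In a finite cover by discs that isolate their centres, every point of [Z] is one of the
    centres. *)
Lemma finite_of_isolated (Z : set R[i]) r : (forall w, Z w -> cmod w <= r) ->
  (forall p, exists2 d, 0 < d & forall w, Z w -> cmod (w - p) < d -> w = p) ->
  finite_set Z.
Proof.
move=> Zr iso.
have /choice[d hd] : forall p, exists d : R, 0 < d /\
    forall w, Z w -> cmod (w - p) < d -> w = p.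
  by move=> p; have [d d0 h] := iso p; exists d.
have [ps hps] := @disc_cover d r (fun p => (hd p).1).
apply: sub_finite_set (finite_seq ps) => w Zw.
by have [p pps wp] := hps _ (Zr _ Zw); rewrite /= ((hd p).2 _ Zw wp).
Qed.

Lemma isolated_preimages phi z p : analytic_self_map phi -> phi 0 <> z ->
  unit_disc p ->
  exists2 d, 0 < d & forall w, preimages phi z w -> cmod (w - p) < d -> w = p.
Proof.
move=> hphi phi0 pd.
have [d d0 hd] := isolated_zero (analytic_subC z (hphi.1 _ pd))
  (not_locally_constant hphi phi0 pd).
by exists d => // w [wd wz] wp; apply: hd => //; rewrite wz subrr.
Qed.

Lemma finite_preimages phi z r : analytic_self_map phi -> phi 0 <> z ->
  r < 1 -> finite_set (preimages phi z `&` [set w | cmod w <= r]).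
Proof.
move=> hphi phi0 r1; apply: (@finite_of_isolated _ r) => [w []//|p].
have [pr|rp] := leP (cmod p) r.
  have [d d0 hd] := isolated_preimages hphi phi0 (le_lt_trans pr r1 : unit_disc p).
  by exists d => // w [wz _]; exact: hd.
(* Here [p] may lie outside the unit disc, where nothing is known of [phi]; this disc around it
   misses the disc of radius [r] altogether. *)
exists (cmod p - r); first by rewrite subr_gt0.
move=> w [_ /= wr] wp; exfalso; have := cmod_leB p w; rewrite cmod_distC; lra.
Qed.

Lemma countable_preimages phi z : analytic_self_map phi -> phi 0 <> z ->
  countable (preimages phi z).
Proof.
move=> hphi phi0.
apply: (@sub_countable _ _ _ (\bigcup_n (preimages phi z `&`
   [set w | cmod w <= 1 - n.+1%:R^-1]))); last first.
  apply: bigcup_countable => // n _; apply: finite_set_countable.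
  by apply: finite_preimages => //; rewrite gtrBl invr_gt0.
apply: subset_card_le => w [wd wz].
have w1 : 0 < 1 - cmod w by rewrite subr_gt0.
have [n hn] := ltr_add_invr w1; exists n => //; split => //=.
by rewrite lerBrDr addrC -lerBrDr; rewrite add0r in hn; exact: ltW.
Qed.

Lemma finite_argmin (T : choiceType) (F : T -> R) (A : set T) :
  finite_set A -> A !=set0 -> exists2 x, A x & forall y, A y -> F x <= F y.
Proof.
move=> /finite_seqP[s ->] {A}; elim: s => [[x] //|x s ih _].
have [->|] := eqVneq s [::].
  by exists x; rewrite /= ?mem_head// => y /=; rewrite inE => /eqP->.
case: s ih => // x' s ih _.
have [|y ys hy] := ih; first by exists x'; rewrite /= mem_head.
have [xy|yx] := leP (F x) (F y).
  exists x; rewrite /= ?mem_head// => y'; rewrite /= inE => /predU1P[->//|].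
  by move=> /hy; exact: le_trans.
exists y; first by rewrite /= inE [_ \in _]ys orbT.
by move=> y'; rewrite /= inE => /predU1P[->|/hy//]; exact: ltW.
Qed.

End Preimages.

(** * Dividing the zeros out of [phi - z] *)

Section Factorization.
Variable R : realType.
Implicit Types (f g phi : R[i] -> R[i]) (a z w u b : R[i]) (r s e d : R).

(** The identity theorem rules out the default case of [zero_order], so the multiplicity is the true
    exponent; it is positive because [phi b - z = 0] while [q b != 0]. *)
Lemma local_factor phi z b : analytic_self_map phi -> phi 0 <> z ->
  preimages phi z b -> exists q, [/\ analytic_at q b, q b != 0,
    (0 < multiplicity phi b)%N &
    cnbhs b [set w | phi w - z = (w - b) ^+ multiplicity phi b * q w]].
Proof.
move=> hphi phi0 [bd bz].
have [//|[m [g [ag /eqP gb [rho rho0 fg]]]]] :=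
  analytic_dichotomy (analytic_subC z (hphi.1 _ bd)).
  by move=> /(not_locally_constant hphi phi0 bd).
have -> : multiplicity phi b = m.
  rewrite /multiplicity bz; apply: zero_orderE ag _ rho0 fg; exact/eqP.
exists g; split => //.
  rewrite lt0n; apply/eqP => m0; move/eqP: gb; apply.
  by have := fg b; rewrite subrr cmod0 m0 bz subrr mul1r => /(_ rho0).
by apply: cnbhsS (cnbhs_ball b rho0) => w /=; exact: fg.
Qed.

Lemma cdiff_prod_sub n a (s : seq R[i]) (P : pred R[i]) (m : R[i] -> nat) :
  cdiff n (fun w => \prod_(b <- s | P b) (w - b) ^+ m b) a.
Proof.
apply: (cdiff_ext _ (@cdiff_prod R n a _ s
  (fun b w => if P b then (w + - b) ^+ m b else 1) _)).
  by apply: cnbhsE => w /=; rewrite [RHS]big_mkcond.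
move=> b; case: (P b); last exact: cdiff_cst.
by apply: cdiffX; apply: cdiffD; [exact: cdiff_id|exact: cdiff_cst].
Qed.

(** The quotient by the finitely many zeros of modulus at most [r], to the second order that
    [mean_ln_cmod] asks for. *)
Lemma disc_factorization phi z r (zs : seq R[i]) : analytic_self_map phi ->
  phi 0 <> z -> r < 1 -> uniq zs ->
  (forall b, b \in zs <-> preimages phi z b /\ cmod b <= r) ->
  exists g, (forall w, cmod w <= r -> cdiff 2 g w /\ g w != 0) /\
    forall w, cmod w <= r -> phi w - z =
      \prod_(b <- zs) (w - b) ^+ multiplicity phi b * g w.
Proof.
move=> hphi phi0 r1 uzs hzs.
have /choice[q hq] : forall b, exists q, b \in zs -> [/\ analytic_at q b, q b != 0,
    (0 < multiplicity phi b)%N & cnbhs b [set w | phi w - z = (w - b) ^+ multiplicity phi b * q w]].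
  move=> b; have [/hzs[bz _]|_] := boolP (b \in zs); last by exists id.
  by have [q hq] := local_factor hphi phi0 bz; exists q.
pose Pi (P : pred R[i]) w := \prod_(b <- zs | P b) (w - b) ^+ multiplicity phi b.
have PiC P w n : cdiff n (Pi P) w by exact: cdiff_prod_sub.
have Pi0 (P : pred R[i]) w : (w \in zs -> ~~ P w) -> Pi P w != 0.
  move=> h; rewrite /Pi prodf_seq_neq0; apply/allP => b bs; apply/implyP => Pb.
  apply: expf_neq0; rewrite subr_eq0; apply/eqP => wb; subst b.
  by move: (h bs); rewrite Pb.
have PiD w b : b \in zs ->
    Pi predT w = (w - b) ^+ multiplicity phi b * Pi (predC1 b) w.
  by move=> bs; rewrite /Pi (bigD1_seq b).
(* At a listed zero the plain quotient is 0 / 0; there the local factor, divided by the product over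
   the other zeros, gives the removable value. *)
pose g w := if w \in zs then q w w / Pi (predC1 w) w else (phi w - z) / Pi predT w.
exists g; split=> w wr; last first.
  rewrite -/(Pi predT w) /g; case: ifPn => ws; last by rewrite mulrC divfK// Pi0// (negbTE ws).
  have [wz _] := (hzs w).1 ws; have [aq qw m0 nq] := hq _ ws.
  have -> := cnbhs_center nq; rewrite (PiD w w ws) -mulrA; congr (_ * _).
  by rewrite mulrC divfK// Pi0//= => _; rewrite negbK.
have wd : unit_disc w by exact: le_lt_trans wr r1.
have [ws|ws] := boolP (w \in zs); last first.
  split; last first.
    rewrite /g (negbTE ws) mulf_neq0 ?invr_eq0//; last by rewrite Pi0// (negbTE ws).
    rewrite subr_eq0; apply/eqP => wz; move/negP: ws; apply; apply/hzs.
    by split.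
  have nz : Pi predT w != 0 by rewrite Pi0// (negbTE ws).
  apply: (@cdiff_ext _ _ (fun u => (phi u - z) * (Pi predT u)^-1)).
    (* A listed zero makes the full product vanish, so near [w] the quotient formula for [g] is the
       one in force. *)
    apply: cnbhsS (ccont_neq0 (PiC predT w 0) nz) => u /= hu; rewrite /g.
    case: ifPn => // us; exfalso; move/eqP: hu; apply.
    have [_ _ m0 _] := hq _ us.
    by rewrite (PiD u u us) subrr expr0n eqn0Ngt m0 mul0r.
  apply: cdiffM; last by apply: cdiffV => //; exact: PiC.
  apply: (analytic_cdiff 2); apply: analytic_subC; exact: hphi.1.
have [aq qw m0 nq] := hq _ ws.
have nz : Pi (predC1 w) w != 0 by rewrite Pi0//= => _; rewrite negbK.
split; last by rewrite /g ws mulf_neq0 ?invr_eq0.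
apply: (@cdiff_ext _ _ (fun u => q w u * (Pi (predC1 w) u)^-1)).
  apply: cnbhsS (cnbhsI nq (ccont_neq0 (PiC (predC1 w) w 0) nz)) => u /= [hu nu].
  rewrite /g; have [->|uw] := eqVneq u w; first by rewrite ws.
  (* Another listed zero [u] would make the full product vanish at [u], yet its two parts, the power
     of [u - w] and [Pi (predC1 w) u], are nonzero. *)
  rewrite ifN; last first.
    apply/negP => us; have [_ _ k0 _] := hq _ us.
    have := PiD u w ws; rewrite (PiD u u us) subrr expr0n eqn0Ngt k0 mul0r.
    move/esym/eqP.
    by rewrite mulf_eq0 (negbTE nu) expf_eq0 subr_eq0 (negbTE uw) andbF.
  have uw0 : (u - w) ^+ multiplicity phi w != 0 by rewrite expf_neq0 ?subr_eq0.
  by rewrite hu (PiD u w ws) invfM mulrACA divff// mul1r.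
apply: cdiffM; first exact: analytic_cdiff.
by apply: cdiffV => //; exact: PiC.
Qed.

End Factorization.

(** * Integration along circles *)

Section CompositionMeasurability.
Variable R : realType.
Implicit Types (Q : R[i] -> R) (a w : R[i]) (r s t e : R).

Definition rcont Q a := forall e, 0 < e -> cnbhs a [set w | `|Q w - Q a| < e].

Lemma rcont_Re f a : ccont f a -> rcont (fun w => Re (f w)) a.
Proof.
move=> cf e /cf; apply: cnbhsS => w /=; apply: le_lt_trans.
by rewrite -ReB; exact: Re_le_cmod.
Qed.

Lemma rcont_Im f a : ccont f a -> rcont (fun w => Im (f w)) a.
Proof.
move=> cf e /cf; apply: cnbhsS => w /=; apply: le_lt_trans.
by rewrite -ImB; exact: Im_le_cmod.
Qed.

Lemma rcont_cmod f a : ccont f a -> rcont (fun w => cmod (f w)) a.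
Proof.
move=> cf e /cf; apply: cnbhsS => w /=; apply: le_lt_trans.
rewrite ler_norml cmod_leB andbT lerNl opprB.
by rewrite cmod_distC; exact: cmod_leB.
Qed.

Lemma rcont_comp Q (h : R -> R) a : rcont Q a -> {for Q a, continuous h} ->
  rcont (fun w => h (Q w)) a.
Proof.
move=> cQ /cvgrPdist_lt ch e /ch/nbhs_ballP[d /= d0 hd].
apply: cnbhsS (cQ _ d0) => w /= Qw; rewrite distrC.
by apply: (hd (Q w)); rewrite -ball_normE /= distrC.
Qed.

(** An open set is the union of the boxes inside it with rational centre and half-side
    [1 / (n + 1)]. This links the topology of [R[i]] to the product sigma-algebra of [R * R]. *)
Lemma measurable_copen (U : set R[i]) : (forall w, U w -> cnbhs w U) ->
  measurable [set p : R * R | U (p.1 +i* p.2)].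
Proof.
move=> oU.
pose J := (rat * rat * nat)%type.
pose lo (q : rat) (n : nat) : R := ratr q - n.+1%:R^-1.
pose hi (q : rat) (n : nat) : R := ratr q + n.+1%:R^-1.
pose B (j : J) : set (R * R) :=
  `]lo j.1.1 j.2, hi j.1.1 j.2[%classic `*` `]lo j.1.2 j.2, hi j.1.2 j.2[%classic.
pose F (j : J) : set (R * R) :=
  if pselect (B j `<=` [set p : R * R | U (p.1 +i* p.2)]) then B j else set0.
have -> : [set p : R * R | U (p.1 +i* p.2)] = \bigcup_j F j.
  apply/seteqP; split=> [[x y] /= Uxy|p [j _]]; last first.
    by rewrite /F; case: pselect => // h; exact: h.
  have [d d0 hd] := (nbhs_cmod _ _).1 (oU _ Uxy).
  (* The centre is within [1 / (n + 1) < d / 4] of both [(x, y)] and any point of the box in each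
     coordinate, so the box stays within [d / 2] per coordinate and [d] in modulus. *)
  have d4 : 0 < d / 4 by rewrite divr_gt0.
  have [n hn] := ltr_add_invr d4; rewrite add0r in hn.
  have n0 : 0 < n.+1%:R^-1 :> R by [].
  have [dn dnE] : exists dn : R, dn = n.+1%:R^-1 by eexists.
  rewrite -dnE in hn n0.
  have rq (u : R) : exists q : rat, u - dn < ratr q < u + dn.
    have [q] := @rat_in_itvoo R (u - dn) (u + dn) ltac:(lra).
    by rewrite in_itv /= => hq; exists q.
  have [q1 /andP[q11 q12]] := rq x; have [q2 /andP[q21 q22]] := rq y.
  exists (q1, q2, n) => //; rewrite /F; case: pselect => [?|[]].
    by split; rewrite /= in_itv /lo /hi /= -dnE; apply/andP; split; lra.
  move=> [x' y'] [] /=; rewrite !in_itv /lo /hi /= -dnE => /andP[h1 h2] /andP[h3 h4].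
  apply: hd; apply: (le_lt_trans (cmod_le_ReIm _)); rewrite ReB ImB /=.
  have hx : `|x' - x| < d / 2 by rewrite ltr_norml; apply/andP; split; lra.
  have hy : `|y' - y| < d / 2 by rewrite ltr_norml; apply/andP; split; lra.
  by rewrite (splitr d) ltrD.
apply: countable_bigcupT_measurable => [|j]; first exact: countableP.
rewrite /F; case: pselect => ?; last exact: measurable0.
by apply: measurableX; exact: measurable_itv.
Qed.

(** Continuity of [Q] is known only at the points reached from [D], so the preimage of an interval
    under [Q] need not be open; its interior is open and has the same points over [D]. *)
Lemma measurable_rcont d (T : measurableType d) (D : set T) (X Y : T -> R) Q :
  measurable_fun setT X -> measurable_fun setT Y ->
  (forall x, D x -> rcont Q (X x +i* Y x)) ->
  measurable_fun D (fun x => Q (X x +i* Y x)).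
Proof.
move=> mX mY cQ mD; apply: (measurability _ (RGenOpens.measurableE R)) => //.
move=> _ [_ [a [b ->] <-]].
pose U := [set w | cnbhs w [set u | a < Q u < b]].
have mU : measurable [set p : R * R | U (p.1 +i* p.2)].
  by apply: measurable_copen => w Uw; exact: cnbhs_open.
have := measurableI _ _ mD (measurable_fun_pair mX mY measurableT mU).
rewrite setTI; congr measurable.
apply/seteqP; split=> x /= [Dx Ux]; split => //.
  by have /= := cnbhs_center Ux; rewrite in_itv.
move: Ux; rewrite in_itv /= => /andP[Ux1 Ux2].
have e0 : 0 < Num.min (Q (X x +i* Y x) - a) (b - Q (X x +i* Y x)).
  by rewrite lt_min !subr_gt0 Ux1.
apply: cnbhsS (cQ _ Dx _ e0) => u /=.
by rewrite lt_min !ltr_norml => /andP[/andP[? ?] /andP[? ?]]; apply/andP; split; lra.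
Qed.

(** Each disc of a finite cover has its own bound; the sum of all of them serves everywhere. *)
Lemma rcont_bounded Q r : (forall w, cmod w <= r -> rcont Q w) ->
  exists2 M, 0 <= M & forall w, cmod w <= r -> `|Q w| <= M.
Proof.
move=> cQ.
have /choice[d hd] : forall p, exists d : R, 0 < d /\
    forall w, cmod w <= r -> cmod (w - p) < d -> `|Q w| <= `|Q p| + 1.
  move=> p; have [pr|rp] := leP (cmod p) r.
    have [d d0 h] := (nbhs_cmod _ _).1 (cQ _ pr _ ltr01).
    exists d; split => // w _ /h /= /ltW; have := ler_normD (Q w - Q p) (Q p).
    by rewrite subrK; lra.
  exists (cmod p - r); split; first by rewrite subr_gt0.
  by move=> w wr wp; have := cmod_leB p w; rewrite cmod_distC; lra.
have [ps hps] := @disc_cover R d r (fun p => (hd p).1).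
exists (\sum_(p <- ps) (`|Q p| + 1)); first by rewrite sumr_ge0.
move=> w wr; have [p pps wp] := hps _ wr.
apply: (le_trans ((hd p).2 _ wr wp)).
by rewrite (big_rem p)//= lerDl sumr_ge0.
Qed.

End CompositionMeasurability.

(** * Tonelli's theorem on a product of two measurable sets *)

Section TonelliRectangle.
Context d1 d2 (T1 : measurableType d1) (T2 : measurableType d2) (R : realType).
Variable m1 : {sigma_finite_measure set T1 -> \bar R}.
Variable m2 : {sigma_finite_measure set T2 -> \bar R}.
Variables (A : set T1) (B : set T2) (f : T1 -> T2 -> \bar R).
Hypothesis mA : measurable A.
Hypothesis mB : measurable B.
Hypothesis mf : measurable_fun (A `*` B) (fun p => f p.1 p.2).
Hypothesis f0 : forall x y, A x -> B y -> (0 <= f x y)%E.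

Let F := (fun p => f p.1 p.2) \_ (A `*` B).

Let mF : measurable_fun setT F.
Proof. by apply/(measurable_restrictT _ _).1 => //; exact: measurableX. Qed.

Let F0 p : (0 <= F p)%E.
Proof.
by rewrite /F patchE; case: ifPn => // /set_mem[? ?]; exact: f0.
Qed.

Let FE1 x : (\int[m2]_y F (x, y) =
  ((fun x => \int[m2]_(y in B) f x y) \_ A) x)%E.
Proof.
rewrite patchE; case: ifPn => xA.
  rewrite [RHS]integral_mkcond; apply: eq_integral => y _.
  rewrite /F !patchE /=; congr (if _ then _ else _).
  by apply/idP/idP => [/set_mem[_ ?]|/set_mem ?]; apply/mem_set => //; split => //; exact: set_mem.
rewrite integral0_eq// => y _; rewrite /F patchE; case: ifPn => // /set_mem[/= h _].
by move: xA; rewrite mem_set.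
Qed.

Let FE2 y : (\int[m1]_x F (x, y) =
  ((fun y => \int[m1]_(x in A) f x y) \_ B) y)%E.
Proof.
rewrite patchE; case: ifPn => yB.
  rewrite [RHS]integral_mkcond; apply: eq_integral => x _.
  rewrite /F !patchE /=; congr (if _ then _ else _).
  by apply/idP/idP => [/set_mem[? _]|/set_mem ?]; apply/mem_set => //; split => //; exact: set_mem.
rewrite integral0_eq// => x _; rewrite /F patchE; case: ifPn => // /set_mem[_ /= h].
by move: yB; rewrite mem_set.
Qed.

Lemma tonelli_rect : (\int[m1]_(x in A) \int[m2]_(y in B) f x y =
  \int[m2]_(y in B) \int[m1]_(x in A) f x y)%E.
Proof.
rewrite [LHS]integral_mkcond [RHS]integral_mkcond.
under eq_integral do rewrite -FE1; under [RHS]eq_integral do rewrite -FE2.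
exact: (fubini_tonelli F mF F0).
Qed.

Lemma integral_rectE : (\int[m1 \x m2]_(p in A `*` B) f p.1 p.2 =
  \int[m1]_(x in A) \int[m2]_(y in B) f x y)%E.
Proof.
rewrite [LHS]integral_mkcond [RHS]integral_mkcond.
under [RHS]eq_integral do rewrite -FE1.
exact: (fubini_tonelli1 F mF F0).
Qed.

Lemma measurable_tonelli_rect1 :
  measurable_fun A (fun x => (\int[m2]_(y in B) f x y)%E).
Proof.
apply/(measurable_restrictT _ _).2 => //.
rewrite (_ : _ \_ A = fun x => (\int[m2]_y F (x, y))%E); last first.
  by apply/funext => x; rewrite FE1.
exact: (measurable_fun_fubini_tonelli_F F mF F0).
Qed.

Lemma measurable_tonelli_rect2 :
  measurable_fun B (fun y => (\int[m1]_(x in A) f x y)%E).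
Proof.
apply/(measurable_restrictT _ _).2 => //.
rewrite (_ : _ \_ B = fun y => (\int[m1]_x F (x, y))%E); last first.
  by apply/funext => x; rewrite FE2.
exact: (measurable_fun_fubini_tonelli_G F mF F0).
Qed.

End TonelliRectangle.

(** * Derivatives and the fundamental theorem on the line *)

Section RealDerivatives.
Variable R : realType.
Implicit Types (f F : R -> R) (x y a b l e : R).

(** The same division-free form as [cder], so that expansions can be substituted into one
    another. *)
Lemma is_derive1P f x l : is_derive x 1 f l <->
  forall e, 0 < e -> exists2 d, 0 < d & forall h, `|h| < d ->
    `|f (x + h) - f x - l * h| <= e * `|h|.
Proof.
have E h : h != 0 -> `|l - h^-1 *: (f (h *: 1 + x) - f x)| * `|h| =
    `|f (x + h) - f x - l * h|.
  move=> h0; rewrite -normrM mulrBl -normrN opprB [h *: 1]mulr1 [h + x]addrC.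
  by rewrite [_ *: _]mulrC divfK.
split=> [[df dfl] e e0|h].
  have : (fun h => h^-1 *: (f (h *: 1 + x) - f x)) @ 0^' --> l by rewrite -dfl.
  move=> /cvgrPdist_lt/(_ _ e0)/nbhs_ballP[d /= d0 hd].
  exists d => // h hd'; have [->|h0] := eqVneq h 0.
    by rewrite addr0 subrr mulr0 subr0 normr0 mulr0.
  rewrite -E// ler_wpM2r//; apply/ltW/hd => //.
  by rewrite -ball_normE /= sub0r normrN.
have : (fun h => h^-1 *: (f (h *: 1 + x) - f x)) @ 0^' --> l.
  apply/cvgrPdist_lt => e e0; have e2 : 0 < e / 2 by rewrite divr_gt0.
  have [d d0 hd] := h _ e2; apply/nbhs_ballP; exists d => //= k.
  rewrite -ball_normE /= sub0r normrN => kd k0.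
  have nk : 0 < `|k| by rewrite normr_gt0.
  rewrite -(ltr_pM2r nk) E//; apply: le_lt_trans (hd _ kd) _.
  by rewrite ltr_pM2r// ltr_pdivrMr// ltr_pMr// ltr1n.
by move=> hl; split; [apply/cvg_ex; exists l|exact: cvg_lim hl].
Qed.

Lemma is_derive_continuous f x l : is_derive x 1 f l -> {for x, continuous f}.
Proof.
by move=> [df _]; apply: differentiable_continuous; exact/derivable1_diffP.
Qed.

Lemma FTC2_derive (f F : R -> R) a b : a < b ->
  (forall x, a <= x <= b -> is_derive x 1 F (f x)) ->
  (forall x, a <= x <= b -> {for x, continuous f}) ->
  (\int[lebesgue_measure]_(x in `[a, b]) (f x)%:E = (F b - F a)%:E)%E.
Proof.
move=> ab dF cf; rewrite (@continuous_FTC2 _ f F a b)//.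
- by apply: continuous_in_subspaceT => x /set_mem /=; rewrite in_itv/= => xab; exact: cf.
- split.
  + by move=> x; rewrite in_itv/= => /andP[/ltW ax /ltW xb]; case: (dF x); rewrite ?ax.
  + apply: cvg_at_right_filter; apply: (@is_derive_continuous _ _ (f a)).
    by apply: dF; rewrite lexx ltW.
  + apply: cvg_at_left_filter; apply: (@is_derive_continuous _ _ (f b)).
    by apply: dF; rewrite lexx ltW.
- move=> x; rewrite in_itv/= => /andP[/ltW ax /ltW xb].
  by rewrite derive1E; case: (dF x) => //; rewrite ax.
Qed.

Lemma itv_integrable f a b M : a <= b -> measurable_fun `[a, b] f ->
  (forall x, a <= x <= b -> `|f x| <= M) ->
  lebesgue_measure.-integrable `[a, b] (EFin \o f).
Proof.
move=> ab mf fM; apply: measurable_bounded_integrable => //.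
  rewrite /= lebesgue_measure_itv /=; case: ifP => // _.
  by rewrite -EFinB ltry.
exists M; split; first exact: num_real.
by move=> N MN x /=; rewrite in_itv/= => /fM /le_trans; apply; exact: ltW.
Qed.

End RealDerivatives.

Section Circles.
Variable R : realType.
Implicit Types (f g G : R[i] -> R[i]) (Q : R[i] -> R) (a w l : R[i]) (r s t e x : R).

Definition circ r t : R[i] := r * cos t +i* (r * sin t).

Lemma cmod_circ r t : 0 <= r -> cmod (circ r t) = r.
Proof.
move=> r0; rewrite cmodE !exprMn -mulrDr cos2Dsin2 mulr1 sqrtr_sqr.
by rewrite ger0_norm.
Qed.

Lemma circE r t : circ r t = r%:C * circ 1 t.
Proof. by rewrite /circ !mul1r; apply/eqP; rewrite eq_complex /=; apply/andP; split; apply/eqP; ring. Qed.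

Lemma circ0 t : circ 0 t = 0.
Proof. by rewrite /circ !mul0r. Qed.

(** Chain rule along a plane curve: one complex estimate, whose real and imaginary parts are the two
    claims. *)
Lemma cder_curve G (X Y : R -> R) x (p q : R) l :
  is_derive x 1 X p -> is_derive x 1 Y q -> cder G (X x +i* Y x) l ->
  is_derive x 1 (fun y => Re (G (X y +i* Y y))) (Re (l * (p +i* q))) /\
  is_derive x 1 (fun y => Im (G (X y +i* Y y))) (Im (l * (p +i* q))).
Proof.
move=> /is_derive1P dX /is_derive1P dY dG.
suff H e : 0 < e -> exists2 d, 0 < d & forall h, `|h| < d ->
    cmod (G (X (x + h) +i* Y (x + h)) - G (X x +i* Y x) -
      l * (p +i* q) * h%:C) <= e * `|h|.
  have rE (u : R[i]) (h : R) : Re (u * h%:C) = Re u * h by rewrite ReM /=; ring.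
  have iE (u : R[i]) (h : R) : Im (u * h%:C) = Im u * h by rewrite ImM /=; ring.
  split; apply/is_derive1P => e /H[d d0 hd]; exists d => // h /hd.
    by apply: le_trans; rewrite -rE -!ReB; exact: Re_le_cmod.
  by apply: le_trans; rewrite -iE -!ImB; exact: Im_le_cmod.
move=> e0.
(* The increment of the curve is at most [K |h|]: [|p| + |q|] for its linear part and 1 for the
   error in each coordinate. *)
pose K := `|p| + `|q| + 2.
have p0 : 0 <= `|p| by []. have q0 : 0 <= `|q| by [].
have K0 : 0 < K by rewrite /K; lra.
have K2 : 0 < 2 * K by lra.
have l0 := cmod_ge0 l; have L0 : 0 < 4 * (cmod l + 1) by lra.
have [d d0 hd] := (nbhs_cmod _ _).1 (dG _ (divr_gt0 e0 K2)).
(* The bound 1 serves [K]; the other one makes the coordinate errors, multiplied by [l], at most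
   [e |h| / 2]. *)
have m0 : 0 < Num.min 1 (e / (4 * (cmod l + 1))) by rewrite lt_min ltr01 divr_gt0.
have [d1 d10 hd1] := dX _ m0; have [d2 d20 hd2] := dY _ m0.
exists (Num.min (d / K) (Num.min d1 d2)); first by rewrite !lt_min divr_gt0// d10.
move=> h; rewrite !lt_min ltr_pdivlMr// => /and3P[hK h1 h2].
have {hd1} := hd1 _ h1; have {hd2} := hd2 _ h2.
set y := Y (x + h) - Y x - q * h; set z := X (x + h) - X x - p * h => hy hz.
have h0 : 0 <= `|h| by [].
set m := Num.min 1 _ in m0 hy hz.
have mle1 : m <= 1 by rewrite ge_min lexx.
have mle2 : m * (4 * (cmod l + 1)) <= e.
  by rewrite -ler_pdivlMr// ge_min lexx orbT.
set u := X (x + h) +i* Y (x + h); set u0 := X x +i* Y x.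
have uE : u - u0 = (p +i* q) * h%:C + (z +i* y).
  apply/eqP; rewrite eq_complex /= /y /z; apply/andP; split; apply/eqP; ring.
have zy : cmod (z +i* y) <= 2 * (m * `|h|).
  by apply: (le_trans (cmod_le_ReIm _)) => /=; lra.
have pq : cmod ((p +i* q) * h%:C) <= (`|p| + `|q|) * `|h|.
  by rewrite cmodM cmod_real ler_wpM2r// (le_trans (cmod_le_ReIm _)).
have uK : cmod (u - u0) <= K * `|h|.
  rewrite uE (le_trans (cmodD _ _))// /K; nra.
have {}hd := hd u ltac:(lra).
have -> : G u - G u0 - l * (p +i* q) * h%:C =
    (G u - G u0 - l * (u - u0)) + l * (z +i* y) by rewrite uE; ring.
apply: (le_trans (cmodD _ _)); rewrite cmodM.
have e1 : e / (2 * K) * cmod (u - u0) <= e / 2 * `|h|.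
  have -> : e / 2 * `|h| = e / (2 * K) * (K * `|h|) by field; rewrite gt_eqF.
  by rewrite ler_wpM2l// divr_ge0// ltW// mulr_gt0.
have e2 : cmod l * cmod (z +i* y) <= e / 2 * `|h|.
  apply: (le_trans (ler_wpM2l l0 zy)).
  have := mulr_ge0 (ltW m0) h0; nra.
have := le_trans hd e1; lra.
Qed.

Lemma is_derive_circ_r r t :
  is_derive r 1 (fun r => r * cos t) (cos t) /\
  is_derive r 1 (fun r => r * sin t) (sin t).
Proof.
have H (c : R) : is_derive r 1 (fun r => r * c) c.
  apply/is_derive1P => e e0; exists 1 => // h _.
  have -> : (r + h) * c - r * c - c * h = 0 by ring.
  by rewrite normr0 mulr_ge0// ltW.
by split.
Qed.

Lemma is_derive_circ_t r t :
  is_derive t 1 (fun t => r * cos t) (- (r * sin t)) /\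
  is_derive t 1 (fun t => r * sin t) (r * cos t).
Proof.
split.
  rewrite -mulrN; exact: (@is_deriveZ _ _ _ (@cos R) r t 1 _ (is_derive_cos t)).
exact: (@is_deriveZ _ _ _ (@sin R) r t 1 _ (is_derive_sin t)).
Qed.

Lemma rcont_curve Q (X Y : R -> R) x :
  {for x, continuous X} -> {for x, continuous Y} -> rcont Q (X x +i* Y x) ->
  {for x, continuous (fun y => Q (X y +i* Y y))}.
Proof.
move=> /cvgrPdist_lt cX /cvgrPdist_lt cY cQ; apply/cvgrPdist_lt => e /cQ.
move=> /nbhs_cmod[d d0 hd]; have d2 : 0 < d / 2 by rewrite divr_gt0.
near=> y; rewrite distrC; apply: hd; apply: (le_lt_trans (cmod_le_ReIm _)).
rewrite ReB ImB /= (splitr d) [ `|X y - _|]distrC [ `|Y y - _|]distrC.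
by apply: ltrD; near: y; [exact: cX|exact: cY].
Unshelve. all: by end_near. Qed.

Lemma continuous_circ_r Q r t : rcont Q (circ r t) ->
  {for r, continuous (fun r => Q (circ r t))}.
Proof.
have [d1 d2] := is_derive_circ_r r t; apply: (@rcont_curve Q (fun r => r * cos t)).
  exact: is_derive_continuous d1.
exact: is_derive_continuous d2.
Qed.

Lemma continuous_circ_t Q r t : rcont Q (circ r t) ->
  {for t, continuous (fun t => Q (circ r t))}.
Proof.
have [d1 d2] := is_derive_circ_t r t; apply: (@rcont_curve Q (fun t => r * cos t)).
  exact: is_derive_continuous d1.
exact: is_derive_continuous d2.
Qed.

Lemma measurable_circ d (T : measurableType d) (D : set T) (X Y : T -> R) Q :
  measurable_fun setT X -> measurable_fun setT Y ->
  (forall p : T, D p -> rcont Q (circ (X p) (Y p))) ->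
  measurable_fun D (fun p : T => Q (circ (X p) (Y p))).
Proof.
move=> mX mY; apply: measurable_rcont; apply: measurable_funM => //.
  by apply: measurableT_comp => //; apply: continuous_measurable_fun; exact: continuous_cos.
by apply: measurableT_comp => //; apply: continuous_measurable_fun; exact: continuous_sin.
Qed.

End Circles.

(** * Mean values over circles *)

Section MeanValue.
Variable R : realType.
Implicit Types (f g G : R[i] -> R[i]) (Q : R[i] -> R) (a w l : R[i]) (r s t e x : R).
Local Notation mu := (@lebesgue_measure R).
Local Notation angles := (`[0, 2 * pi]%classic : set R).

(** A bounded function becomes nonnegative after adding a constant; this is how Tonelli's theorem is
    brought to bear on a function without sign in [radial_mean]. *)
Lemma integral_addc (D : set R) (f : R -> R) (L M c : R) : measurable D ->
  mu D = L%:E -> measurable_fun D f -> (forall x, D x -> `|f x| <= M) ->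
  (\int[mu]_(x in D) (f x + c)%:E = \int[mu]_(x in D) (f x)%:E + (c * L)%:E)%E.
Proof.
move=> mD DL mf fM.
have fin : (mu D < +oo)%E by rewrite DL ltry.
have fi : mu.-integrable D (EFin \o f).
  apply: measurable_bounded_integrable => //.
  exists M; split; first exact: num_real.
  by move=> N MN x /= /fM /le_trans; apply; exact: ltW.
have ci : mu.-integrable D (EFin \o cst c).
  apply: measurable_bounded_integrable => //.
  exists `|c|; split; first exact: num_real.
  by move=> N MN x /= _; exact: ltW.
transitivity (\int[mu]_(x in D) ((EFin \o f) x + (EFin \o cst c) x))%E.
  by apply: eq_integral => x _ /=; rewrite EFinD.
rewrite integralD//; congr (_ + _)%E.
transitivity (\int[mu]_(x in D) cst c%:E x)%E; first by [].
by rewrite integral_cst// EFinM; congr (_ * _)%E.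
Qed.

Lemma angles_gt0 : 0 < 2 * pi :> R.
Proof. by rewrite mulr_gt0// pi_gt0. Qed.

Lemma mu_angles : mu angles = (2 * pi)%:E.
Proof. by rewrite lebesgue_measure_itv /= lte_fin angles_gt0 sube0. Qed.

(* Exchanging the order of integration of the radial derivative [A] turns its
   vanishing circular means into constancy of the circular means of [h]. *)
Lemma radial_mean (A : R -> R -> R) (h : R -> R) (h0 M : R) s : (0 < s)%R ->
  measurable_fun (`]0%R, s]%classic `*` angles) (fun p => A p.1 p.2) ->
  (forall r, measurable_fun angles (A r)) ->
  (forall t, measurable_fun `]0%R, s] (A^~ t)) ->
  (forall r t, 0 <= r <= s -> `|A r t| <= M) ->
  (forall t, \int[mu]_(r in `]0%R, s]) (A r t)%:E = (h t - h0)%:E)%E ->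
  (forall r, 0 < r <= s -> (\int[mu]_(t in angles) (A r t)%:E = 0)%E) ->
  measurable_fun angles h -> (forall t, `|h t| <= M) ->
  (\int[mu]_(t in angles) (h t)%:E = (2 * pi * h0)%:E)%E.
Proof.
move=> s0 mA mAr mAt AM Ah A0 mh hM.
have mS : measurable (`]0%R, s]%classic : set R) by exact: measurable_itv.
have mC : measurable angles by exact: measurable_itv.
have muS : mu (`]0%R, s]%classic : set R) = s%:E.
  by rewrite lebesgue_measure_itv /= lte_fin s0 sube0.
have AM' r t : (`]0%R, s]%classic : set R) r -> `|A r t| <= M.
  by rewrite /= in_itv /= => /andP[/ltW r0 rs]; apply: AM; rewrite r0.
have mT : measurable_fun (`]0%R, s]%classic `*` angles)
    (fun p : R * R => (A p.1 p.2 + M)%:E).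
  by apply/measurable_EFinP; apply: measurable_funD => //; exact: measurable_cst.
have := @tonelli_rect _ _ _ _ R mu mu _ _ (fun r t => (A r t + M)%:E) mS mC mT.
have A0' r t : (`]0%R, s]%classic : set R) r -> angles t -> (0 <= (A r t + M)%:E)%E.
  move=> Sr _; rewrite lee_fin.
  by have := AM' r t Sr; rewrite ler_norml => /andP[]; lra.
move=> /(_ A0').
have -> : (\int[mu]_(r in `]0%R, s]) \int[mu]_(t in angles) (A r t + M)%:E =
    (M * (2 * pi) * s)%:E)%E.
  rewrite EFinM -muS -integral_cst//; apply: eq_integral => r /set_mem/=.
  rewrite in_itv/= => rs.
  rewrite (integral_addc M mC mu_angles (mAr _) (M := M)) ?A0 ?add0e//.
  by move=> t _; apply: AM; case/andP: rs => /ltW ->.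
have -> : (\int[mu]_(t in angles) \int[mu]_(r in `]0%R, s]) (A r t + M)%:E =
    \int[mu]_(t in angles) (h t + (M * s - h0))%:E)%E.
  apply: eq_integral => t _.
  rewrite (integral_addc M mS muS (mAt _) (M := M)) ?Ah -?EFinD//.
    by congr EFin; ring.
  by move=> r; exact: AM'.
rewrite (integral_addc _ mC mu_angles mh (M := M))// => H.
have hi : (\int[mu]_(t in angles) (h t)%:E)%E \is a fin_num.
  apply: integrable_fin_num => //; apply: itv_integrable mh (fun x _ => hM x).
  exact: ltW angles_gt0.
by case: (X in X \is a fin_num) hi H => // x _ [H]; congr EFin; lra.
Qed.

(** Used with [Q = Re G] and [k = G'], then with [Q = log |g|] and [k = g' / g]: in both cases the
    radial derivative of [Q] is [Re (k e^(it))]. *)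
Lemma radial_mean_circ (k : R[i] -> R[i]) Q s : 0 < s ->
  (forall w, cmod w <= s -> ccont k w) ->
  (forall w, cmod w <= s -> rcont Q w) ->
  (forall r t, 0 <= r <= s ->
    is_derive r 1 (fun r => Q (circ r t)) (Re (k (circ r t) * circ 1 t))) ->
  (forall r, 0 < r <= s ->
    (\int[mu]_(t in angles) (Re (k (circ r t) * circ 1 t))%:E = 0)%E) ->
  (\int[mu]_(t in angles) (Q (circ s t))%:E = (2 * pi * Q 0)%:E)%E.
Proof.
move=> s0 ck cQ dQ k0.
have cs r t : 0 <= r <= s -> cmod (circ r t) <= s.
  by move=> /andP[r0 rs]; rewrite cmod_circ.
have [M1 M10 hM1] := rcont_bounded (fun w ws => rcont_cmod (ck w ws)).
have [M2 M20 hM2] := rcont_bounded cQ.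
(* outside [0, s] the derivative is replaced by 0 to get a total function *)
pose A r t := if 0 <= r <= s then Re (k (circ r t) * circ 1 t) else 0.
have AE r t : 0 <= r <= s -> A r t =
    Re (k (circ r t)) * cos t - Im (k (circ r t)) * sin t.
  by move=> rs; rewrite /A rs ReM /circ !mul1r.
have mcos : measurable_fun setT (@cos R).
  by apply: continuous_measurable_fun; exact: continuous_cos.
have msin : measurable_fun setT (@sin R).
  by apply: continuous_measurable_fun; exact: continuous_sin.
have mA d (T : measurableType d) (D : set T) (X Y : T -> R) : measurable D ->
    measurable_fun setT X -> measurable_fun setT Y ->
    (forall p : T, D p -> 0 <= X p <= s) ->
    measurable_fun D (fun p : T => A (X p) (Y p)).
  move=> mD mX mY hX.
  apply: (@eq_measurable_fun _ _ _ _ D (fun p : T => Re (k (circ (X p) (Y p))) *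
    cos (Y p) - Im (k (circ (X p) (Y p))) * sin (Y p))).
    by move=> p /set_mem Dp; rewrite AE//; exact: hX.
  have mcY : measurable_fun D (fun p : T => cos (Y p)).
    by apply: measurable_funTS; exact: measurableT_comp.
  have msY : measurable_fun D (fun p : T => sin (Y p)).
    by apply: measurable_funTS; exact: measurableT_comp.
  apply: measurable_funB; apply: measurable_funM => //.
    apply: (@measurable_circ R _ _ D X Y (fun w => Re (k w)) mX mY) => p /hX Dp.
    exact/rcont_Re/ck/cs.
  apply: (@measurable_circ R _ _ D X Y (fun w => Im (k w)) mX mY) => p /hX Dp.
  exact/rcont_Im/ck/cs.
have AM r t : 0 <= r <= s -> `|A r t| <= M1 + M2.
  move=> rs; rewrite /A rs; apply: (le_trans (Re_le_cmod _)).
  rewrite cmodM cmod_circ// mulr1; have := hM1 _ (cs r t rs).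
  by rewrite ger0_norm ?cmod_ge0//; lra.
have s0s : 0 <= s <= s by rewrite lexx ltW.
have mS : measurable (`]0%R, s]%classic : set R) by exact: measurable_itv.
have mC : measurable angles by exact: measurable_itv.
apply: (@radial_mean A _ (Q 0) (M1 + M2) s s0).
- apply: mA => //; first by apply: measurableX; exact: measurable_itv.
  by move=> p [] /=; rewrite in_itv /= => /andP[/ltW -> ->].
- move=> r; have [rs|rs] := boolP (0 <= r <= s).
    exact: (@mA _ _ _ (fun=> r) id mC).
  have -> : A r = cst 0 by apply/funext => t; rewrite /A (negbTE rs).
  exact: measurable_cst.
- move=> t; apply: (@mA _ _ _ id (fun=> t) mS) => //.
  by move=> p /=; rewrite in_itv /= => /andP[/ltW -> ->].
- exact: AM.
(* The circular means are known to vanish for [r > 0] only, hence the half-open interval; the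
   fundamental theorem wants the closed one, which differs by a null set. *)
- move=> t; rewrite integral_itv_obnd_cbnd; last first.
    apply/measurable_EFinP; apply: (@mA _ _ _ id (fun=> t) mS) => //.
    by move=> p /=; rewrite in_itv /= => /andP[/ltW -> ->].
  rewrite -(circ0 t) -(@FTC2_derive R (fun r => Re (k (circ r t) * circ 1 t))
    (fun r => Q (circ r t)))//.
  + by apply: eq_integral => r /set_mem/=; rewrite in_itv/= /A => ->.
  + move=> r rs; apply: (@continuous_circ_r R (fun w => Re (k w * circ 1 t))).
    by apply/rcont_Re/ccontM; [exact/ck/cs|exact: ccont_cst].
- move=> r rs; rewrite -[RHS](k0 r rs); apply: eq_integral => t _.
  by rewrite /A; case/andP: rs => /ltW -> ->.
- apply: (@measurable_circ R _ _ _ (fun=> s) id) => // t _.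
  by apply/cQ/cs.
- move=> t; apply: (@le_trans _ _ M2); first exact/hM2/cs.
  by rewrite lerDr.
Qed.

(** [Re (G' e^(it))] is the derivative in [t] of [Im (G (r e^(it))) / r], which is periodic, so its
    integral over a full turn is 0. *)
Lemma mean_Re G s : 0 < s -> (forall w, cmod w <= s -> cdiff 1 G w) ->
  (\int[mu]_(t in angles) (Re (G (circ s t)))%:E = (2 * pi * Re (G 0))%:E)%E.
Proof.
move=> s0 hG.
have cs r t : 0 <= r <= s -> cmod (circ r t) <= s.
  by move=> /andP[r0 rs]; rewrite cmod_circ.
apply: (@radial_mean_circ (cD G) (fun w => Re (G w)) s s0).
- by move=> w /hG[].
- by move=> w /hG h; apply: rcont_Re; exact: cdiff_cont h.
- move=> r t rs; have [/cnbhs_center /= dG _] := hG _ (cs r t rs).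
  have [d1 d2] := is_derive_circ_r r t.
  have [d3 _] := cder_curve d1 d2 dG.
  have -> : circ 1 t = cos t +i* sin t by rewrite /circ !mul1r.
  exact: d3.
- move=> r rs; have r0 : 0 < r by case/andP: rs.
  have rs' : 0 <= r <= s by case/andP: rs => /ltW ->.
  apply: etrans; first apply: (@FTC2_derive R
    (fun t => Re (cD G (circ r t) * circ 1 t)) (fun t => r^-1 * Im (G (circ r t)))
    _ _ angles_gt0).
  + move=> t _; have [/cnbhs_center /= dG _] := hG _ (cs r t rs').
    have [d1 d2] := is_derive_circ_t r t.
    have [_ d3] := cder_curve d1 d2 dG.
    have := @is_deriveZ _ _ _ _ r^-1 t 1 _ d3; congr is_derive.
    rewrite /circ !mul1r /GRing.scale ImM ReM /=; field; exact: lt0r_neq0.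
  + move=> t _.
    (* Continuity in the angle is obtained for functions of the point [circ r u], so the unit
       direction is expressed through this point. *)
    have E u : circ 1 u = r^-1%:C * circ r u.
      by rewrite (circE r) mulrA -rmorphM/= mulVf ?mul1r ?lt0r_neq0.
    rewrite (_ : (fun u => Re (cD G (circ r u) * circ 1 u)) =
      fun u => Re (cD G (circ r u) * (r^-1%:C * circ r u))); last first.
      by apply/funext => u; rewrite E.
    apply: (@continuous_circ_t R (fun w => Re (cD G w * (r^-1%:C * w)))).
    apply: rcont_Re; apply: ccontM; first by have [] := hG _ (cs r t rs').
    by apply: ccontM; [exact: ccont_cst|exact: ccont_id].
  + by rewrite /circ mulr_natl cos2pi sin2pi cos0 sin0 subrr.
Qed.

(** [log |g|] is half of [log |g|^2], whose radial derivative is [2 Re (g' / g e^(it))]. Up to the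
    factor [1 / r], the mean of [Re (g' / g e^(it))] is that of [Re (w g'(w) / g(w))], which is 0 by
    [mean_Re] because [w g'(w) / g(w)] vanishes at 0. *)
Lemma mean_ln_cmod g s : 0 < s ->
  (forall w, cmod w <= s -> cdiff 2 g w /\ g w != 0) ->
  (\int[mu]_(t in angles) (ln (cmod (g (circ s t))))%:E =
    (2 * pi * ln (cmod (g 0)))%:E)%E.
Proof.
move=> s0 hg.
have cs r t : 0 <= r <= s -> cmod (circ r t) <= s.
  by move=> /andP[r0 rs]; rewrite cmod_circ.
pose k w := cD g w * (g w)^-1.
have kd w : cmod w <= s -> cdiff 1 k w.
  move=> /hg[h1 h2]; apply: cdiffM; first exact: h1.2.
  by apply: cdiffV => //; exact: cdiffW.
apply: (@radial_mean_circ k (fun w => ln (cmod (g w))) s s0).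
- by move=> w /kd; exact: cdiff_cont.
- move=> w /hg[h1 h2]; apply: (rcont_comp (Q := fun w => cmod (g w))).
    by apply: rcont_cmod; exact: cdiff_cont h1.
  by apply: continuous_ln; rewrite cmod_gt0.
- move=> r t rs; have [[/cnbhs_center /= dg _] g0] := hg _ (cs r t rs).
  have [d1 d2] := is_derive_circ_r r t.
  have [] := cder_curve d1 d2 dg.
  have -> : cos t +i* sin t = circ 1 t by rewrite /circ !mul1r.
  set c := circ 1 t; set l := cD g _ * c => d3 d4.
  have N0 : 0 < cmod (g (circ r t)) ^+ 2 by rewrite exprn_gt0// cmod_gt0.
  pose P y := Re (g (circ y t)) ^+ 2 + Im (g (circ y t)) ^+ 2.
  have d5 : is_derive r 1 P
      (2 * Re (g (circ r t)) * Re l + 2 * Im (g (circ r t)) * Im l).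
    have := is_deriveD (is_deriveX 2 d3) (is_deriveX 2 d4).
    by congr is_derive; rewrite /= !expr1 /GRing.scale /= !mulr_natl.
  rewrite cmod_sqr in N0.
  have d6 := @is_derive1_comp R (@ln R) P r _ _ (is_derive1_ln N0) d5.
  have := @is_deriveZ _ _ _ _ 2^-1 r 1 _ d6.
  congr is_derive.
    apply/funext => y; rewrite /= /P -cmod_sqr /GRing.scale /=.
    (* The two functions must agree at every real [y], also beyond [s], where [g] may vanish; there
       both sides are 0 since [ln 0 = 0]. *)
    have [c0|c0] := ltP 0 (cmod (g (circ y t))).
      by rewrite lnXn// mulr2n; field.
    by rewrite (ln0 c0) ln0 ?mulr0// expr2; have := cmod_ge0 (g (circ y t)); nra.
  have -> : k (circ r t) * c = l / g (circ r t) by rewrite /k /l mulrAC.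
  rewrite /GRing.scale /=.
  move: l N0 {d3 d4 d5 d6} => l; case: (g (circ r t)) => x y /= N0.
  by case: l => p q /=; field; rewrite gt_eqF.
- move=> r rs; have r0 : 0 < r by case/andP: rs.
  have rs' w : cmod w <= r -> cmod w <= s by case/andP: rs => _ rs /le_trans; apply.
  pose G w := w * k w.
  have GE t : Re (k (circ r t) * circ 1 t) = r^-1 * Re (G (circ r t)).
    rewrite /G {2}circE [_ * k _]mulrC mulrCA.
    rewrite -[r%:C]complexr0.
    case: (k (circ r t) * circ 1 t) => p q /=.
    by rewrite mul0r subr0 mulKf// gt_eqF.
  have Gd w : cmod w <= r -> cdiff 1 G w.
    by move=> /rs' ws; apply: cdiffM (kd w ws); exact: cdiff_id.
  have := mean_Re r0 Gd; rewrite {2}/G mul0r /= mulr0 => G0.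
  transitivity (r^-1%:E * \int[mu]_(t in angles) (Re (G (circ r t)))%:E)%E.
    have [M M0 hM] := rcont_bounded (fun w wr => rcont_Re (cdiff_cont (Gd w wr))).
    rewrite -integralZl//.
      by apply: eq_integral => t _; rewrite GE EFinM.
    apply: (itv_integrable (M := M)); first exact: ltW angles_gt0.
      apply: (@measurable_circ R _ _ _ (fun=> r) id (fun w => Re (G w))) => // t _.
      by apply: rcont_Re; apply: cdiff_cont; apply: Gd; rewrite cmod_circ// ltW.
    by move=> t _; apply: hM; rewrite cmod_circ// ltW.
  by rewrite G0 mule0.
Qed.

End MeanValue.

(** * Jensen's formula *)

Section LogKernel.
Variable R : realType.
Implicit Types (f g : R[i] -> R[i]) (a b z w : R[i]) (r s t x : R).
Local Notation mu := (@lebesgue_measure R).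
Local Notation angles := (`[0, 2 * pi]%classic : set R).

(* [log (2 / x)], which is nonnegative on the distances [x <= 2] between points
   of the disc; truncated at 0 for larger [x] so as to be nonnegative everywhere. *)
Definition kap x : \bar R :=
  if x == 0 then +oo%E else (Num.max 0 (ln 2 - ln x))%:E.

Lemma kap_ge0 x : (0 <= kap x)%E.
Proof. by rewrite /kap; case: ifP => _; rewrite ?leey// lee_fin le_max lexx. Qed.

Lemma kapE x : 0 < x -> x <= 2 -> kap x = (ln 2 - ln x)%:E.
Proof.
move=> x0 x2; rewrite /kap gt_eqF//; congr EFin; apply/max_idPr.
by rewrite subr_ge0 ler_ln ?posrE.
Qed.

Lemma kap_fin x : x != 0 -> kap x \is a fin_num.
Proof. by move=> x0; rewrite /kap (negbTE x0). Qed.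

Lemma measurable_kap : measurable_fun setT kap.
Proof.
apply: measurable_fun_ifT => //.
  by apply: measurable_fun_eqr; [exact: measurable_id|exact: measurable_cst].
apply/measurable_EFinP; apply: measurable_maxr; first exact: measurable_cst.
by apply: measurable_funB; [exact: measurable_cst|exact: measurable_ln].
Qed.

(** Continuity up to 0 with values in the extended reals, in the sequential form that Fatou's lemma
    consumes. *)
Lemma kap_cvg (u : nat -> R) x : (forall n, 0 <= u n) -> 0 <= x ->
  u @ \oo --> x -> kap (u n) @[n --> \oo] --> kap x.
Proof.
move=> u0; rewrite le_eqVlt => /predU1P[<-|x0] ux.
  rewrite {2}/kap eqxx; apply/cvgeyPge => A.
  (* A positive [u n] below this number has [ln 2 - ln (u n) > A]. *)
  have e0 : 0 < expR (ln 2 - A) by exact: expR_gt0.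
  have /cvgrPdist_lt/(_ _ e0) := ux; apply: filterS => n /=.
  rewrite sub0r normrN ger0_norm// => une; rewrite /kap; case: ifPn => [_|un].
    by rewrite leey.
  rewrite lee_fin le_max; apply/orP; right.
  have un0 : 0 < u n by rewrite lt_neqAle eq_sym un u0.
  have : ln (u n) < ln (expR (ln 2 - A)) by rewrite ltr_ln ?posrE.
  by rewrite expRK; lra.
have near0 : \forall n \near \oo, (Num.max 0 (ln 2 - ln (u n)))%:E = kap (u n).
  have /cvgrPdist_lt/(_ _ x0) := ux; apply: filterS => n /=.
  rewrite /kap => h; rewrite ifF//; apply/eqP => un.
  by move: h; rewrite un subr0 gtr0_norm// ltxx.
rewrite {2}/kap gt_eqF//.
apply: cvg_trans; first exact: (near_eq_cvg near0).
apply: cvg_EFin; first by near=> n.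
apply: (@cvg_comp _ _ _ _ (fun y => Num.max 0 (ln 2 - ln y)) _ _ _ ux).
have lnx : (fun y => ln 2 - ln y) @ x --> ln 2 - ln x.
  by apply: cvgB; [exact: cvg_cst|exact: continuous_ln].
exact: (@continuous_max _ _ (fun=> 0) (fun y => ln 2 - ln y) x
  (@cst_continuous _ _ _ _) lnx).
Unshelve. all: by end_near. Qed.

(** The truncation in [kap] is inactive up to 2, so on the circle it is [log |2 / g|], and [2 / g]
    is again zero-free. *)
Lemma mean_kap g s : 0 < s ->
  (forall w, cmod w <= s -> cdiff 2 g w /\ g w != 0) ->
  (forall t, cmod (g (circ s t)) <= 2) ->
  (\int[mu]_(t in angles) kap (cmod (g (circ s t))) =
    (2 * pi * (ln 2 - ln (cmod (g 0))))%:E)%E.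
Proof.
move=> s0 hg g2.
have g0 w : cmod w <= s -> 0 < cmod (g w) by rewrite cmod_gt0 => /hg[].
pose h w := 2%:C * (g w)^-1.
have c2 : cmod (2%:C : R[i]) = 2 by rewrite cmod_real ger0_norm.
have lnh w : cmod w <= s -> ln (cmod (h w)) = ln 2 - ln (cmod (g w)).
  by move=> ws; rewrite cmodM cmodV c2 ln_div ?posrE ?g0.
have hd w : cmod w <= s -> cdiff 2 h w /\ h w != 0.
  move=> /hg[h1 h2]; split.
    by apply: cdiffM; [exact: cdiff_cst|exact: cdiffV].
  by rewrite mulf_neq0 ?invr_eq0// -cmod_gt0 c2.
have := mean_ln_cmod s0 hd; rewrite lnh ?cmod0 ?ltW// => <-.
apply: eq_integral => t _; have cs : cmod (circ s t) <= s by rewrite cmod_circ// ltW.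
by rewrite lnh// kapE ?g0.
Qed.

(** Blaschke reflection: the right-hand factor can vanish only at the mirror point [s^2 / conjc b],
    which lies outside the closed disc of radius [s] when [|b| < s]. *)
Lemma cmod_reflect s b t : 0 < s ->
  cmod (circ s t - b) = cmod (s%:C - conjc b / s%:C * circ s t).
Proof.
move=> s0; apply/eqP; rewrite -(eqrXn2 (n := 2)) ?cmod_ge0//.
have sC : s%:C != 0 by rewrite -cmod_gt0 cmod_real normr_gt0 gt_eqF.
have -> : conjc b / s%:C * circ s t = conjc b * circ 1 t.
  by rewrite (circE s) mulrACA mulrA mulfK.
case: b => x y; rewrite !cmod_sqr /circ /=; apply/eqP.
have := cos2Dsin2 t; move: (cos t) (sin t) => c d; rewrite !mul1r => cd.
have -> : (s - (x * c - - y * d)) ^+ 2 + (0 - (x * d + - y * c)) ^+ 2 =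
  s ^+ 2 - 2 * s * (x * c + y * d) + (x ^+ 2 + y ^+ 2) * (c ^+ 2 + d ^+ 2) by ring.
have -> : (s * c - x) ^+ 2 + (s * d - y) ^+ 2 =
  s ^+ 2 * (c ^+ 2 + d ^+ 2) - 2 * s * (x * c + y * d) + (x ^+ 2 + y ^+ 2) by ring.
by rewrite cd !mulr1.
Qed.

Lemma mean_kap_out w r : 0 < r -> r < cmod w -> cmod w + r <= 2 ->
  (\int[mu]_(t in angles) kap (cmod (w - circ r t)%R) =
    (2 * pi)%:E * kap (cmod w))%E.
Proof.
move=> r0 rw wr; rewrite kapE; [|lra..].
under eq_integral do rewrite -mulN1r.
rewrite -EFinM -[in RHS](addr0 w) -[in RHS](mulr0 (-1)).
apply: (mean_kap (g := fun z => w + (-1) * z) r0).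
- move=> z zr; split.
    apply: cdiffD; first exact: cdiff_cst.
    by apply: cdiffM; [exact: cdiff_cst|exact: cdiff_id].
  rewrite mulN1r subr_eq0; apply/eqP => wz; move: rw; rewrite wz; lra.
- move=> t; rewrite mulN1r; have := cmodD w (- circ r t).
  by rewrite cmodN cmod_circ; lra.
Qed.

(** After [cmod_reflect] the function takes the value [r] at the centre whatever [w] is, so the mean
    does not depend on [w]. *)
Lemma mean_kap_in w r : cmod w < r -> cmod w + r <= 2 ->
  (\int[mu]_(t in angles) kap (cmod (w - circ r t)%R) =
    (2 * pi * (ln 2 - ln r))%:E)%E.
Proof.
move=> wr wr2; have w0 := cmod_ge0 w; have r0 : 0 < r by lra.
under eq_integral do rewrite cmod_distC (cmod_reflect _ _ r0).
have cr : cmod (conjc w / r%:C) < 1.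
  rewrite cmodM cmodV cmod_real (gtr0_norm r0) ltr_pdivrMr// mul1r.
  rewrite (_ : cmod (conjc w) = cmod w)//; case: (w) => x y.
  by rewrite !cmodE sqrrN.
under eq_integral do rewrite -mulNr.
rewrite [in RHS](_ : r = cmod (r%:C + (- (conjc w / r%:C)) * 0)); last first.
  by rewrite mulr0 addr0 cmod_real gtr0_norm.
apply: (mean_kap (g := fun z => r%:C + (- (conjc w / r%:C)) * z) r0).
- move=> z zr; split.
    apply: cdiffD; first exact: cdiff_cst.
    by apply: cdiffM; [exact: cdiff_cst|exact: cdiff_id].
  rewrite mulNr subr_eq0; apply/eqP => rwz.
  have : cmod (r%:C : R[i]) < r.
    rewrite rwz cmodM; have := cmod_ge0 z; have := cmod_ge0 (conjc w / r%:C).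
    by nra.
  by rewrite cmod_real gtr0_norm// ltxx.
- move=> t; rewrite mulNr -cmod_reflect//.
  apply: (le_trans (cmodD _ _)); rewrite cmodN cmod_circ; lra.
Qed.

(** Superharmonicity of the kernel. For [w] off the circle the mean is known exactly; on the circle
    the integrand is singular, and the inequality comes from interior points tending to [w], by
    Fatou's lemma. *)
Lemma kap_sub_mean w r : 0 < r -> cmod w + r <= 2 ->
  (\int[mu]_(t in angles) kap (cmod (w - circ r t)%R) <=
    (2 * pi)%:E * kap (cmod w))%E.
Proof.
move=> r0 wr2; have [wr|rw|wr] := ltgtP (cmod w) r.
- rewrite mean_kap_in//; have [w0|w0] := eqVneq (cmod w) 0.
    by rewrite w0 /kap eqxx gt0_muley ?leey// lte_fin angles_gt0.
  have w0' : 0 < cmod w by rewrite lt_neqAle eq_sym w0 cmod_ge0.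
  rewrite kapE//; last lra.
  rewrite -EFinM lee_fin ler_pM2l ?angles_gt0// lerD2l lerN2.
  by rewrite ler_ln ?posrE// ltW.
- by rewrite mean_kap_out.
have w0' : 0 < cmod w by rewrite wr.
(* [n + 2] keeps the factor in [(0, 1)], so that [u n] tends to [w] from inside the circle. *)
pose u n := (1 - n.+2%:R^-1 : R)%:C * w.
have c0 n : 0 < 1 - n.+2%:R^-1 :> R by rewrite subr_gt0 invf_lt1 ?ltr1n.
have c1 n : 1 - n.+2%:R^-1 < 1 :> R by rewrite gtrBl invr_gt0.
have cu n : cmod (u n) = (1 - n.+2%:R^-1) * cmod w.
  by rewrite /u cmodM cmod_real gtr0_norm.
have ur n : cmod (u n) < r.
  by rewrite cu wr gtr_pMl.
have uw : (fun n => cmod (w - u n)) @ \oo --> 0.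
  have -> : (fun n => cmod (w - u n)) = fun n => n.+2%:R^-1 * cmod w.
    apply/funext => n; rewrite /u rmorphB/= mulrBl mul1r opprB addrC subrK.
    by rewrite cmodM cmod_real gtr0_norm// invr_gt0.
  rewrite -[X in _ --> X](mul0r (cmod w)); apply: cvgM; last exact: cvg_cst.
  by have := @cvg_harmonic R; rewrite -cvg_shiftS.
have mk (c : R[i]) : measurable_fun angles (fun t => kap (cmod (c - circ r t)%R)).
  apply: measurableT_comp; first exact: measurable_kap.
  apply: (@measurable_circ R _ _ _ (fun=> r) id (fun z => cmod (c - z))) => // t _.
  apply: (rcont_cmod (f := fun z => c - z)).
  apply: (@cdiff_cont _ 0); apply: cdiffD; first exact: cdiff_cst.
  apply: (@cdiff_ext _ _ (fun z => (-1) * z)); first by apply: cnbhsE => z /=; rewrite mulN1r.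
  by apply: cdiffM; [exact: cdiff_cst|exact: cdiff_id].
have mC : measurable angles by exact: measurable_itv.
have F := @fatou _ _ R mu _ mC (fun n t => kap (cmod (u n - circ r t)%R))
  (fun n => mk (u n)) (fun _ _ _ => kap_ge0 _).
have -> : (\int[mu]_(t in angles) kap (cmod (w - circ r t)%R) =
    \int[mu]_(t in angles) limn_einf (fun n => kap (cmod (u n - circ r t)%R)))%E.
  apply: eq_integral => t _; apply/esym.
  have h : kap (cmod (u n - circ r t)%R) @[n --> \oo] --> kap (cmod (w - circ r t)%R).
    apply: kap_cvg; [by move=> n; exact: cmod_ge0|exact: cmod_ge0|].
    apply/cvgrPdist_lt => e e0; have /cvgrPdist_lt/(_ _ e0) := uw.
    apply: filterS => n /=; rewrite sub0r normrN ger0_norm ?cmod_ge0//.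
    apply: le_lt_trans; rewrite ler_norml; apply/andP; split.
      rewrite lerNl opprB; apply: (le_trans (cmod_leB _ _)).
      by rewrite cmod_distC (_ : _ - _ = w - u n)//; ring.
    by apply: (le_trans (cmod_leB _ _)); rewrite (_ : _ - _ = w - u n)//; ring.
  by rewrite is_cvg_limn_einfE; [exact: cvg_lim h|apply/cvg_ex; eexists; exact: h].
apply: (le_trans F).
have -> : (fun n => \int[mu]_(t in angles) kap (cmod (u n - circ r t)%R))%E =
    fun=> (2 * pi * (ln 2 - ln r))%:E.
  by apply/funext => n; rewrite mean_kap_in//; have := ur n; lra.
rewrite is_cvg_limn_einfE; last exact: is_cvg_cst.
rewrite lim_cst// kapE//; last lra.
by rewrite -EFinM wr.
Qed.

End LogKernel.

(** * Jensen's formula for [phi - z] *)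

Section Jensen.
Variable R : realType.
Implicit Types (f g phi : R[i] -> R[i]) (a b z w : R[i]) (r s t x : R).
Local Notation mu := (@lebesgue_measure R).
Local Notation angles := (`[0, 2 * pi]%classic : set R).

Lemma cmod_prod (I : Type) (zs : seq I) (F : I -> R[i]) :
  cmod (\prod_(i <- zs) F i) = \prod_(i <- zs) cmod (F i).
Proof. by apply: big_morph; [exact: cmodM|exact: cmod1]. Qed.

Lemma ln_prodX (I : eqType) (zs : seq I) (x : I -> R) (m : I -> nat) :
  (forall i, i \in zs -> 0 < x i) ->
  ln (\prod_(i <- zs) x i ^+ m i) = \sum_(i <- zs) (m i)%:R * ln (x i).
Proof.
elim: zs => [|i zs ih] h; first by rewrite !big_nil ln1.
have xi : 0 < x i by apply: h; rewrite mem_head.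
have hz j : j \in zs -> 0 < x j by move=> jz; apply: h; rewrite inE jz orbT.
rewrite !big_cons lnM ?posrE ?exprn_gt0//; last first.
  by rewrite big_seq; apply: prodr_gt0 => j /hz; exact: exprn_gt0.
by rewrite ih// lnXn// mulr_natl.
Qed.

Lemma cmod_conjc b : cmod (conjc b) = cmod b.
Proof. by case: b => x y; rewrite !cmodE sqrrN. Qed.

Lemma cmod_sub_disc z w : unit_disc z -> unit_disc w -> cmod (z - w) <= 2.
Proof.
rewrite /unit_disc /= => zd wd; apply: (le_trans (cmodD _ _)).
by rewrite cmodN; lra.
Qed.

(** Replacing every zero by its reflection gives a zero-free [F] with the modulus of [phi - z] on
    the circle. At the centre each zero [b] changes the modulus by the factor [s / |b|], and the
    logarithms of these factors make up [partial_counting]. A preimage on the circle would survive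
    its own reflection, hence the last hypothesis. *)
Lemma jensen phi z s : analytic_self_map phi -> phi 0 <> z -> unit_disc z ->
  0 < s < 1 -> (forall b, preimages phi z b -> cmod b <> s) ->
  (partial_counting phi s z + ((2 * pi)^-1)%:E *
     \int[mu]_(t in angles) kap (cmod (phi (circ s t) - z)%R) =
   kap (cmod (phi 0 - z)%R))%E.
Proof.
move=> hphi phi0 zd /andP[s0 s1] nos.
have fin := finite_preimages hphi phi0 s1.
have [zs [uzs zsE]] : exists zs : seq R[i], uniq zs /\
    preimages phi z `&` [set w | cmod w <= s] = [set` zs].
  exists (enum_fset (fset_set (preimages phi z `&` [set w | cmod w <= s]))).
  by split; [exact: fset_uniq|rewrite -[LHS](fset_setK fin)].
have hzs b : b \in zs <-> preimages phi z b /\ cmod b <= s.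
  have : (preimages phi z `&` [set w | cmod w <= s]) b <-> b \in zs by rewrite zsE.
  by move=> [h1 h2]; split=> [/h2[]//|[bz br]]; apply: h1.
have bs b : b \in zs -> cmod b < s.
  by move=> /hzs[bz]; rewrite le_eqVlt => /predU1P[/(nos _ bz)//|].
have b0 b : b \in zs -> 0 < cmod b.
  by move=> /hzs[[_ bz] _]; rewrite cmod_gt0; apply/eqP => bb; rewrite bb in bz.
have [g [hg gE]] := disc_factorization hphi phi0 s1 uzs hzs.
pose m := multiplicity phi.
pose F w := \prod_(b <- zs) (s%:C - conjc b / s%:C * w) ^+ m b * g w.
have cs t : cmod (circ s t) <= s by rewrite cmod_circ// ltW.
have FE t : cmod (F (circ s t)) = cmod (phi (circ s t) - z).
  rewrite (gE _ (cs t)) /F [LHS]cmodM [RHS]cmodM; congr (_ * _).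
  rewrite !cmod_prod; apply: eq_bigr => b _.
  by rewrite [LHS]cmodX [RHS]cmodX (cmod_reflect b t s0).
have hF w : cmod w <= s -> cdiff 2 F w /\ F w != 0.
  move=> ws; have [g1 g2] := hg w ws; split.
    apply: (@cdiffM R 2 (fun w => \prod_(b <- zs) (s%:C - conjc b / s%:C * w) ^+ m b)
      g w _ g1).
    apply: (@cdiff_prod R 2 w _ zs (fun b w => (s%:C - conjc b / s%:C * w) ^+ m b)).
    move=> b; apply: (@cdiffX R 2 (fun w => s%:C - conjc b / s%:C * w)).
    apply: (@cdiff_ext _ _ (fun w => s%:C + (- (conjc b / s%:C)) * w)).
      by apply: cnbhsE => u /=; rewrite mulNr.
    apply: cdiffD; first exact: cdiff_cst.
    by apply: cdiffM; [exact: cdiff_cst|exact: cdiff_id].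
  apply: mulf_neq0 => //; rewrite prodf_seq_neq0; apply/allP => b bzs.
  apply/implyP => _; apply: expf_neq0; rewrite subr_eq0; apply/eqP => sE.
  have : cmod (s%:C : R[i]) < s.
    rewrite sE !cmodM cmodV cmod_conjc cmod_real gtr0_norm//.
    rewrite mulrAC ltr_pdivrMr//; have := bs _ bzs; have := b0 _ bzs.
    by have := cmod_ge0 w; nra.
  by rewrite cmod_real gtr0_norm// ltxx.
have F2 t : cmod (F (circ s t)) <= 2.
  rewrite FE; apply: cmod_sub_disc zd; apply: hphi.2.
  by rewrite /unit_disc /= (le_lt_trans (cs t)).
have d0 : unit_disc (0 : R[i]) by change (cmod (0 : R[i]) < 1); rewrite cmod0 ltr01.
have f0 : 0 < cmod (phi 0 - z) by rewrite cmod_gt0 subr_eq0; exact/eqP.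
rewrite kapE//; last by apply: cmod_sub_disc zd; exact: hphi.2.
have -> : (\int[mu]_(t in angles) kap (cmod (phi (circ s t) - z)%R) =
    (2 * pi * (ln 2 - ln (cmod (F 0))))%:E)%E.
  by rewrite -(mean_kap s0 hF F2); apply: eq_integral => t _; rewrite FE.
have -> : partial_counting phi s z =
    (\sum_(b <- zs) (m b)%:R * ln (s / cmod b))%:E.
  rewrite /partial_counting zsE esum_fset//; last first.
    move=> b /set_mem/= bzs; rewrite lee_fin mulr_ge0// ln_ge0//.
    by rewrite ler_pdivlMr ?b0// mul1r ltW ?bs.
    exact: finite_seq.
  by rewrite -(fsbig_seq _ _ uzs) sumEFin.
rewrite -EFinM -EFinD mulKf; last by rewrite lt0r_neq0// angles_gt0.
congr EFin.
have g00 : 0 < cmod (g 0) by rewrite cmod_gt0; case: (hg 0) => //; rewrite cmod0 ltW.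
have P1 : 0 < \prod_(b <- zs) s ^+ m b.
  by apply: prodr_gt0 => b _; exact: exprn_gt0.
have P2 : 0 < \prod_(b <- zs) cmod b ^+ m b.
  by rewrite big_seq; apply: prodr_gt0 => b /b0; exact: exprn_gt0.
have -> : cmod (F 0) = (\prod_(b <- zs) s ^+ m b) * cmod (g 0).
  rewrite /F cmodM cmod_prod; congr (_ * _); apply: eq_bigr => b _.
  by rewrite mulr0 subr0 cmodX cmod_real gtr0_norm.
have -> : cmod (phi 0 - z) = (\prod_(b <- zs) cmod b ^+ m b) * cmod (g 0).
  rewrite gE; last by rewrite cmod0 ltW.
  rewrite cmodM cmod_prod; congr (_ * _); apply: eq_bigr => b _.
  by rewrite sub0r cmodX cmodN.
rewrite !lnM ?posrE// (ln_prodX (x := fun=> s))// (ln_prodX (x := fun b => cmod b))//.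
have -> : \sum_(b <- zs) (m b)%:R * ln (s / cmod b) =
   \sum_(b <- zs) (m b)%:R * ln s - \sum_(b <- zs) (m b)%:R * ln (cmod b).
  rewrite -sumrB big_seq [RHS]big_seq; apply: eq_bigr => b /b0 bb.
  by rewrite ln_div ?posrE// mulrBr.
by ring.
Qed.

End Jensen.

(** * The weight *)

Section PolarFiniteness.
Variable R : realType.
Implicit Types (r s t x y k : R).
Local Notation mu := (@lebesgue_measure R).

Lemma measurable_mulrl k : measurable_fun setT (fun x : R => k * x).
Proof. by apply: measurable_funM. Qed.

(** Lebesgue measure is determined by half-open intervals, on which it agrees with [k] times its
    image under [x |-> k x]. *)
Lemma ge0_integral_scale k (f : R -> \bar R) : 0 < k ->
  measurable_fun setT f -> (forall x, (0 <= f x)%E) ->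
  (\int[mu]_x f x = k%:E * \int[mu]_x f (k * x)%R)%E.
Proof.
move=> k0 mf f0.
pose pf : {measure set (measurableTypeR R) -> \bar R} :=
  @measure_function_pushforward__canonical__measure_function_Measure _ _
    (measurableTypeR R) (measurableTypeR R) R mu _ (measurable_mulrl k).
pose nu : {measure set (measurableTypeR R) -> \bar R} :=
  mscale (NngNum (ltW k0)) pf.
have E A : measurable A -> mu A = nu A.
  apply: lebesgue_measure_unique => X [[a b] _ <-] /=.
  rewrite /nu /= /mscale /= /pushforward.
  have -> : (fun x => k * x) @^-1` `]a, b]%classic = `]a / k, b / k]%classic.
    apply/seteqP; split => x /=; rewrite !in_itv /= ltr_pdivrMr// ler_pdivlMr//;
      by rewrite ![x * k]mulrC.
  rewrite !lebesgue_measure_itv /= !lte_fin ltr_pM2r ?invr_gt0//.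
  case: ifP => _; last by rewrite mule0.
  rewrite -!EFinB -EFinM; congr EFin; field; exact: lt0r_neq0.
transitivity (\int[nu]_x f x)%E.
  by apply: eq_measure_integral => A mA _; exact: E.
rewrite ge0_integral_mscale//=; congr (_ * _)%E.
by rewrite ge0_integral_pushforward//; exact: measurable_mulrl.
Qed.

(** The density [s v(s)], cut off because [v] is arbitrary outside the disc; as a total function it
    can be rescaled and integrated over the whole line. *)
Definition wdens (v : R[i] -> R) s : R := if 0 < s < 1 then v s%:C * s else 0.

Variable v : R[i] -> R.
Hypothesis hv : radial_weight v.

Lemma radial_weight_ge0 s : 0 < s < 1 -> 0 <= v s%:C.
Proof.
move=> /andP[s0 s1]; apply: hv.1.1.
by change (cmod (s%:C : R[i]) < 1); rewrite cmod_real gtr0_norm.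
Qed.

Lemma wdens_ge0 s : 0 <= wdens v s.
Proof.
rewrite /wdens; case: ifP => // h; apply: mulr_ge0; first exact: radial_weight_ge0.
by case/andP: h => /ltW.
Qed.

Let D := [set p : R * R | unit_disc (p.1 +i* p.2)].

Let mD : measurable D.
Proof.
apply: measurable_copen => w wd; apply/nbhs_cmod; exists (1 - cmod w).
  by rewrite subr_gt0.
move=> u uw; change (cmod u < 1); have := cmod_leB u w; lra.
Qed.

Let vt s : R := if 0 < s < 1 then v s%:C else 0.

Let vt_ge0 s : 0 <= vt s.
Proof. by rewrite /vt; case: ifP => // h; exact: radial_weight_ge0. Qed.

Let mvD : measurable_fun D (fun p => v (p.1 +i* p.2)).
Proof. by apply/measurable_EFinP; exact: measurable_int hv.1.2. Qed.

(** Measurability of the radial profile is inherited from the plane through the measurable embedding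
    [s |-> (s, 0)]. *)
Let mvt : measurable_fun setT vt.
Proof.
have m01 : measurable (`]0, 1[%classic : set R) by exact: measurable_itv.
rewrite (_ : vt = (fun s => v s%:C) \_ (`]0, 1[%classic)); last first.
  apply/funext => s; rewrite patchE /vt; congr (if _ then _ else _).
  by rewrite mem_setE in_itv.
apply: (measurable_restrictT (fun s : R => v s%:C) m01).1.
have sub : [set (s, 0 : R) | s in (`]0, 1[%classic : set R)] `<=` D.
  move=> _ [s /= + <-]; rewrite in_itv /= => /andP[s0 s1].
  by change (cmod (s%:C : R[i]) < 1); rewrite cmod_real gtr0_norm.
have mp : measurable_fun (`]0, 1[%classic : set R) (fun s : R => (s, 0 : R)).
  by apply: measurable_funTS; exact: measurable_fun_pair.
exact: (measurable_comp mD sub mvD mp).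
Qed.

Lemma wdensE : wdens v = fun s => s * vt s.
Proof.
apply/funext => s; rewrite /wdens /vt; case: ifP => _; last by rewrite mulr0.
by rewrite mulrC.
Qed.

Lemma measurable_wdens : measurable_fun setT (wdens v).
Proof. by rewrite wdensE; exact: measurable_funM. Qed.

(* Area integral in the coordinates (x, k) = (x, y / x): only linear
   substitutions are needed, and the integral factorizes as in polar
   coordinates. *)
Lemma wdens_lty : (\int[mu]_s (wdens v s)%:E < +oo)%E.
Proof.
(* Half of the disc is enough to bound [V], and [x > 0] makes the substitution [y = x k]
   legitimate. *)
pose D' := D `&` [set p : R * R | 0 < p.1].
have mD' : measurable D'.
  apply: measurableI => //; rewrite -[X in measurable X]setTI.
  have : measurable_fun setT (fun p : R * R => 0 < p.1).
    by apply: measurable_fun_ltr => //; exact: measurable_cst.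
  by move=> /(_ measurableT [set true]); apply.
pose F := (fun p => (v (p.1 +i* p.2))%:E) \_ D'.
have F0 p : (0 <= F p)%E.
  rewrite /F patchE; case: ifPn => // /set_mem[h _].
  by rewrite lee_fin; exact: hv.1.1.
have mF : measurable_fun setT F.
  apply: (measurable_restrictT (fun p : R * R => (v (p.1 +i* p.2))%:E) mD').1; apply/measurable_EFinP.
  by apply: measurable_funS mvD => // p [].
have Foo : (\int[mu \x mu]_p F p < +oo)%E.
  rewrite /F -integral_mkcond.
  have /integrableP[_] := hv.1.2; apply: le_lt_trans.
  have m2 : measurable_fun D (fun p : R * R => (v (p.1 +i* p.2))%:E).
    exact/measurable_EFinP.
  apply: (@le_trans _ _ (\int[mu \x mu]_(p in D) (v (p.1 +i* p.2))%:E)%E).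
    apply: ge0_subset_integral => //; last by move=> p [].
    by move=> p h; rewrite lee_fin; exact: hv.1.1.
  apply: ge0_le_integral => //.
  - by move=> p h; rewrite lee_fin; exact: hv.1.1.
  - exact: measurableT_comp.
  - by move=> p _; exact: lee_abs.
(* The modulus of [x + i x k] is [c k * x] for [x > 0], so along each ray the weight is a dilated
   radial profile. *)
pose c k := Num.sqrt (1 + k ^+ 2).
have c1 k : 0 < 1 + k ^+ 2 by rewrite ltr_pwDl// sqr_ge0.
have c0 k : 0 < c k by rewrite sqrtr_gt0.
have mc : measurable_fun setT c.
  apply: measurableT_comp.
    by apply: continuous_measurable_fun; exact: sqrt_continuous.
  by apply: measurable_funD => //; exact: measurable_funX.
have FE x k : F (x, x * k) = (vt (c k * x))%:E.
  have cE : 0 < x -> cmod (x +i* (x * k)) = c k * x.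
    move=> x0; rewrite cmodE exprMn -[X in X + _]mulr1 -mulrDr mulrC sqrtrM ?ltW//.
    by rewrite sqrtr_sqr gtr0_norm.
  rewrite /F patchE /vt; have [x0|x0] := ltP 0 x; last first.
    rewrite ifN; last by apply/negP => /set_mem[_ /=]; lra.
    by rewrite ifN// negb_and -leNgt pmulr_rle0// x0.
  rewrite pmulr_rgt0// x0 /=; case: ifPn => [/set_mem[/= h _]|h].
    have cx : cmod (x +i* (x * k)) < 1 by exact: h.
    rewrite cE// in cx; rewrite cx.
    congr EFin; apply: hv.2 => //.
      by change (cmod ((c k * x)%:C : R[i]) < 1); rewrite cmod_real gtr0_norm ?mulr_gt0.
    by rewrite cE// cmod_real gtr0_norm ?mulr_gt0.
  rewrite ifN//; apply: contra h => h; apply: mem_set; split => //=.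
  by change (cmod (x +i* (x * k)) < 1); rewrite cE.
have slope x : (\int[mu]_y F (x, y) = \int[mu]_k (x * vt (c k * x))%:E)%E.
  have [x0|x0] := ltP 0 x; last first.
    rewrite integral0_eq; last first.
      move=> y _; rewrite /F patchE ifN//; apply/negP => /set_mem[_ /=]; lra.
    rewrite integral0_eq// => k _; rewrite /vt ifN ?mulr0//.
    by rewrite negb_and -leNgt pmulr_rle0// x0.
  rewrite (ge0_integral_scale x0)//; last first.
    exact: (measurableT_comp mF (measurable_pair1 x)).
  under eq_integral do rewrite FE; rewrite -ge0_integralZl_EFin ?ltW//.
    by move=> k _; rewrite lee_fin.
  apply/measurable_EFinP; apply: measurableT_comp => //.
  by apply: measurable_funM => //; exact: mc.
have mcx : measurable_fun setT (fun p : R * R => c p.2 * p.1).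
  by apply: measurable_funM => //; exact: measurableT_comp.
pose H x k := (x * vt (c k * x))%:E.
have H0 x k : (0 <= H x k)%E.
  rewrite lee_fin; have [x0|x0] := leP 0 x; first by rewrite mulr_ge0.
  rewrite /vt ifN ?mulr0//.
  by rewrite negb_and -leNgt pmulr_rle0// ltW.
have mH : measurable_fun setT (fun p : R * R => H p.1 p.2).
  apply/measurable_EFinP; apply: measurable_funM => //.
  exact: measurableT_comp.
have main : (\int[mu]_x \int[mu]_k H x k < +oo)%E.
  apply: le_lt_trans Foo; rewrite fubini_tonelli1//.
  by under [leRHS]eq_integral do rewrite /fubini_F slope.
have swap : (\int[mu]_x \int[mu]_k H x k = \int[mu]_k \int[mu]_x H x k)%E.
  exact: (@fubini_tonelli _ _ _ _ R mu mu _ mH (fun p => H0 p.1 p.2)).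
set V := (\int[mu]_s _)%E.
have V0 : (0 <= V)%E by apply: integral_ge0 => s _; rewrite lee_fin wdens_ge0.
(* The substitution [s = c k * x] in the integral of [x vt (c k * x)] produces the factor
   [1 / (c k)^2]. *)
have inner k : (\int[mu]_x H x k = ((1 + k ^+ 2)^-1)%:E * V)%E.
  have mW : measurable_fun setT (fun s => (wdens v s)%:E).
    by apply/measurable_EFinP; exact: measurable_wdens.
  have W0 s : (0 <= (wdens v s)%:E)%E by rewrite lee_fin wdens_ge0.
  rewrite /V (ge0_integral_scale (c0 k) mW W0).
  have W1 x : setT x -> (0 <= (wdens v (c k * x))%:E)%E by [].
  have mW1 : measurable_fun setT (fun x => (wdens v (c k * x))%:E).
    apply/measurable_EFinP.
    exact: (measurableT_comp measurable_wdens (measurable_mulrl (c k))).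
  have k0 : 0 <= (1 + k ^+ 2)^-1 * c k by rewrite mulr_ge0 ?invr_ge0 ?ltW.
  rewrite muleA -EFinM -(ge0_integralZl_EFin mu measurableT W1 mW1 k0).
  apply: eq_integral => x _; rewrite -EFinM wdensE /H; congr EFin.
  have ck : c k ^+ 2 = 1 + k ^+ 2 by apply: sqr_sqrtr; exact: ltW.
  by rewrite -ck; field; exact: lt0r_neq0.
(* For [0 <= k <= 1] the factor [1 / (1 + k^2)] is at least [1 / 2], and this interval has length
   1. *)
have : ((2^-1)%:E * V < +oo)%E.
  apply: le_lt_trans main; rewrite swap.
  have mi : measurable_fun setT (fun k => \int[mu]_x H x k)%E.
    exact: (@measurable_fun_fubini_tonelli_G _ _ _ _ R mu _ mH
      (fun p => H0 p.1 p.2)).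
  have m01 : measurable (`[0, 1]%classic : set R) by exact: measurable_itv.
  apply: (@le_trans _ _ (\int[mu]_(k in `[0%R, 1%R]) \int[mu]_x H x k)%E); last first.
    apply: ge0_subset_integral; [exact: m01|exact: measurableT|exact: mi| |by []].
    by move=> k _; apply: integral_ge0 => x _; exact: H0.
  apply: (@le_trans _ _ (\int[mu]_(k in `[0%R, 1%R]) cst ((2^-1)%:E * V) k)%E).
    have m1 : (mu `[0%R, 1%R]%classic = 1)%E.
      by rewrite lebesgue_measure_itv /= lte_fin ltr01 sube0.
    rewrite le_eqVlt; apply/orP; left; apply/eqP; rewrite -[LHS]mule1; apply: esym.
    apply: (etrans (integral_cst mu m01 _)); congr (_ * _)%E; exact: m1.
  apply: ge0_le_integral => //.
  - by move=> k _; apply: mule_ge0 => //; rewrite lee_fin invr_ge0.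
  - exact: measurable_funTS.
  - move=> k /=; rewrite in_itv /= inner => /andP[k0 k1]; apply: lee_wpmul2r => //.
    rewrite lee_fin lef_pV2 ?posrE//.
    suff : k ^+ 2 <= 1 by lra.
    by rewrite expr_le1.
clear inner; clearbody V; move: V0; case: V => [r _ _|_|//]; first exact: ltry.
by rewrite gt0_muley// lte_fin invr_gt0.
Qed.

End PolarFiniteness.

(** * Counting functions *)

Section CountableSums.
Variables (R : realType) (T : choiceType) (P : set T).
Hypothesis cP : countable P.
Local Open Scope ereal_scope.

(** One enumeration serves every nonnegative family at once, so that sums depending on a parameter
    turn into series with common indices. [Q] marks the indices in use; [x0] fills the others. *)
Lemma countable_esum (x0 : T) : exists (Q : pred nat) (e : nat -> T),
  (forall n, Q n -> P (e n)) /\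
  forall a : T -> \bar R, (forall i, P i -> 0 <= a i) ->
    \esum_(i in P) a i = \sum_(0 <= n <oo) (if Q n then a (e n) else 0).
Proof.
have /countable_injP[f finj] := cP.
pose Q n := `[< exists2 i, P i & f i = n >].
pose e n := xget x0 [set i | P i /\ f i = n].
have eP n : Q n -> P (e n) /\ f (e n) = n.
  by move=> /asboolP[i Pi fi]; rewrite /e; case: xgetP => [y _ //|/(_ i)]; case.
have eK i : P i -> Q (f i) /\ e (f i) = i.
  move=> Pi; have Qi : Q (f i) by apply/asboolP; exists i.
  by split=> //; have [Pe fe] := eP _ Qi; apply: finj => //; exact: mem_set.
exists Q, e; split => [n /eP[]//|a a0].
rewrite -eseries_mkcond -esum_pred_image; last 2 first.
- by move=> n /eP[Pe _]; exact: a0.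
- move=> n m /set_mem/eP[_ fn] /set_mem/eP[_ fm] nm.
  by rewrite -fn -fm nm.
congr esum; apply/seteqP; split => [i Pi|_ [n /eP[Pe _] <-]//].
by have [Qi ei] := eK i Pi; exists (f i).
Qed.

Lemma esumZr (a : T -> \bar R) (k : R) : (0 <= k)%R -> (forall i, P i -> 0 <= a i) ->
  \esum_(i in P) (a i * k%:E) = (\esum_(i in P) a i) * k%:E.
Proof.
move=> k0 a0; have [->|/set0P[x0 _]] := eqVneq P set0; first by rewrite !esum_set0 mul0e.
have [Q [e [eP esE]]] := countable_esum x0.
rewrite !esE//; last by move=> i Pi; rewrite mule_ge0 ?a0.
rewrite muleC -nneseriesZl; last by move=> n _; case: ifP => // /eP/a0.
by apply: eq_eseriesr => n _; case: ifP => _; rewrite ?mule0 1?muleC.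
Qed.

Variables (d : measure_display) (U : measurableType d) (D : set U).
Variable f : T -> U -> \bar R.
Hypothesis mD : measurable D.
Hypothesis mf : forall i, P i -> measurable_fun D (f i).
Hypothesis f0 : forall i x, P i -> D x -> 0 <= f i x.

Lemma integral_esum (m : {measure set U -> \bar R}) :
  \int[m]_(x in D) (\esum_(i in P) f i x) = \esum_(i in P) \int[m]_(x in D) f i x.
Proof.
have [->|/set0P[x0 _]] := eqVneq P set0.
  by under eq_integral do rewrite esum_set0; rewrite integral0 esum_set0.
have [Q [e [eP esE]]] := countable_esum x0.
rewrite esE; last by move=> i Pi; apply: integral_ge0 => x Dx; exact: f0.
transitivity (\int[m]_(x in D) \sum_(0 <= n <oo) (if Q n then f (e n) x else 0)).
  by apply: eq_integral => x /set_mem Dx; rewrite esE// => i Pi; exact: f0.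
rewrite integral_nneseries//.
- apply: eq_eseriesr => n _; case: ifP => // _; exact: integral0.
- move=> n; case Qn : (Q n); last exact: measurable_cst.
  by apply: mf; apply: eP.
- by move=> n x Dx; case: ifP => // /eP h; exact: f0.
Qed.

Lemma measurable_esum : measurable_fun D (fun x => \esum_(i in P) f i x).
Proof.
have [->|/set0P[x0 _]] := eqVneq P set0.
  by under eq_fun do rewrite esum_set0; exact: measurable_cst.
have [Q [e [eP esE]]] := countable_esum x0.
apply: (@eq_measurable_fun _ _ _ _ D
    (fun x => \sum_(0 <= n <oo | n \in xpredT) (if Q n then f (e n) x else 0))).
  by move=> x /set_mem Dx; rewrite esE// => i Pi; exact: f0.
apply: ge0_emeasurable_sum => [n x Dx _|n _].
  by case: ifP => // /eP h; exact: f0.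
case Qn : (Q n); last exact: measurable_cst.
by apply: mf; apply: eP.
Qed.

End CountableSums.

(** * The two integral formulas *)

Section CountingIdentities.
Variables (R : realType) (v : R[i] -> R).
Hypothesis hv : radial_weight v.
Implicit Types (r s t x c : R) (z zeta : R[i]).
Local Notation mu := (@lebesgue_measure R).

Let ooP (a b s : R) : s \in (`]a, b[%classic : set R) -> a < s /\ s < b.
Proof. by move=> /set_mem; rewrite /= in_itv /= => /andP[]. Qed.

Let itv_gt (b c r : R) : c <= r -> `]r, b[%classic = `]c, b[ `&` [set s | r < s].
Proof.
move=> cr; apply/seteqP; split => s /=; rewrite !in_itv /=; last by case=> /andP[_ ->] ->.
by move=> /andP[rs ->]; rewrite rs (le_lt_trans cr rs).
Qed.

Let itv_lt (b c s : R) : s <= b -> `]c, s[%classic = `]c, b[ `&` [set r | r < s].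
Proof.
move=> sb; apply/seteqP; split => r /=; rewrite !in_itv /=; last by case=> /andP[-> _] ->.
by move=> /andP[-> rs]; rewrite rs (lt_le_trans rs sb).
Qed.

Let patch_gt (F : R -> \bar R) c s :
  (F \_ [set x | c < x]) s = if c < s then F s else 0%E.
Proof. by rewrite patchE; congr (if _ then _ else _); apply/idP/idP => [/set_mem|h] //; exact: mem_set. Qed.

Let patch_lt (F : R -> \bar R) c s :
  (F \_ [set x | x < c]) s = if s < c then F s else 0%E.
Proof. by rewrite patchE; congr (if _ then _ else _); apply/idP/idP => [/set_mem|h] //; exact: mem_set. Qed.

Let mW (D : set R) : measurable_fun D (wdens v).
Proof. by apply: measurable_funTS; exact: measurable_wdens. Qed.

Let mlnd (D : set R) c : measurable_fun D (fun s => ln (s / c)).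
Proof.
apply: measurable_funTS; apply: measurableT_comp; first exact: measurable_ln.
by apply: measurable_funM.
Qed.

Let minv c s : 0 <= c -> measurable_fun `]c, s[ (fun r : R => r^-1).
Proof.
move=> c0; apply: (@eq_measurable_fun _ _ _ _ _ (fun r : R => r `^ (-1))).
  by move=> r /ooP[cr _]; rewrite powR_inv1// (le_trans c0) ?ltW.
exact: measurable_funTS.
Qed.

Let wE s : 0 < s -> s < 1 -> v s%:C * s = wdens v s.
Proof. by move=> s0 s1; rewrite /wdens s0 s1. Qed.

Lemma vstarE zeta :
  (vstar v zeta =
    \int[mu]_(s in `]cmod zeta, 1%R[) (wdens v s * ln (s / cmod zeta))%:E)%E.
Proof.
apply: eq_integral => s /ooP[cs s1].
rewrite -wE//; last by apply: le_lt_trans cs; exact: cmod_ge0.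
by congr EFin; rewrite mulrAC.
Qed.

Lemma hatE r : 0 <= r ->
  (hat (fun w => (v w * cmod w)%R) r = \int[mu]_(s in `]r, 1%R[) (wdens v s)%:E)%E.
Proof.
move=> r0; apply: eq_integral => s /ooP[rs s1].
have s0 := le_lt_trans r0 rs.
by rewrite cmod_real gtr0_norm// wE.
Qed.

Lemma hat_fin r : 0 <= r -> hat (fun w => (v w * cmod w)%R) r \is a fin_num.
Proof.
move=> r0; rewrite hatE// ge0_fin_numE; last first.
  by apply: integral_ge0 => s _; rewrite lee_fin wdens_ge0.
apply: le_lt_trans (wdens_lty hv); apply: ge0_subset_integral => //.
- by apply/measurable_EFinP; exact: mW.
- by move=> s _; rewrite lee_fin wdens_ge0.
Qed.

Lemma integral_inv c s : 0 < c -> c < s ->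
  (\int[mu]_(r in `]c, s[) (r^-1)%:E = (ln (s / c))%:E)%E.
Proof.
move=> c0 cs; have s0 := lt_trans c0 cs.
rewrite -(@integral_itv_bndoo R c s (fun r => (r^-1)%:E) true false); last first.
  by apply/measurable_EFinP; apply: minv; exact: ltW.
have dln x : c <= x <= s -> is_derive x 1 (@ln R) x^-1.
  by move=> /andP[cx _]; apply: is_derive1_ln; exact: lt_le_trans cx.
have cinv x : c <= x <= s -> {for x, continuous (fun r : R => r^-1)}.
  move=> /andP[cx _]; apply: inv_continuous; apply: lt0r_neq0.
  exact: lt_le_trans cx.
by rewrite ln_div ?posrE//; exact: (FTC2_derive cs dln cinv).
Qed.

(** The density of [dr / r] times [s v(s) ds] on the triangle [r < s]: integration over [s] gives
    the tail [hat], integration over [r] the logarithm of [vstar]. *)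
Let f r s : \bar R := if r < s then (r^-1 * wdens v s)%:E else 0%E.

Let mf c : 0 <= c -> measurable_fun (`]c, 1[ `*` `]c, 1[ : set (R * R)) (fun p => f p.1 p.2).
Proof.
move=> c0; apply: (@eq_measurable_fun _ _ _ _ _
    (fun p : R * R => if p.1 < p.2 then (p.1 `^ (-1) * wdens v p.2)%:E else 0%E)).
  move=> p /set_mem[/=]; rewrite in_itv /= => /andP[cp _] _.
  by rewrite /f powR_inv1// (le_trans c0) ?ltW.
apply: measurable_funTS; apply: measurable_fun_ifT.
- by apply: measurable_fun_ltr.
- apply/measurable_EFinP; apply: measurable_funM.
    exact: (measurableT_comp (measurable_powR (-1))).
  exact: (measurableT_comp (measurable_wdens hv)).
- exact: measurable_cst.
Qed.

Let f0 c r s : 0 <= c -> `]c, 1[%classic r -> `]c, 1[%classic s -> (0 <= f r s)%E.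
Proof.
move=> c0; rewrite /= !in_itv /= => /andP[cr _] _; rewrite /f; case: ifP => // _.
rewrite lee_fin mulr_ge0 ?wdens_ge0// invr_ge0 ltW//; exact: le_lt_trans cr.
Qed.

Let m1 c : measurable (`]c, 1[%classic : set R).
Proof. exact: measurable_itv. Qed.

Let innerE c r : 0 <= c -> c < r ->
  ((r^-1)%:E * hat (fun w => (v w * cmod w)%R) r =
    \int[mu]_(s in `]c, 1%R[) f r s)%E.
Proof.
move=> c0 cr; have r0 := le_lt_trans c0 cr; rewrite hatE ?(ltW r0)//.
rewrite -ge0_integralZl_EFin//; last 3 first.
- by move=> s _; rewrite lee_fin wdens_ge0.
- by apply/measurable_EFinP; exact: mW.
- by rewrite invr_ge0 ltW.
rewrite (itv_gt 1 (ltW cr)) integral_mkcondr; apply: eq_integral => s _.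
by rewrite ?patch_gt ?patch_lt /f EFinM.
Qed.

Lemma measurable_hat c : 0 <= c -> measurable_fun `]c, 1[
  (fun r => (r^-1)%:E * hat (fun w => (v w * cmod w)%R) r)%E.
Proof.
move=> c0; apply: (@eq_measurable_fun _ _ _ _ _ (fun r => \int[mu]_(s in `]c, 1%R[) f r s)%E).
  by move=> r /ooP[cr _]; rewrite -innerE.
exact: (@measurable_tonelli_rect1 _ _ _ _ R mu _ _ f (m1 c) (m1 c) (mf c0)
  (fun r s => f0 c0)).
Qed.

Lemma vstar_hat zeta : 0 < cmod zeta ->
  (\int[mu]_(r in `]cmod zeta, 1%R[)
     ((r^-1)%:E * hat (fun w => (v w * cmod w)%R) r) = vstar v zeta)%E.
Proof.
move=> c0; rewrite vstarE; move: (cmod zeta) c0 => c c0.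
transitivity (\int[mu]_(r in `]c, 1%R[) \int[mu]_(s in `]c, 1%R[) f r s)%E.
  apply: eq_integral => r /ooP[cr _].
  by rewrite -innerE// ltW.
rewrite (@tonelli_rect _ _ _ _ R mu mu _ _ f (m1 c) (m1 c) (mf (ltW c0))
  (fun r s => f0 (ltW c0))).
apply: eq_integral => s /ooP[cs s1].
rewrite mulrC EFinM -integral_inv// -ge0_integralZr//; last 3 first.
- by apply/measurable_EFinP; apply: minv; exact: ltW.
- move=> r /=; rewrite in_itv /= => /andP[cr _]; rewrite lee_fin invr_ge0 ltW//.
  exact: lt_trans cr.
- by rewrite lee_fin wdens_ge0.
rewrite (itv_lt c (ltW s1)) integral_mkcondr; apply: eq_integral => r _.
by rewrite ?patch_gt ?patch_lt /f EFinM.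
Qed.

Variables (phi : R[i] -> R[i]) (z : R[i]).
Hypotheses (hphi : analytic_self_map phi) (phi0 : phi 0 <> z).
Let P := preimages phi z.
Let m zeta : R := (multiplicity phi zeta)%:R.

Let m0 zeta : 0 <= m zeta. Proof. exact: ler0n. Qed.

Let cP : countable P. Proof. exact: countable_preimages. Qed.

Lemma preimage_gt0 zeta : P zeta -> 0 < cmod zeta.
Proof.
by move=> [_ h]; rewrite cmod_gt0; apply/eqP => e; apply: phi0; rewrite -h e.
Qed.

(** The condition [|zeta| <= s] moves from the index set into the summand, so that one index set
    serves all [s]; [np_term] does the same for [num_preimages]. *)
Let pc_term zeta s : \bar R :=
  if cmod zeta <= s then (m zeta * ln (s / cmod zeta))%:E else 0%E.

Let pc_term_ge0 zeta s : P zeta -> (0 <= pc_term zeta s)%E.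
Proof.
move=> /preimage_gt0 c0; rewrite /pc_term; case: ifP => // cs.
by rewrite lee_fin mulr_ge0// ln_ge0// ler_pdivlMr// mul1r.
Qed.

Let mpc_term zeta (D : set R) : measurable_fun D (pc_term zeta).
Proof.
apply: measurable_funTS; apply: measurable_fun_ifT.
- by apply: measurable_fun_ler => //; exact: measurable_cst.
- by apply/measurable_EFinP; apply: measurable_funM => //; exact: mlnd.
- exact: measurable_cst.
Qed.

Lemma partial_countingE s :
  (partial_counting phi s z = \esum_(zeta in P) pc_term zeta s)%E.
Proof.
rewrite /partial_counting esum_mkcondr; apply: eq_esum => zeta _.
by rewrite mem_setE.
Qed.

Lemma partial_counting_ge0 s : (0 <= partial_counting phi s z)%E.
Proof. by rewrite partial_countingE; apply: esum_ge0 => zeta; exact: pc_term_ge0. Qed.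

Lemma measurable_partial_counting (D : set R) :
  measurable D -> measurable_fun D (fun s => partial_counting phi s z).
Proof.
move=> mD; under eq_fun do rewrite partial_countingE.
apply: measurable_esum => //.
by move=> zeta s Pz _; exact: pc_term_ge0.
Qed.

Lemma gen_counting_partial :
  (gen_counting phi (vstar v) z =
    \int[mu]_(s in `]0%R, 1%R[) (partial_counting phi s z * (wdens v s)%:E))%E.
Proof.
transitivity (\int[mu]_(s in `]0%R, 1%R[)
    \esum_(zeta in P) (pc_term zeta s * (wdens v s)%:E))%E; last first.
  apply: eq_integral => s _; rewrite partial_countingE.
  by apply: (esumZr cP (wdens_ge0 hv s)) => zeta Pz; exact: pc_term_ge0.
rewrite integral_esum; last 4 first.
- exact: cP.
- exact: measurable_itv.
- move=> zeta _; apply: emeasurable_funM; first exact: mpc_term.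
  by apply/measurable_EFinP; exact: mW.
- move=> zeta s Pz _; apply: mule_ge0; first exact: pc_term_ge0.
  by rewrite lee_fin wdens_ge0.
apply: eq_esum => zeta Pz; have c0 := preimage_gt0 Pz.
rewrite vstarE -ge0_integralZl_EFin//; last 2 first.
- move=> s /=; rewrite in_itv /= => /andP[cs _].
  by rewrite lee_fin mulr_ge0 ?wdens_ge0// ln_ge0// ler_pdivlMr// mul1r ltW.
- by apply/measurable_EFinP; apply: measurable_funM; [exact: mW|exact: mlnd].
rewrite (itv_gt 1 (ltW c0)) integral_mkcondr; apply: eq_integral => s _.
(* [partial_counting] admits [|zeta| = s] and [vstar] does not; the term in question is
   [ln 1 = 0]. *)
rewrite patch_gt /pc_term; case: ltgtP => [cs|cs|sE].
- by rewrite -!EFinM; congr EFin; rewrite mulrA mulrAC.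
- by rewrite mul0e.
- by rewrite -sE divff ?gt_eqF// ln1 mulr0 mul0e.
Qed.

(** Given one preimage [w], only finitely many are no farther out, and the minimum among these is
    global. *)
Lemma min_preimageP : P !=set0 -> is_min_preimage phi z (min_preimage phi z).
Proof.
move=> [w Pw]; apply: (@xgetPex _ 0 [set zeta | is_min_preimage phi z zeta]).
have w1 : cmod w < 1 by exact: Pw.1.
have [|x [Px xw] xmin] := @finite_argmin R _ (fun w => cmod w) _ (finite_preimages hphi phi0 w1).
  by exists w; split => /=.
exists x; split => // y Py; have [yw|/ltW wy] := leP (cmod y) (cmod w).
  by apply: xmin; split.
exact: le_trans wy.
Qed.

Let np_term zeta r : \bar R := if cmod zeta < r then (m zeta)%:E else 0%E.

Lemma num_preimagesE r :
  (num_preimages phi r z = \esum_(zeta in P) np_term zeta r)%E.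
Proof.
rewrite /num_preimages esum_mkcondr; apply: eq_esum => zeta _.
by rewrite mem_setE.
Qed.

Lemma gen_counting_num :
  (gen_counting phi (vstar v) z =
     \int[mu]_(r in `]cmod (min_preimage phi z), 1%R[)
       (num_preimages phi r z * (r^-1)%:E * hat (fun w => (v w * cmod w)%R) r))%E.
Proof.
set c := cmod _; have c0 : 0 <= c by exact: cmod_ge0.
pose H r := ((r^-1)%:E * hat (fun w => (v w * cmod w)%R) r)%E.
have H0 r : 0 < r -> (0 <= H r)%E.
  move=> r0; apply: mule_ge0; first by rewrite lee_fin invr_ge0 ltW.
  by rewrite (hatE (ltW r0)); apply: integral_ge0 => s _; rewrite lee_fin wdens_ge0.
(* [esumZr] takes a real factor; [H r] is finite because the density [s v(s)] has finite
   integral. *)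
have HE r : 0 < r -> H r = (fine (H r))%:E.
  by move=> r0; rewrite fineK// fin_numM// hat_fin// ltW.
have np0 zeta r : (0 <= np_term zeta r)%E.
  by rewrite /np_term; case: ifP => // _; rewrite lee_fin.
transitivity (\int[mu]_(r in `]c, 1%R[) \esum_(zeta in P) (np_term zeta r * H r))%E; last first.
  apply: eq_integral => r /ooP[cr _].
  have r0 := le_lt_trans c0 cr; rewrite -muleA -/(H r) HE// esumZr//.
    by rewrite num_preimagesE.
  by rewrite -lee_fin -HE// H0.
have mH : measurable_fun `]c, 1[ H by exact: measurable_hat.
rewrite integral_esum; last 4 first.
- exact: cP.
- exact: measurable_itv.
- move=> zeta _; apply: emeasurable_funM; last exact: mH.
  apply: measurable_funTS; apply: measurable_fun_ifT; [|exact: measurable_cst..].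
  by apply: measurable_fun_ltr => //; exact: measurable_cst.
- move=> zeta r _ /=; rewrite in_itv /= => /andP[cr _].
  by apply: mule_ge0 => //; apply: H0; exact: le_lt_trans cr.
apply: eq_esum => zeta Pz; have z0 := preimage_gt0 Pz.
(* The term of [zeta] lives on [r > |zeta| >= c], so all integrals may start at [c]. Without
   preimages the sum is empty, whatever the default behind [c]. *)
have cz : c <= cmod zeta.
  by have [|_ h] := min_preimageP; [exists zeta|exact: h].
have sub : `]cmod zeta, 1[%classic `<=` `]c, 1[%classic.
  by move=> r /=; rewrite !in_itv /= => /andP[h ->]; rewrite (le_lt_trans cz h).
rewrite -vstar_hat// -ge0_integralZl_EFin//; last 2 first.
- move=> r /=; rewrite in_itv /= => /andP[h _]; apply: H0; exact: lt_trans h.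
- exact: measurable_funS mH.
rewrite (itv_gt 1 cz) integral_mkcondr; apply: eq_integral => r _.
by rewrite patch_gt /np_term; case: ifP => // _; rewrite mul0e.
Qed.

End CountingIdentities.

(** * Subharmonicity *)

(* The canonical sigma-finite structure on product measures is only found for
   products of subprobabilities, hence the explicit packing. *)
Definition area (R : realType) : SigmaFiniteMeasure.type _ R :=
  let mu := @lebesgue_measure R in
  HB.pack_for (SigmaFiniteMeasure.type _ R) (mu \x mu)%E
    (@Measure_isSigmaFinite.Build _ _ _ (mu \x mu)%E
      (lebesgue_integral_fubini.product_measure_sigma_finite_subproof mu mu)).

Section LogMass.
Variables (R : realType) (phi : R[i] -> R[i]) (v : R[i] -> R).
Hypotheses (hphi : analytic_self_map phi) (hv : radial_weight v).
Implicit Types (r s t x c : R) (z w : R[i]) (p : R * R).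
Local Notation mu := (@lebesgue_measure R).
Local Notation nu := (mu \x mu)%E.
Local Notation angles := (`[0, 2 * pi]%classic : set R).
Local Notation polar := ((`]0, 1[%classic : set R) `*` angles).
Local Notation u := (gen_counting phi (vstar v)).
Local Notation V := (\int[mu]_s (wdens v s)%:E)%E.

Lemma limn_einf_le (f g : nat -> \bar R) l : (forall n, (f n <= g n)%E) ->
  g @ \oo --> l -> (limn_einf f <= l)%E.
Proof.
move=> fg gl; rewrite limn_einf_lim -(cvg_lim _ gl)//; apply: lee_lim.
- exact: is_cvg_einfs.
- by apply/cvg_ex; exists l.
- near=> n; apply: le_trans (fg n); apply: ereal_inf_lbound.
  by exists n => //=.
Unshelve. all: by end_near. Qed.

Lemma measurable_kap_cmod d (T : measurableType d) (D : set T) (X Y : T -> R) :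
  measurable_fun D X -> measurable_fun D Y ->
  measurable_fun D (fun q => kap (cmod (X q +i* Y q))).
Proof.
move=> mX mY.
have mc : measurable_fun D (fun q => cmod (X q +i* Y q)).
  under eq_fun do rewrite cmodE.
  apply: measurableT_comp.
    by apply: continuous_measurable_fun; exact: sqrt_continuous.
  by apply: measurable_funD; exact: measurable_funX.
exact: (measurableT_comp (@measurable_kap R) mc).
Qed.

Let pdens p : R := (2 * pi)^-1 * wdens v p.1.

Let pdens_ge0 p : 0 <= pdens p.
Proof. by rewrite mulr_ge0 ?wdens_ge0// invr_ge0 ltW// angles_gt0. Qed.

(** Its integral [I z] below is the potential, for the kernel [kap], of the image under [phi] of the
    measure with density [pdens] on the polar rectangle. *)
Let mass z p : \bar R := ((pdens p)%:E * kap (cmod (phi (circ p.1 p.2) - z)%R))%E.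

Let mass_ge0 z p : (0 <= mass z p)%E.
Proof. by apply: mule_ge0; [rewrite lee_fin pdens_ge0|exact: kap_ge0]. Qed.

Lemma polar_disc p : polar p -> unit_disc (circ p.1 p.2).
Proof.
move=> [/=]; rewrite in_itv /= => /andP[s0 s1] _.
by change (cmod (circ p.1 p.2) < 1); rewrite cmod_circ// ltW.
Qed.

Let cont_phi p : polar p -> ccont phi (circ p.1 p.2).
Proof.
by move=> /polar_disc h; apply: (@cdiff_cont _ 0); apply: analytic_cdiff; exact: hphi.1.
Qed.

Let mphiRe : measurable_fun polar (fun p => Re (phi (circ p.1 p.2))).
Proof.
apply: (@measurable_circ R _ _ polar fst snd (fun w => Re (phi w))) => // p Ap.
by apply: rcont_Re; exact: cont_phi.
Qed.

Let mphiIm : measurable_fun polar (fun p => Im (phi (circ p.1 p.2))).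
Proof.
apply: (@measurable_circ R _ _ polar fst snd (fun w => Im (phi w))) => // p Ap.
by apply: rcont_Im; exact: cont_phi.
Qed.

Let mpolar : measurable polar.
Proof. by apply: measurableX; exact: measurable_itv. Qed.

(** The general maps [P], [X], [Y] cover a fixed [z] as well as a [z] moving on a circle jointly
    with the polar point, which Tonelli's theorem requires. *)
Lemma measurable_mass d (T : measurableType d) (D : set T) (P : T -> R * R)
    (X Y : T -> R) : measurable_fun D P -> P @` D `<=` polar ->
  measurable_fun D X -> measurable_fun D Y ->
  measurable_fun D (fun q => mass (X q +i* Y q) (P q)).
Proof.
move=> mP sub mX mY; apply: emeasurable_funM.
  apply/measurable_EFinP; apply: measurable_funM => //.
  apply: (measurableT_comp (measurable_wdens hv)).
  exact: (measurableT_comp measurable_fst mP).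
have mRe := measurable_comp mpolar sub mphiRe mP.
have mIm := measurable_comp mpolar sub mphiIm mP.
have := measurable_kap_cmod (measurable_funB mRe mX) (measurable_funB mIm mY).
congr measurable_fun; apply/funext => q.
have -> : phi (circ (P q).1 (P q).2) - (X q +i* Y q) =
    (Re (phi (circ (P q).1 (P q).2)) - X q) +i*
    (Im (phi (circ (P q).1 (P q).2)) - Y q).
  by case: (phi _).
by [].
Qed.

Let mmass z : measurable_fun polar (mass z).
Proof.
case: z => x y.
have sub : id @` polar `<=` polar by rewrite image_id.
exact: (@measurable_mass _ _ polar id (fun=> x) (fun=> y) (@measurable_id _ _ _) sub
  (@measurable_cst _ _ _ _ _ x) (@measurable_cst _ _ _ _ _ y)).
Qed.

Let I z : \bar R := (\int[nu]_(p in polar) mass z p)%E.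

Let I_ge0 z : (0 <= I z)%E.
Proof. by apply: integral_ge0 => p _; exact: mass_ge0. Qed.

Lemma jensen_mass z : unit_disc z -> phi 0 <> z ->
  (u z + I z = kap (cmod (phi 0 - z)%R) * V)%E.
Proof.
move=> zd phi0.
have m01 : measurable (`]0, 1[%classic : set R) by exact: measurable_itv.
have mang : measurable angles by exact: measurable_itv.
pose J s : \bar R := (\int[mu]_(t in angles) mass z (s, t))%E.
have mw D : measurable_fun D (fun s => (wdens v s)%:E).
  by apply/measurable_EFinP; apply: measurable_funTS; exact: measurable_wdens.
have w0 s : (0 <= (wdens v s)%:E)%E by rewrite lee_fin wdens_ge0.
have mass0 s t : `]0, 1[%classic s -> angles t -> (0 <= mass z (s, t))%E by [].
have mmass' : measurable_fun polar (fun p => mass z (p.1, p.2)).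
  by have := @mmass z; congr measurable_fun; apply/funext => -[].
have IE : I z = (\int[mu]_(s in `]0%R, 1%R[) J s)%E.
  rewrite /I /J -(@integral_rectE _ _ _ _ R mu mu _ _ (fun s t => mass z (s, t)) m01
    mang mmass' mass0).
  by apply: eq_integral => -[].
have mJ : measurable_fun (`]0, 1[%classic : set R) J.
  exact: (@measurable_tonelli_rect1 _ _ _ _ R mu _ _ (fun s t => mass z (s, t)) m01
    mang mmass' mass0).
have J0 s : (0 <= J s)%E by apply: integral_ge0.
have kap0 : (0 <= kap (cmod (phi 0 - z)%R))%E by exact: kap_ge0.
(* The exceptional radii of [jensen]; there are countably many because [z] has countably many
   preimages. *)
pose N : set R := [set cmod b | b in preimages phi z].
have cN : countable N.
  by apply: card_le_trans (countable_preimages hphi phi0); exact: card_image_le.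
have jensenE s : 0 < s < 1 -> ~ N s ->
    (partial_counting phi s z * (wdens v s)%:E + J s =
     kap (cmod (phi 0 - z)%R) * (wdens v s)%:E)%E.
  move=> s01 nos.
  have nz b : preimages phi z b -> cmod b <> s by move=> Pb bs; apply: nos; exists b.
  rewrite -(jensen hphi phi0 zd s01 nz) ge0_muleDl; last 2 first.
  - exact: (partial_counting_ge0 phi0).
  - apply: mule_ge0; first by rewrite lee_fin invr_ge0 ltW// angles_gt0.
    by apply: integral_ge0 => t _; exact: kap_ge0.
  congr (_ + _)%E; rewrite muleAC -EFinM.
  apply: (ge0_integralZl_EFin mu mang (f1 := fun t => kap (cmod (phi (circ s t) - z)%R))
    (fun t _ => kap_ge0 _) _ (pdens_ge0 (s, 0))).
  apply: (measurableT_comp (@measurable_kap R)).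
  apply: (@measurable_circ R _ _ angles (fun=> s) id (fun w => cmod (phi w - z))) => //.
  move=> t ta; apply: (rcont_cmod (f := fun w => phi w - z)).
  apply: (@cdiff_cont _ 0); apply: analytic_cdiff; apply: analytic_subC.
  by apply: hphi.1; apply: (@polar_disc (s, t)); split=> //=; rewrite in_itv.
have mpc : measurable_fun (`]0, 1[%classic : set R) (fun s => partial_counting phi s z).
  exact: measurable_partial_counting.
have VE : V = (\int[mu]_(s in `]0%R, 1%R[) (wdens v s)%:E)%E.
  rewrite [RHS]integral_mkcond; apply: eq_integral => s _.
  rewrite patchE; case: ifPn => // s01; rewrite /wdens ifN//.
  by apply: contra s01 => s01; apply: mem_set; rewrite /= in_itv.
pose pcw s := (partial_counting phi s z * (wdens v s)%:E)%E.
have pcw0 s : `]0, 1[%classic s -> (0 <= pcw s)%E.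
  by move=> _; apply: mule_ge0; [exact: (partial_counting_ge0 phi0)|exact: w0].
have mpcw : measurable_fun (`]0, 1[%classic : set R) pcw.
  exact: (emeasurable_funM mpc (mw _)).
rewrite (gen_counting_partial hv hphi phi0) IE.
rewrite -(ge0_integralD mu m01 pcw0 mpcw (fun s _ => J0 s) mJ).
rewrite VE -(ge0_integralZl mu m01 (mw _) (fun s _ => w0 s) kap0).
apply: ge0_ae_eq_integral => //.
- exact: emeasurable_funD.
- by apply: emeasurable_funM; [exact: measurable_cst|exact: mw].
- by move=> s s01; apply: adde_ge0; [exact: pcw0|exact: J0].
- by move=> s _; exact: mule_ge0.
- exists N; split.
  + by apply: countable_measurable => // t; exact: measurable_set1.
  + exact: countable_lebesgue_measure0.
  + move=> s /=; apply: contra_notP => nos; rewrite in_itv /= => s01.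
    exact: jensenE.
Qed.

Let V0 : (0 <= V)%E.
Proof. by apply: integral_ge0 => s _; rewrite lee_fin wdens_ge0. Qed.

Let Vfin : V \is a fin_num.
Proof. by rewrite ge0_fin_numE//; exact: wdens_lty. Qed.

Let kV z : \bar R := (kap (cmod (phi 0 - z)%R) * V)%E.

Let kVfin z : phi 0 <> z -> kV z \is a fin_num.
Proof.
move=> phi0; rewrite /kV fin_numM//; apply: kap_fin.
by apply: lt0r_neq0; rewrite cmod_gt0 subr_eq0; exact/eqP.
Qed.

Lemma gen_counting_ge0 z : phi 0 <> z -> (0 <= u z)%E.
Proof.
move=> phi0; rewrite (gen_counting_partial hv hphi phi0); apply: integral_ge0 => s _.
by apply: mule_ge0; [exact: (partial_counting_ge0 phi0)|rewrite lee_fin wdens_ge0].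
Qed.

(** Both terms on the left of [jensen_mass] are nonnegative and the right-hand side is finite: [kap]
    off [phi 0], and [V] by [wdens_lty]. *)
Lemma gen_counting_fin z : unit_disc z -> phi 0 <> z -> u z \is a fin_num.
Proof.
move=> zd phi0; have u0 := gen_counting_ge0 phi0.
rewrite ge0_fin_numE//; have := kVfin phi0; rewrite /kV -(jensen_mass zd phi0).
rewrite ge0_fin_numE; last exact: adde_ge0.
by apply: le_lt_trans; rewrite leeDl.
Qed.

Let Ifin z : unit_disc z -> phi 0 <> z -> I z \is a fin_num.
Proof.
move=> zd phi0; have u0 := gen_counting_ge0 phi0.
rewrite ge0_fin_numE//; have := kVfin phi0; rewrite /kV -(jensen_mass zd phi0).
rewrite ge0_fin_numE; last exact: adde_ge0.
by apply: le_lt_trans; rewrite leeDr.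
Qed.

Let cvg_dist (f : nat -> R[i]) z w : (fun n => cmod (f n - z)) @ \oo --> 0 ->
  (fun n => cmod (w - f n)) @ \oo --> cmod (w - z).
Proof.
move=> fz; apply/cvgrPdist_lt => e e0; have /cvgrPdist_lt/(_ _ e0) := fz.
apply: filterS => n /=; rewrite sub0r normrN ger0_norm ?cmod_ge0//.
apply: le_lt_trans; rewrite ler_norml; apply/andP; split.
  rewrite lerNl opprB; apply: (le_trans (cmod_leB _ _)).
  by rewrite cmod_distC (_ : _ - _ = f n - z)//; ring.
by apply: (le_trans (cmod_leB _ _)); rewrite (_ : _ - _ = f n - z)//; ring.
Qed.

(** Failure would give points [f n] tending to [z] with [u (f n) >= c], that is
    [I (f n) <= kV (f n) - c]; continuity of [kV] and Fatou's lemma carry this over to [z]. *)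
Lemma gen_counting_usc z c : unit_disc z -> phi 0 <> z -> (u z < c%:E)%E ->
  cnbhs z [set w | (u w < c%:E)%E].
Proof.
move=> zd phi0 uz; apply: contrapT => nbz.
(* Keeps the whole sequence inside the disc and away from [phi 0], where [jensen_mass] applies. *)
pose d := Num.min (1 - cmod z) (cmod (phi 0 - z)).
have d0 : 0 < d.
  by rewrite lt_min subr_gt0 cmod_gt0 subr_eq0; apply/andP; split=> //; exact/eqP.
have /choice[f hf] : forall n, exists w, cmod (w - z) < d / n.+1%:R /\ (c%:E <= u w)%E.
  move=> n; apply: contrapT => nf; apply: nbz; apply/nbhs_cmod.
  exists (d / n.+1%:R); first by rewrite divr_gt0.
  by move=> w wz; rewrite /= ltNge; apply/negP => cw; apply: nf; exists w.
have fd n : cmod (f n - z) < d.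
  by apply: (lt_le_trans (hf n).1); rewrite ler_pdivrMr// ler_peMr ?ler1n// ltW.
have [fdisc fphi] : (forall n, unit_disc (f n)) /\ (forall n, phi 0 <> f n).
  split=> n; have := fd n; rewrite lt_min => /andP[h1 h2].
    by change (cmod (f n) < 1); have := cmod_leB (f n) z; lra.
  by move=> e; rewrite -e in h2; move: h2; rewrite ltxx.
have fz : (fun n => cmod (f n - z)) @ \oo --> 0.
  have dn : (fun n => d * n.+1%:R^-1) @ \oo --> 0.
    rewrite -[X in _ --> X](mulr0 d); apply: cvgM; first exact: cvg_cst.
    exact: cvg_harmonic.
  apply: (squeeze_cvgr _ (@cvg_cst _ (0 : R) _ _ _) dn).
  by apply: nearW => n; rewrite cmod_ge0 ltW// (hf n).1.
have kVf : kV (f n) @[n --> \oo] --> kV z.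
  apply: cvgeZr => //; apply: kap_cvg; [by move=> n; exact: cmod_ge0|exact: cmod_ge0|].
  exact: cvg_dist.
have If n : (I (f n) <= kV (f n) - c%:E)%E.
  rewrite leeBrDr// /kV -(jensen_mass (fdisc n) (fphi n)) addeC leeD2rE ?Ifin//.
  exact: (hf n).2.
have lim : (limn_einf (fun n => I (f n)) <= kV z - c%:E)%E.
  apply: (limn_einf_le If); apply: cvgeB kVf _; last exact: cvg_cst.
  exact: fin_num_adde_defl.
have F : (I z <= limn_einf (fun n => I (f n)))%E.
  apply: le_trans (@fatou _ _ R nu _ mpolar (fun n p => mass (f n) p)
    (fun n => @mmass (f n)) (fun n p _ => mass_ge0 _ _)).
  rewrite le_eqVlt; apply/orP; left; apply/eqP; apply: eq_integral => p _.
  apply/esym.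
  have h : mass (f n) p @[n --> \oo] --> mass z p.
    apply: cvgeZl => //; apply: kap_cvg; [by move=> n; exact: cmod_ge0|exact: cmod_ge0|].
    exact: cvg_dist.
  by rewrite is_cvg_limn_einfE; [exact: cvg_lim h|apply/cvg_ex; eexists; exact: h].
move: uz; apply/negP; rewrite -leNgt.
have := le_trans F lim; rewrite leeBrDr// /kV -(jensen_mass zd phi0) addeC.
by rewrite leeD2rE// Ifin.
Qed.

(** In [u + I = kV] the mean of [kV] is its value at [a], as [phi 0] lies outside the closed disc,
    while the mean of [I] is at most [I a]; finiteness of [I a] then allows the cancellation. *)
Lemma gen_counting_submean a r : 0 < r ->
  (forall w, cmod (w - a) <= r -> unit_disc w /\ phi 0 <> w) ->
  (u a <= ((2 * pi)^-1)%:E * \int[mu]_(t in angles) u (a + circ r t)%R)%E.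
Proof.
move=> r0 inside.
have [ad aphi] : unit_disc a /\ phi 0 <> a by apply: inside; rewrite subrr cmod0 ltW.
have a1 : cmod a < 1 by exact: ad.
have zt t : unit_disc (a + circ r t) /\ phi 0 <> a + circ r t.
  by apply: inside; rewrite addrC addrA addNr add0r cmod_circ// ltW.
(* The range required by [kap_sub_mean]; as [|w| < 1], it follows from [|a| + r <= 1]. *)
have dist w : unit_disc w -> cmod (w - a) + r <= 2.
  move=> wd; suff ar : cmod a + r <= 1.
    by have w1 : cmod w < 1 := wd; have := cmodD w (- a); rewrite cmodN; lra.
  have [a0|a0] := eqVneq a 0.
    have [+ _] := zt 0; rewrite a0 add0r; change (cmod (circ r 0) < 1 -> cmod (0 : R[i]) + r <= 1).
    by rewrite cmod_circ ?cmod0 ?(ltW r0)//; lra.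
  have ca : 0 < cmod a by rewrite cmod_gt0.
  (* The point of the closed disc farthest from the origin, of modulus [|a| + r]. *)
  have [|+ _] := inside (a + (r / cmod a)%:C * a).
    rewrite addrC addrA addNr add0r cmodM cmod_real gtr0_norm ?divr_gt0//.
    by rewrite divfK// gt_eqF.
  change (cmod (a + (r / cmod a)%:C * a) < 1 -> cmod a + r <= 1).
  rewrite -{1}(mul1r a) -mulrDl -(rmorph1 (real_complex R)) -rmorphD /=.
  rewrite cmodM cmod_real gtr0_norm ?addr_gt0 ?divr_gt0// mulrDl mul1r divfK ?gt_eqF//.
  exact: ltW.
have mang : measurable angles by exact: measurable_itv.
have dB w t : w - (a + circ r t) = w - a - circ r t by rewrite opprD addrA.
have two_pi : (0 <= (2 * pi)%:E :> \bar R)%E by rewrite lee_fin ltW// angles_gt0.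
have wa : r < cmod (phi 0 - a).
  rewrite ltNge; apply/negP => h; have [_] := inside _ h; exact.
have d0 : unit_disc (phi 0).
  by apply: hphi.2; change (cmod (0 : R[i]) < 1); rewrite cmod0 ltr01.
have mX : measurable_fun setT (fun t => Re a + r * cos t).
  apply: measurable_funD => //; apply: measurable_funM => //.
  by apply: continuous_measurable_fun; exact: continuous_cos.
have mY : measurable_fun setT (fun t => Im a + r * sin t).
  apply: measurable_funD => //; apply: measurable_funM => //.
  by apply: continuous_measurable_fun; exact: continuous_sin.
have aE t : a + circ r t = (Re a + r * cos t) +i* (Im a + r * sin t) by case: (a).
have mk w : measurable_fun angles (fun t => kap (cmod (w - (a + circ r t))%R)).
  have := measurable_kap_cmod
    (measurable_funB (@measurable_cst _ _ _ _ angles (Re w)) (measurable_funTS mX))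
    (measurable_funB (@measurable_cst _ _ _ _ angles (Im w)) (measurable_funTS mY)).
  congr measurable_fun; apply/funext => t.
  have -> : w - (a + circ r t) = (Re w - (Re a + r * cos t)) +i*
      (Im w - (Im a + r * sin t)) by rewrite aE; case: w.
  by [].
have kmean : (\int[mu]_(t in angles) kV (a + circ r t)%R = (2 * pi)%:E * kV a)%E.
  rewrite /kV (ge0_integralZr mu mang (mk _) _ V0); last by move=> t _; exact: kap_ge0.
  rewrite muleA -(mean_kap_out r0 wa (dist _ d0)).
  by congr (_ * _)%E; apply: eq_integral => t _; rewrite dB.
pose F p t := mass (a + circ r t) p.
have mF : measurable_fun (polar `*` angles) (fun q => F q.1 q.2).
  have sub : fst @` (polar `*` angles) `<=` polar by move=> _ [q [h _] <-].
  have := @measurable_mass _ _ (polar `*` angles) fst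
    (fun q => Re a + r * cos q.2) (fun q => Im a + r * sin q.2)
    (measurable_funTS measurable_fst) sub
    (measurable_funTS (measurableT_comp mX measurable_snd))
    (measurable_funTS (measurableT_comp mY measurable_snd)).
  by congr measurable_fun; apply/funext => q; rewrite /F aE.
have F0 p t : polar p -> angles t -> (0 <= F p t)%E by move=> _ _; exact: mass_ge0.
have mI : measurable_fun angles (fun t => I (a + circ r t)).
  exact: (@measurable_tonelli_rect2 _ _ _ _ R (area R) _ _ F mpolar mang mF F0).
have Imean : (\int[mu]_(t in angles) I (a + circ r t)%R <= (2 * pi)%:E * I a)%E.
  rewrite /I -(@tonelli_rect _ _ _ _ R (area R) mu _ _ F mpolar mang mF F0).
  rewrite -(ge0_integralZl nu mpolar (@mmass a) (fun p _ => mass_ge0 _ _) two_pi).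
  apply: ge0_le_integral => //.
  - by move=> p Ap; apply: integral_ge0 => t; exact: F0.
  - exact: (@measurable_tonelli_rect1 _ _ _ _ R mu _ _ F mpolar mang mF F0).
  - exact: (emeasurable_funM (@measurable_cst _ _ _ _ polar ((2 * pi)%:E : \bar R)) (@mmass a)).
  move=> p Ap; rewrite /F /mass.
  rewrite (ge0_integralZl_EFin mu mang (fun t _ => kap_ge0 _) (mk _) (pdens_ge0 p)).
  rewrite muleCA; apply: lee_wpmul2l; first by rewrite lee_fin pdens_ge0.
  under eq_integral do rewrite dB.
  apply: kap_sub_mean => //; apply: dist; apply: hphi.2; exact: polar_disc.
have uE t : u (a + circ r t) = (kV (a + circ r t)%R - I (a + circ r t)%R)%E.
  by rewrite /kV -(jensen_mass (zt t).1 (zt t).2) addeK// Ifin//; case: (zt t).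
(* Measurability of [u] on the circle is read off the difference [kV - I], not off the sum over
   preimages, whose index set varies with [t]. *)
have mgen : measurable_fun angles (fun t => u (a + circ r t)).
  apply: (@eq_measurable_fun _ _ _ _ angles
    (fun t => kV (a + circ r t)%R - I (a + circ r t)%R)%E); first by move=> t _; rewrite uE.
  apply: emeasurable_funB mI.
  exact: (emeasurable_funM (mk _) (@measurable_cst _ _ _ _ angles V)).
have sum : (\int[mu]_(t in angles) u (a + circ r t)%R +
    \int[mu]_(t in angles) I (a + circ r t)%R = (2 * pi)%:E * (u a + I a))%E.
  rewrite -(ge0_integralD mu mang _ mgen _ mI); last 2 first.
  - by move=> t _; apply: gen_counting_ge0; case: (zt t).
  - by [].
  rewrite (jensen_mass ad aphi) -/(kV a) -kmean; apply: eq_integral => t _.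
  by rewrite (jensen_mass (zt t).1 (zt t).2).
rewrite -(@lee_pmul2l _ (2 * pi)%:E) ?lte_fin ?angles_gt0//.
rewrite muleA -EFinM mulfV ?mul1e ?gt_eqF ?angles_gt0//.
have If : ((2 * pi)%:E * I a)%E \is a fin_num by rewrite fin_numM// Ifin.
rewrite -(leeD2rE _ _ If) -muleDr//; last first.
  by rewrite fin_num_adde_defl// Ifin.
by rewrite -sum leeD2l.
Qed.

End LogMass.

Theorem lemma14 (R : realType) (phi : R[i] -> R[i]) (v : R[i] -> R)
    (hphi : analytic_self_map phi) (hv : radial_weight v) :
  (forall z : R[i], unit_disc z -> z <> phi 0 ->
    [/\ gen_counting phi (vstar v) z =
          (\int[lebesgue_measure]_(s in `]0%R, 1%R[)
             (partial_counting phi s z * (v s%:C * s)%:E))%E,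
        preimages phi z !=set0 -> is_min_preimage phi z (min_preimage phi z) &
        gen_counting phi (vstar v) z =
          (\int[lebesgue_measure]_(r in `]cmod (min_preimage phi z), 1%R[)
             (num_preimages phi r z * (r^-1)%:E *
              hat (fun w => (v w * cmod w)%R) r))%E]) /\
  subharmonic_on (unit_disc `\` [set phi 0]) (gen_counting phi (vstar v)).
Proof.
have ne z : z <> phi 0 -> phi 0 <> z by move=> h e; apply: h.
split=> [z zd /ne zphi|]; split.
- rewrite (gen_counting_partial hv hphi zphi); apply: eq_integral => s /set_mem /itvP s01.
  by rewrite /wdens !s01.
- exact: min_preimageP.
- exact: gen_counting_num.
- move=> z [zd /ne zphi]; have := gen_counting_fin hphi hv zd zphi.
  by rewrite fin_numElt => /andP[].
- by move=> z c [zd /ne zphi]; exact: gen_counting_usc.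
- move=> a rho rho0 inside.
  by apply: (gen_counting_submean hphi hv rho0) => w /inside[wd /ne].
Qed.
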